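(* Let $P$ be a projective left $\Lambda$-module of finite $K$-dimension $r$, and let $m,d$ be natural numbers with $r=m+d$. There is an inclusion-preserving one-to-one correspondence between the $\operatorname{Aut}_\Lambda(P)$-stable subsets of $\operatorname{Sub}^m_P$ and the $\operatorname{GL}_d$-stable subsets of $\operatorname{Fac}^d_P$ given by $M\mapsto\sigma\rho^{-1}(M)$. Both ways, this correspondence preserves openness, closures, connected and irreducible components, as well as types of singularities. Furthermore, an $\operatorname{Aut}_\Lambda(P)$-stable subvariety $M$ of $\operatorname{Sub}^m_P$ admits a geometric quotient by $\operatorname{Aut}_\Lambda(P)$ if and only if the corresponding $\operatorname{GL}_d$-stable subvariety of $\operatorname{Fac}^d_P$ admits a geometric quotient by the $\operatorname{GL}_d$-action; in the positive case, both of these quotients are isomorphic to the geometric quotient of $\rho^{-1}(M)$ by $\operatorname{Aut}_\Lambda(P)\times\mathcal{H}$.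
   Context: $K$ is an algebraically closed field and $\Lambda=K\Gamma/I$ is a basic finite dimensional $K$-algebra, the path algebra of a finite quiver $\Gamma$ modulo an admissible ideal $I$. Let $\Gamma^*$ be the set of vertices and arrows of $\Gamma$. For $n\in\mathbb{N}$, $\operatorname{Mod}_\Lambda^n$ is the affine variety of points $x=(\alpha(x))_{\alpha\in\Gamma^*}\in\prod_{\alpha\in\Gamma^*}M_n(K)$ satisfying the relations of $\Lambda$ (i.e. defining a left $\Lambda$-module structure on $K^n$), with $\operatorname{GL}_n$ acting by simultaneous conjugation. Let $p=(\alpha(p))_{\alpha\in\Gamma^*}\in\operatorname{Mod}_\Lambda^r$ be a point representing $P$, and identify $P$ with $K^r$ accordingly, so that $\operatorname{Aut}_\Lambda(P)\subseteq\operatorname{GL}_r$. - $\operatorname{Sub}^m_P$ is the closed subset of the Grassmannian $\mathcal{G}_m(K^r)$ consisting of all $m$-dimensional $\Lambda$-submodules of $P$, with the natural $\operatorname{Aut}_\Lambda(P)$-action. - $\operatorname{Fac}^d_P$ is the open subvariety of $\operatorname{Mod}_\Lambda^d$ consisting of the points that represent $d$-dimensional homomorphic images of $P$, with the $\operatorname{GL}_d$-conjugation action. - $B^{m,d}_P$ is the closed subvariety of $\operatorname{GL}_r$ of those matrices whose first $m$ columns span a $\Lambda$-submodule of $P$. - $\mathcal{H}\le\operatorname{GL}_r$ is the subgroup of block matrices $\begin{pmatrix}h_1&h_2\\0&h_3\end{pmatrix}$ with $h_1\in\operatorname{GL}_m$, $h_3\in\operatorname{GL}_d$. The group $\operatorname{Aut}_\Lambda(P)\times\mathcal{H}$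 acts on $B^{m,d}_P$ from the right by $b(f,h)=f^{-1}bh$. - $\rho:B^{m,d}_P\to\operatorname{Sub}^m_P$ sends $b$ to the span of its first $m$ columns. - $\operatorname{pr}:M_r(K)\to M_d(K)$ sends a matrix to its lower right $d\times d$ block, and $\sigma:B^{m,d}_P\to\operatorname{Fac}^d_P$ is the surjective morphism $b\mapsto(\operatorname{pr}(b^{-1}\alpha(p)b))_{\alpha\in\Gamma^*}$; the point $\sigma(b)$ represents $P/\rho(b)$. Types of singularities are understood up to smooth equivalence: pointed varieties $(X,x)$ and $(Y,y)$ have the same type of singularity if there are a variety $Z$, a point $z\in Z$ and smooth morphisms $Z\to X$, $Z\to Y$ sending $z$ to $x$ and to $y$, respectively; for corresponding subvarieties the points compared are $\rho(b)$ and $\sigma(b)$ for $b\in B^{m,d}_P$. Geometric quotient: if a linear algebraic group $H$ acts morphically on a variety $X$, a geometric quotient of $X$ modulo $H$ is a surjective open morphism $\phi:X\to Y$ of varieties whose fibres are exactly the $H$-orbits and such that for every open $U\subseteq Y$ the comorphism induces an isomorphism from $\mathcal{O}_Y(U)$ onto the ring of those regular functions on $\phi^{-1}(U)$ that are constant on $H$-orbits. *)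

(* Defs.v *)
From HB Require Import structures.
From mathcomp Require Import all_boot all_order all_algebra.
From mathcomp Require Import monalg.
From mathcomp Require mpoly.
From mathcomp Require Import finmap.
From mathcomp Require Import boolp classical_sets functions filter topology.

Set Implicit Arguments.
Unset Strict Implicit.
Unset Printing Implicit Defensive.

Import GRing.Theory.
Local Open Scope classical_set_scope.
Local Open Scope ring_scope.

Record quiver := Quiver {
  vertex : finType;
  arrow : finType;
  src : arrow -> vertex;
  tgt : arrow -> vertex }.

Definition qstar (Q : quiver) : finType := (vertex Q + arrow Q)%type.

Section Paths.
Context {Q : quiver}.

(** [chain v s]: the arrows of [s], listed in the order in which they are
    traversed, form a path starting at [v]; [chain_end v s] is its end. *)
Fixpoint chain (v : vertex Q) (s : seq (arrow Q)) : bool :=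
  if s is a :: s' then (src a == v) && chain (tgt a) s' else true.

Fixpoint chain_end (v : vertex Q) (s : seq (arrow Q)) : vertex Q :=
  if s is a :: s' then chain_end (tgt a) s' else v.

Lemma chain_cat v s t :
  chain v (s ++ t) = chain v s && chain (chain_end v s) t.
Proof. by elim: s v => //= a s IHs v; rewrite IHs andbA. Qed.

Record qpath := QPath {
  qpath_val : vertex Q * seq (arrow Q);
  qpathP : chain qpath_val.1 qpath_val.2 }.

HB.instance Definition _ := [isSub for qpath_val].
HB.instance Definition _ := [Choice of qpath by <:].

Definition qstart (p : qpath) : vertex Q := (qpath_val p).1.
Definition qarrows (p : qpath) : seq (arrow Q) := (qpath_val p).2.
Definition qend (p : qpath) : vertex Q := chain_end (qstart p) (qarrows p).
Definition qlength (p : qpath) : nat := size (qarrows p).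

Fact qcomp_subproof (p q : qpath) : qend q = qstart p ->
  chain (qstart q, qarrows q ++ qarrows p).1
        (qstart q, qarrows q ++ qarrows p).2.
Proof.
by move=> e; rewrite /= chain_cat [chain_end _ _]e; apply/andP; split;
  exact: qpathP.
Qed.

(** The path "first [q], then [p]", written [pq] for left modules. *)
Definition qcomp (p q : qpath) (e : qend q = qstart p) : qpath :=
  QPath (qcomp_subproof e).

End Paths.
Arguments qpath : clear implicits.

Section PathAlgebra.
Context {K : fieldType} {Q : quiver}.

(** The underlying vector space of the path algebra KQ is the space of finitely
    supported functions on the set of paths. *)
Definition pathalg := {malg K[qpath Q]}.

Definition qpath_mul (p q : qpath Q) : pathalg :=
  match @eqP _ (qend q) (qstart p) with
  | ReflectT e => << qcomp e >>
  | ReflectF _ => 0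
  end.

Definition pathalg_mul (x y : pathalg) : pathalg :=
  \sum_(p <- msupp x) \sum_(q <- msupp y)
    (x@_p * y@_q) *: qpath_mul p q.

Definition two_sided_ideal (I : set pathalg) : Prop :=
  [/\ I 0, forall x y, I x -> I y -> I (x + y) &
      forall x a, I x -> I (pathalg_mul a x) /\ I (pathalg_mul x a)].

(** The [k]-th power of the ideal generated by the arrows is spanned by the
    paths of length at least [k]. *)
Definition arrow_ideal_pow (k : nat) : set pathalg :=
  [set x | forall p, p \in msupp x -> (k <= qlength p)%N].

Definition admissible (I : set pathalg) : Prop :=
  [/\ two_sided_ideal I, I `<=` arrow_ideal_pow 2 &
      exists L : nat, arrow_ideal_pow L `<=` I].

(** A family of endomorphisms indexed by vertices and arrows acts on [V]; a path
    acts through its starting vertex first, then through its arrows in order of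
    traversal. *)
Definition qpath_act (V : lmodType K) (act : qstar Q -> {linear V -> V})
    (p : qpath Q) (v : V) : V :=
  foldl (fun w a => act (inr a) w) (act (inl (qstart p)) v) (qarrows p).

(** A left module over [KQ / I], given by the action of vertices and arrows. *)
Definition is_module (I : set pathalg) (V : lmodType K)
    (act : qstar Q -> {linear V -> V}) : Prop :=
  [/\ forall i j v,
        act (inl i) (act (inl j) v) = if i == j then act (inl i) v else 0,
      forall v, \sum_i act (inl i) v = v,
      forall a v, act (inl (tgt a)) (act (inr a) v) = act (inr a) v,
      forall a v, act (inr a) (act (inl (src a)) v) = act (inr a) v &
      forall x, I x -> forall v,
        \sum_(p <- msupp x) x@_p *: qpath_act act p v = 0].

Definition is_hom (V W : lmodType K) (actV : qstar Q -> {linear V -> V})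
    (actW : qstar Q -> {linear W -> W}) (f : {linear V -> W}) : Prop :=
  forall a v, f (actV a v) = actW a (f v).

Definition projective (I : set pathalg) (V : lmodType K)
    (act : qstar Q -> {linear V -> V}) : Prop :=
  is_module I act /\
  forall (M N : lmodType K) (actM : qstar Q -> {linear M -> M})
         (actN : qstar Q -> {linear N -> N}),
    is_module I actM -> is_module I actN ->
  forall (g : {linear M -> N}) (f : {linear V -> N}),
    is_hom actM actN g -> (forall n, exists m, g m = n) -> is_hom act actN f ->
  exists2 h : {linear V -> M}, is_hom act actM h & forall v, g (h v) = f v.

Definition qpoint (n : nat) := {ffun qstar Q -> 'M[K]_n}.

Definition qpoint_act (n : nat) (x : qpoint n) (a : qstar Q) :
  {linear 'cV[K]_n -> 'cV[K]_n} := mulmx (x a).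

End PathAlgebra.
Arguments pathalg : clear implicits.
Arguments qpoint : clear implicits.

(** A space with functions is a topological space together with, at each point,
    the functions which are regular at that point.  Functions are total; only
    their germ at the point matters.  A function is regular on an open set when
    it is regular at each of its points. *)

Record kspace (K : fieldType) := Space {
  points :> topologicalType;
  regular_at : points -> (points -> K) -> Prop;
  regular_at_near : forall x f g,
    (\forall y \near x, f y = g y) -> regular_at x f -> regular_at x g }.

Section Spaces.
Context {K : fieldType}.
Implicit Types X Y : kspace K.

Definition regular_on X (U : set X) (f : X -> K) : Prop :=
  forall x, U x -> regular_at x f.

Definition kmorphism X Y (phi : X -> Y) : Prop :=
  continuous phi /\
  forall x g, regular_at (phi x) g -> regular_at x (g \o phi).

Definition isomorphism X Y (phi : X -> Y) : Prop :=
  exists psi : Y -> X,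
    [/\ kmorphism phi, kmorphism psi, cancel phi psi & cancel psi phi].

Definition isomorphic X Y : Prop := exists phi : X -> Y, isomorphism phi.

(** The induced structure on a subset: regular functions are locally
    restrictions of regular functions. *)
Section Subspace.
Context {X : kspace K} (A : set X).

Definition sub_regular_at (x : A) (f : A -> K) : Prop :=
  exists2 g : X -> K, regular_at (val x) g & \forall y \near x, f y = g (val y).

Fact sub_regular_at_near x f g :
  (\forall y \near x, f y = g y) -> sub_regular_at x f -> sub_regular_at x g.
Proof.
move=> fg [h hx fh]; exists h => //.
by apply: filterS2 fg fh => y /= <- .
Qed.

Definition sub_space : kspace K := @Space K A sub_regular_at sub_regular_at_near.
End Subspace.

(** The coordinate ring of [V], as the algebra of functions generated by the
    linear forms; this avoids the choice of a basis. *)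
Inductive polyfun (V : lmodType K) : (V -> K) -> Prop :=
| polyfun_cst c : polyfun (fun=> c)
| polyfun_lin (l : {scalar V}) : polyfun l
| polyfun_add f g : polyfun f -> polyfun g -> polyfun (fun v => f v + g v)
| polyfun_mul f g : polyfun f -> polyfun g -> polyfun (fun v => f v * g v).

Definition zariski (V : vectType K) : Type := V.

Section Affine.
Context (V : vectType K).

HB.instance Definition _ := Choice.copy (zariski V) V.

Definition zariski_open : set (set (zariski V)) :=
  [set U | forall x, U x -> exists2 p : V -> K, polyfun p &
             p x != 0 /\ [set y | p y != 0] `<=` U].

Fact zariski_openT : zariski_open setT.
Proof.
by move=> x _; exists (fun=> 1); [exact: polyfun_cst | rewrite oner_neq0].
Qed.

Fact zariski_openI : setI_closed zariski_open.
Proof.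
move=> A B oA oB x [/oA[p pp [px pA]] /oB[q pq [qx qB]]].
exists (fun v => p v * q v); first exact: polyfun_mul.
split=> [|y /=]; rewrite mulf_eq0 negb_or; first exact/andP.
by case/andP=> py qy; split; [exact: pA | exact: qB].
Qed.

Fact zariski_open_bigU (I : Type) (f : I -> set (zariski V)) :
  (forall i, zariski_open (f i)) -> zariski_open (\bigcup_i f i).
Proof.
move=> of_ x [i _ /of_[p pp [px pf]]]; exists p => //; split=> // y /pf fy.
by exists i.
Qed.

HB.instance Definition _ := isOpenTopological.Build (zariski V)
  zariski_openT zariski_openI zariski_open_bigU.

Definition affine_regular_at (x : zariski V) (f : zariski V -> K) : Prop :=
  exists p q : V -> K, [/\ polyfun p, polyfun q, q x != 0 &
    \forall y \near x, f y = p y / q y].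

Fact affine_regular_at_near x f g : (\forall y \near x, f y = g y) ->
  affine_regular_at x f -> affine_regular_at x g.
Proof.
move=> fg [p [q [pp pq qx fpq]]]; exists p, q; split=> //.
by apply: filterS2 fg fpq => y /= <-.
Qed.

Definition affine_space : kspace K :=
  @Space K (zariski V) affine_regular_at affine_regular_at_near.

End Affine.

(** [grassmannian V] is the disjoint union of the Grassmannians of [V] for all
    dimensions, glued from the usual affine charts: for each decomposition of
    [V] as a direct sum of [W] and [C], the chart sends a linear map from [W] to
    [C] to its graph. *)

Definition vspaces (V : vectType K) : Type := {vspace V}.

Section Grassmannian.
Context (V : vectType K).

HB.instance Definition _ := Choice.copy (vspaces V) {vspace V}.

Definition complementary (W C : {vspace V}) : Prop :=
  (W + C = fullv)%VS /\ (W :&: C = 0)%VS.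

Definition graph_chart (W C : {vspace V})
    (A : affine_space 'Hom(subvs_of W, subvs_of C)) : vspaces V :=
  limg (linfun (fun w : subvs_of W => vsval w + vsval (fun_of_lfun A w))).

Definition grass_open : set (set (vspaces V)) :=
  [set U | forall W C, complementary W C -> open (@graph_chart W C @^-1` U)].

Fact grass_openT : grass_open setT.
Proof. by move=> W C _; rewrite preimage_setT; exact: openT. Qed.

Fact grass_openI : setI_closed grass_open.
Proof.
move=> A B oA oB W C cWC; rewrite preimage_setI.
by apply: openI; [exact: oA | exact: oB].
Qed.

Fact grass_open_bigU (I : Type) (f : I -> set (vspaces V)) :
  (forall i, grass_open (f i)) -> grass_open (\bigcup_i f i).
Proof.
move=> of_ W C cWC; rewrite preimage_bigcup.
by apply: bigcup_open => i _; exact: of_.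
Qed.

HB.instance Definition _ := isOpenTopological.Build (vspaces V)
  grass_openT grass_openI grass_open_bigU.

Definition grass_regular_at (U : vspaces V) (f : vspaces V -> K) : Prop :=
  forall W C (A : affine_space 'Hom(subvs_of W, subvs_of C)),
    complementary W C -> graph_chart A = U ->
    regular_at A (f \o @graph_chart W C).

Fact graph_chart_continuous W C :
  complementary W C -> continuous (@graph_chart W C).
Proof. by move=> cWC; apply/continuousP => U oU; exact: oU. Qed.

Fact grass_regular_at_near (U : vspaces V) f g :
  (\forall U' \near U, f U' = g U') ->
  grass_regular_at U f -> grass_regular_at U g.
Proof.
move=> fg rf W C A cWC AU; apply: regular_at_near (rf W C A cWC AU).
by rewrite -AU in fg; exact: (graph_chart_continuous cWC fg).
Qed.

Definition grassmannian : kspace K :=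
  @Space K (vspaces V) grass_regular_at grass_regular_at_near.

End Grassmannian.

Definition affine_variety X : Prop :=
  exists (n : nat) (A : set (affine_space 'rV[K]_n)),
    closed A /\ isomorphic X (sub_space A).

Definition prevariety X : Prop :=
  exists (n : nat) (U : 'I_n -> set X),
    (forall i, open (U i) /\ affine_variety (sub_space (U i))) /\
    \bigcup_i U i = setT.

Definition separated_space X : Prop :=
  forall (Z : kspace K) (f g : Z -> X),
    prevariety Z -> kmorphism f -> kmorphism g -> closed [set z | f z = g z].

Definition variety X : Prop := prevariety X /\ separated_space X.

(** [M] is a subvariety of [A] (both subsets of [X]). *)
Definition locally_closed_in X (A M : set X) : Prop :=
  exists O F : set X, [/\ open O, closed F & M = A `&` O `&` F].

(** Jacobian criterion: locally on source and target, [phi] is an open immersion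
    into the zero locus of [f_1, ..., f_c] in [A * K^n] (with [A] affine, closed
    in [K^N]) followed by the projection to [A], and the Jacobian matrix of
    [f_1, ..., f_c] with respect to the last [n] coordinates has rank [c]. *)
Definition smooth_at X Y (phi : X -> Y) (x : X) : Prop :=
  exists (V : set X) (U : set Y) (N n c : nat)
    (A : set (affine_space 'rV[K]_N)) (O : set (affine_space 'rV[K]_(N + n)))
    (f : 'I_c -> mpoly.mpoly (N + n) K),
  let E : set (affine_space 'rV[K]_(N + n)) :=
    [set s | [/\ O s, A (lsubmx s) &
                 forall i, mpoly.meval (fun k => s 0 k) (f i) = 0]] in
  [/\ [/\ open V, V x, open U & phi @` V `<=` U],
      closed A /\ open O,
      forall s, E s -> \rank (\matrix_(i < c, j < n)
        mpoly.meval (fun k => s 0 k) (mpoly.mderiv (rshift N j) (f i))) = c &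
      exists (u : sub_space U -> sub_space A) (v : sub_space V -> sub_space E),
        [/\ isomorphism u, isomorphism v &
            forall (z : V) (y : U), phi (val z) = val y ->
              lsubmx (val (v z)) = val (u y)]].

Definition smooth X Y (phi : X -> Y) : Prop :=
  kmorphism phi /\ forall x, smooth_at phi x.

Definition same_singularity X (x : X) Y (y : Y) : Prop :=
  exists (Z : kspace K) (z : Z) (phi : Z -> X) (psi : Z -> Y),
    [/\ variety Z, smooth phi, smooth psi, phi z = x & psi z = y].

(** A geometric quotient with respect to the orbit relation [orb].  The
    comorphism is injective since [phi] is surjective, so only its surjectivity
    onto the invariant regular functions is stated. *)
Definition geometric_quotient X (orb : X -> X -> Prop) Y (phi : X -> Y) : Prop :=
  [/\ variety Y /\ kmorphism phi,
      forall y, exists x, phi x = y,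
      forall U, open U -> open (phi @` U),
      forall x x', phi x = phi x' <-> orb x x' &
      forall U, open U -> forall g : X -> K, regular_on (phi @^-1` U) g ->
        (forall x x', U (phi x) -> orb x x' -> g x = g x') ->
        exists2 f : Y -> K, regular_on U f &
          forall x, U (phi x) -> f (phi x) = g x].

(** A subset [M] of [X] with the induced structure has the geometric quotient
    [phi : M -> Y] for a relation given on [X]. *)
Definition sub_quotient X (orb : X -> X -> Prop) (M : set X) Y
    (phi : sub_space M -> Y) : Prop :=
  @geometric_quotient (sub_space M) (fun x x' : M => orb (val x) (val x')) Y phi.

End Spaces.

Definition stable_subset (T : Type) (orb : T -> T -> Prop) (A : set T) :
  set (set T) :=
  [set M | M `<=` A /\ forall x y, M x -> orb x y -> M y].

(** Openness and closure of a subset of [A] in the induced topology of [A]. *)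
Definition open_in (T : topologicalType) (A M : set T) : Prop :=
  @open (subspace A) M.

Definition closure_in (T : topologicalType) (A M : set T) : set T :=
  @closure (subspace A) M.

Definition is_connected_component (T : topologicalType) (A C : set T) : Prop :=
  exists2 x, A x & C = connected_component A x.

Definition irreducible_set (T : topologicalType) (C : set T) : Prop :=
  C !=set0 /\ forall F G : set T, closed F -> closed G ->
    C `<=` F `|` G -> C `<=` F \/ C `<=` G.

Definition is_irreducible_component (T : topologicalType) (A C : set T) : Prop :=
  [/\ C `<=` A, irreducible_set C &
      forall D, D `<=` A -> irreducible_set D -> C `<=` D -> D = C].

(** The module P is [K^(m + d)] (column vectors) with the structure given by the
    point [p]; subspaces of P of dimension [m] have quotients of dimension [d]. *)
Section SubFac.
Context {K : closedFieldType} {Q : quiver} (I : set (pathalg K Q)).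

Definition Mod (n : nat) : set (affine_space (qpoint K Q n)) :=
  [set x | is_module I (qpoint_act x)].
Arguments Mod : clear implicits.

Context {m d : nat} (p : qpoint K Q (m + d)).

Definition is_submodule (U : {vspace 'cV[K]_(m + d)}) : Prop :=
  forall a v, v \in U -> p a *m v \in U.

Definition Aut_P : set 'M[K]_(m + d) :=
  [set f | f \in unitmx /\ forall a, f *m p a = p a *m f].

Definition Sub_P : set (grassmannian 'cV[K]_(m + d)) :=
  [set U | \dim U = m /\ is_submodule U].

Definition Sub_orbit (U U' : grassmannian 'cV[K]_(m + d)) : Prop :=
  exists2 f, Aut_P f & U' = (linfun (mulmx f) @: U)%VS.

Definition Fac_P : set (affine_space (qpoint K Q d)) :=
  [set x | Mod d x /\ exists2 g : {linear 'cV[K]_(m + d) -> 'cV[K]_d},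
     is_hom (qpoint_act p) (qpoint_act x) g & forall w, exists v, g v = w].

Definition Fac_orbit (x x' : affine_space (qpoint K Q d)) : Prop :=
  exists2 g : 'M[K]_d, g \in unitmx & x' = [ffun a => g *m x a *m invmx g].

Definition rho (b : affine_space 'M[K]_(m + d)) :
    grassmannian 'cV[K]_(m + d) :=
  <<[seq col (lshift d i) b | i : 'I_m]>>%VS.

Definition B_P : set (affine_space 'M[K]_(m + d)) :=
  [set b | b \in unitmx /\ is_submodule (rho b)].

Definition parabolic : set 'M[K]_(m + d) :=
  [set h | exists h1 h2 h3, [/\ h1 \in unitmx, h3 \in unitmx &
                                h = block_mx h1 h2 0 h3]].

Definition B_orbit (b b' : affine_space 'M[K]_(m + d)) : Prop :=
  exists f h, [/\ Aut_P f, parabolic h & b' = invmx f *m b *m h].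

Definition sigma (b : affine_space 'M[K]_(m + d)) :
    affine_space (qpoint K Q d) :=
  [ffun a => drsubmx (invmx b *m p a *m b)].

Definition rho_inv (M : set (grassmannian 'cV[K]_(m + d))) :
    set (affine_space 'M[K]_(m + d)) := B_P `&` rho @^-1` M.

Definition corr (M : set (grassmannian 'cV[K]_(m + d))) :
    set (affine_space (qpoint K Q d)) := sigma @` rho_inv M.

End SubFac.
Arguments Mod {K Q} I n.

(* Main.v *)
(** Invert [b] and write [b^-1] as a block column [(c1; c2)].  Then [rho b] is a
    submodule if and only if [c2] is a homomorphism from [P] onto a module [X] on
    [K^d], and in this case [X = sigma b] and [rho b] is the kernel of [c2].  The
    map [rho] is the quotient by the parabolic group, hence locally a product.  As [P] is projective, there
    are projectors [T_X] of [M_(d, r)] onto [Hom(P, X)] depending polynomially on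
    [X]; they trivialize the bundle of the [Hom(P, X)] locally, so that [sigma] is
    locally an open piece of a projection with affine fibres.  Both maps therefore
    have regular local sections through every point and are smooth, which transports
    openness, closures and quotients.  An isomorphism of [P / U] with [P / U'] lifts
    to an automorphism of [P] because [End P] has stable range one, so that [rho] and
    [sigma] identify the orbits.  Components are transported since the orbits are
    irreducible. *)

From HB Require Import structures.
Require Import Defs.
From mathcomp Require Import all_boot all_order all_algebra.
From mathcomp Require Import boolp classical_sets functions filter topology.

Set Implicit Arguments.
Unset Strict Implicit.
Unset Printing Implicit Defensive.
Local Open Scope classical_set_scope.
Local Open Scope ring_scope.
Import GRing.Theory.

(** * Correspondences of stable subsets *)

(** The main obstacle is that Hom(P, X) has to vary polynomially with X. As [projective] allows test
    modules of infinite dimension, P can be lifted against a module made of polynomial families; one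
    splitting of evaluation then yields all the projectors T_X at once. There is no map between
    submodules and factors, only two maps out of [B_P]. The correspondence is therefore carried by a
    relation, [subfac], whose hypotheses are symmetric: each transport is proved in one direction
    and reversed with [stable_corr_sym]. What drives it is that both images of open sets are
    relatively open, and that orbits are irreducible, which forces relatively clopen pieces and
    components to be unions of orbits. The orbits are irreducible because the groups consist of the
    units of a linear space of matrices: two elements lie on a line, and two nonzero polynomials in
    one variable have a common nonroot over an algebraically closed field. Functions are total, and
    [rho] and [sigma] behave well only at invertible matrices. Hence morphisms and sections are
    handled point by point, with arbitrary values far away. *)

Lemma open_inP (T : topologicalType) (A M : set T) : M `<=` A ->
  (open_in A M <-> exists2 O, open O & M = A `&` O).
Proof.
move=> MA; rewrite /open_in open_subspaceP; split=> -[O].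
  by rewrite (setIidl MA) setIC => oO <-; exists O.
by move=> oO ->; exists O => //; rewrite setIAC setIid setIC.
Qed.

Lemma closure_inE (T : topologicalType) (A M : set T) : M `<=` A ->
  closure_in A M = A `&` closure M.
Proof. by move=> MA; rewrite setIC /closure_in closure_subspaceW. Qed.

Lemma irreducible_connected (T : topologicalType) (C : set T) :
  irreducible_set C -> connected C.
Proof.
move=> [_ irr] B [x Bx] [O oO BO] [F cF BF].
have : C `<=` F `|` ~` O.
  move=> y Cy; have [Oy|] := pselect (O y); last by right.
  by left; move: (conj Cy Oy : (C `&` O) y); rewrite -BO BF => -[].
case/(irr _ _ cF (open_closedC oO)) => h; first by rewrite BF; exact: setIidl.
by move: Bx; rewrite BO => -[/h].
Qed.

Lemma irreducible_meet (T : topologicalType) (C U V : set T) :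
  irreducible_set C -> open U -> open V -> C `&` U !=set0 -> C `&` V !=set0 ->
  C `&` (U `&` V) !=set0.
Proof.
move=> [_ irr] oU oV [x [Cx Ux]] [y [Cy Vy]]; apply: contrapT => h.
have : C `<=` ~` U `|` ~` V.
  move=> z Cz; have [Uz|] := pselect (U z); last by left.
  by right=> Vz; apply: h; exists z.
by case/(irr _ _ (open_closedC oU) (open_closedC oV)) => k;
  [exact: (k x) | exact: (k y)].
Qed.

Lemma irreducible_setP (T : topologicalType) (C : set T) : C !=set0 ->
  (forall U V : set T, open U -> open V -> C `&` U !=set0 -> C `&` V !=set0 ->
    C `&` (U `&` V) !=set0) -> irreducible_set C.
Proof.
move=> C0 h; split=> // F G cF cG CFG; apply: contrapT => /not_orP[nF nG].
have meet (H : set T) : ~ C `<=` H -> C `&` ~` H !=set0.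
  move=> nH; apply: contrapT => h0; apply: nH => x Cx.
  by apply: contrapT => nHx; apply: h0; exists x.
have [x [Cx [nFx nGx]]] :=
  h _ _ (closed_openC cF) (closed_openC cG) (meet _ nF) (meet _ nG).
by case: (CFG _ Cx).
Qed.

Definition rel_image (T1 T2 : Type) (E : T1 -> T2 -> Prop) (M : set T1) :
  set T2 := [set y | exists2 x, M x & E x y].

(** Abstract form of two open surjections with a common source: [E x y] says that some point of the
    source lies over both [x] and [y]. The fields [sc_open1] and [sc_open2] combine the continuity
    of one surjection with the openness of the other. *)
Record stable_corr (T1 T2 : topologicalType) (A1 : set T1) (A2 : set T2)
    (orb1 : T1 -> T1 -> Prop) (orb2 : T2 -> T2 -> Prop)
    (E : T1 -> T2 -> Prop) : Prop := StableCorr {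
  sc_dom1 : forall x y, E x y -> A1 x;
  sc_dom2 : forall x y, E x y -> A2 y;
  sc_tot1 : forall x, A1 x -> exists y, E x y;
  sc_tot2 : forall y, A2 y -> exists x, E x y;
  sc_orb1 : forall x y x', E x y -> orb1 x x' <-> E x' y;
  sc_orb2 : forall x y y', E x y -> orb2 y y' <-> E x y';
  sc_open1 : forall O, open O ->
    exists2 O', open O' & A2 `&` O' = rel_image E O;
  sc_open2 : forall O, open O ->
    exists2 O', open O' & A1 `&` O' = rel_image (fun y x => E x y) O;
  sc_irr1 : forall x, A1 x -> irreducible_set [set x' | orb1 x x'];
  sc_irr2 : forall y, A2 y -> irreducible_set [set y' | orb2 y y'] }.

Lemma stable_corr_sym (T1 T2 : topologicalType) (A1 : set T1) (A2 : set T2)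
    orb1 orb2 (E : T1 -> T2 -> Prop) :
  stable_corr A1 A2 orb1 orb2 E ->
  stable_corr A2 A1 orb2 orb1 (fun y x => E x y).
Proof.
case=> d1 d2 t1 t2 o1 o2 p1 p2 i1 i2; split=> //.
- by move=> y x; exact: d2.
- by move=> y x; exact: d1.
- by move=> y x y'; exact: o2.
- by move=> y x x'; exact: o1.
Qed.

Section StableCorrespondence.
Context {T1 T2 : topologicalType} {A1 : set T1} {A2 : set T2}.
Context {orb1 : T1 -> T1 -> Prop} {orb2 : T2 -> T2 -> Prop}.
Context {E : T1 -> T2 -> Prop} (sc : stable_corr A1 A2 orb1 orb2 E).

Local Notation Phi := (rel_image E).
Local Notation Psi := (rel_image (fun y x => E x y)).
Local Notation st1 := (stable_subset orb1 A1).
Local Notation st2 := (stable_subset orb2 A2).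

Lemma stable_swap M x x' y : st1 M -> E x y -> E x' y -> M x -> M x'.
Proof.
by move=> [_ sM] Exy Ex'y Mx; apply: sM Mx _; exact/(sc_orb1 sc x' Exy).
Qed.

Lemma rel_imageE M x y : st1 M -> E x y -> Phi M y <-> M x.
Proof.
move=> sM Exy; split; last by exists x.
by case=> x' Mx' Ex'y; exact: (stable_swap sM Ex'y Exy).
Qed.

Lemma rel_image_stable M : st2 (Phi M).
Proof.
split=> [y [x _ /(sc_dom2 sc)] //|y y' [x Mx Exy]].
by move/(sc_orb2 sc y' Exy); exists x.
Qed.

Lemma rel_imageK M : st1 M -> Psi (Phi M) = M.
Proof.
move=> sM; apply/seteqP; split=> [x [y [x' Mx' Ex'y] Exy]|x Mx].
  exact: (stable_swap sM Ex'y Exy).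
by have [y Exy] := sc_tot1 sc (sM.1 _ Mx); exists y => //; exists x.
Qed.

Lemma rel_image_sub M M' : st1 M -> st1 M' -> (M `<=` M' <-> Phi M `<=` Phi M').
Proof.
move=> sM sM'; split=> [MM' y [x /MM' ? ?]|h x Mx]; first by exists x.
have [y Exy] := sc_tot1 sc (sM.1 _ Mx).
by apply/(rel_imageE sM' Exy)/h; exists x.
Qed.

Lemma rel_image_open M : st1 M -> open_in A1 M -> open_in A2 (Phi M).
Proof.
move=> sM /(open_inP sM.1)[O oO MO]; apply/open_inP.
  exact: (rel_image_stable M).1.
have [O' oO' O'E] := sc_open1 sc oO; exists O' => //; rewrite O'E.
apply/seteqP; split=> y [x].
  by rewrite {1}MO => -[_ Ox] Exy; exists x.
by move=> Ox Exy; exists x => //; rewrite MO; split => //; exact: (sc_dom1 sc Exy).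
Qed.

(** The points related to a neighbourhood of [y] form, by [sc_open2], a relative neighbourhood of
    [x], so one of them lies in [M]. *)
Lemma rel_image_closure M x y : st1 M -> E x y -> closure M x ->
  closure (Phi M) y.
Proof.
move=> sM Exy Mx; move=> B; rewrite nbhsE => -[O [oO Oy] OB].
have [O' oO' O'E] := sc_open2 sc oO.
have : (A1 `&` O') x by rewrite O'E; exists y.
case=> _ O'x; have : (M `&` O') !=set0.
  by apply: Mx; exact: open_nbhs_nbhs.
case=> x' [Mx' O'x'].
have : (A1 `&` O') x' by split => //; exact: sM.1.
by rewrite O'E => -[y' Oy' Ex'y']; exists y'; split; [exists x' | exact: OB].
Qed.

(** A relatively clopen part [B] of the image contains every orbit that it meets, orbits being
    irreducible. It thus corresponds to a relatively clopen part of [C]. *)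
Lemma connected_rel_image C : st1 C -> connected C -> connected (Phi C).
Proof.
move=> sC cC B [y By] [O oO BO] [F cF BF].
have sB : st2 B.
  split=> [z|z z' Bz zz']; first by rewrite BO => -[/(rel_image_stable C).1].
  have [Cz Oz] : (Phi C `&` O) z by rewrite -BO.
  have irr : irreducible_set [set y' | orb2 z y'].
    by apply: (sc_irr2 sc); exact: (rel_image_stable C).1.
  have orbC w : orb2 z w -> Phi C w by move=> zw; exact: (rel_image_stable C).2 zw.
  have : [set y' | orb2 z y'] `<=` F `|` ~` O.
    move=> w /orbC Cw; have [Ow|] := pselect (O w); last by right.
    by left; move: (conj Cw Ow : (Phi C `&` O) w); rewrite -BO BF => -[].
  case/(irr.2 _ _ cF (open_closedC oO)) => h.
    by rewrite BF; split; [exact: orbC | exact: h].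
  have : orb2 z z by case: Cz => x _ Exz; exact/(sc_orb2 sc z Exz).
  by move/h.
have swapB x z z' : E x z -> E x z' -> B z -> B z'.
  by move=> Exz Exz' Bz; apply: sB.2 Bz _; exact/(sc_orb2 sc z' Exz).
have [O1 oO1 O1E] := sc_open2 sc oO.
have [O2 oO2 O2E] := sc_open2 sc (closed_openC cF).
suff PB : Psi B = C.
  apply/seteqP; split=> [z|z [x Cx Exz]]; first by rewrite BO => -[].
  by move: Cx; rewrite -PB => -[z' Bz' Exz']; exact: swapB Exz' Exz Bz'.
apply: cC.
- have [x Cx Exy] : Phi C y by move: By; rewrite BO => -[].
  by exists x, y.
- exists O1 => //; apply/seteqP; split=> x.
    move=> [z]; rewrite {1}BO => -[Cz Oz] Exz.
    split; first exact/(rel_imageE sC Exz).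
    suff : (A1 `&` O1) x by case.
    by rewrite O1E; exists z.
  move=> [Cx O1x]; have : (A1 `&` O1) x by split=> //; exact: sC.1.
  rewrite O1E => -[z Oz Exz]; exists z => //; rewrite BO; split=> //.
  by exists x.
(* The relation need not send closed sets to closed sets, so the open image of the complement of [F]
   is removed instead. Stability of [B] guarantees that no point of [Psi B] is lost. *)
- exists (~` O2); first exact: open_closedC.
  apply/seteqP; split=> x.
    move=> [z Bz Exz]; split.
      by apply/(rel_imageE sC Exz); move: Bz; rewrite BO => -[].
    move=> O2x; have : (A1 `&` O2) x by split=> //; exact: (sc_dom1 sc Exz).
    rewrite O2E => -[z' nFz' Exz'].
    by move: (swapB _ _ _ Exz Exz' Bz); rewrite BF => -[_ /nFz'].
  move=> [Cx nO2x]; have [z Exz] := sc_tot1 sc (sC.1 _ Cx).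
  exists z => //; rewrite BF; split; first by exists x.
  apply: contrapT => nFz; apply: nO2x.
  suff : (A1 `&` O2) x by case.
  by rewrite O2E; exists z.
Qed.

Lemma connected_component_stable M C : st1 M -> is_connected_component M C ->
  st1 C.
Proof.
move=> sM [x Mx ->]; split=> [z /connected_component_sub /sM.1 //|z z' Cz zz'].
have Mz := connected_component_sub Cz.
have [y Ezy] := sc_tot1 sc (sM.1 _ Mz).
have irr := sc_irr1 sc (sM.1 _ Mz).
rewrite (same_connected_component Cz).
apply: (@connected_component_max _ M [set w | orb1 z w] z) => //.
- exact/(sc_orb1 sc z Ezy).
- by move=> w zw; exact: sM.2 zw.
- exact: irreducible_connected.
Qed.

(** Stability of [C] is not assumed, so that arbitrary irreducible sets can be tested. Two open sets
    meeting the image pull back to open sets sharing a point [z] of [C]; [z] is related to a point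
    of each, both in one orbit, and irreducibility of that orbit gives a common point. *)
Lemma irreducible_rel_image C : C `<=` A1 -> irreducible_set C ->
  irreducible_set (Phi C).
Proof.
move=> CA irr; have [x0 Cx0] := irr.1.
apply: irreducible_setP => [|U V oU oV].
  by have [y Ey] := sc_tot1 sc (CA _ Cx0); exists y, x0.
have [U' oU' U'E] := sc_open2 sc oU; have [V' oV' V'E] := sc_open2 sc oV.
move=> [y [[x Cx Exy] Uy]] [y' [[x' Cx' Ex'y'] Vy']].
have meet O O' z w : C z -> E z w -> O w ->
    A1 `&` O' = Psi O -> C `&` O' !=set0.
  move=> Cz Ezw Ow OE; exists z; split=> //; suff : (A1 `&` O') z by case.
  by rewrite OE; exists w.
have [z [Cz [U'z V'z]]] := irreducible_meet irr oU' oV'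
  (meet _ _ _ _ Cx Exy Uy U'E) (meet _ _ _ _ Cx' Ex'y' Vy' V'E).
have : (A1 `&` U') z by split=> //; exact: CA.
rewrite U'E => -[w Uw Ezw].
have : (A1 `&` V') z by split=> //; exact: CA.
rewrite V'E => -[w' Vw' Ezw'].
have := irreducible_meet (sc_irr2 sc (sc_dom2 sc Ezw)) oU oV.
case=> [||u [wu UVu]].
- by exists w; split=> //; exact/(sc_orb2 sc w Ezw).
- by exists w'; split=> //; exact/(sc_orb2 sc w' Ezw).
- by exists u; split=> //; exists z => //; exact/(sc_orb2 sc u Ezw).
Qed.

End StableCorrespondence.

Section StableCorrespondence2.
Context {T1 T2 : topologicalType} {A1 : set T1} {A2 : set T2}.
Context {orb1 : T1 -> T1 -> Prop} {orb2 : T2 -> T2 -> Prop}.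
Context {E : T1 -> T2 -> Prop} (sc : stable_corr A1 A2 orb1 orb2 E).

Local Notation Phi := (rel_image E).
Local Notation Psi := (rel_image (fun y x => E x y)).
Local Notation st1 := (stable_subset orb1 A1).
Local Notation st2 := (stable_subset orb2 A2).
Let cs := stable_corr_sym sc.

Lemma rel_image_bij : set_bij st1 st2 Phi.
Proof.
split.
- by move=> M _; exact: (rel_image_stable sc M).
- move=> M M'; rewrite !inE => sM sM' MM'.
  by rewrite -(rel_imageK sc sM) MM' (rel_imageK sc sM').
- move=> N sN; exists (Psi N); first exact: (rel_image_stable cs N).
  exact: (rel_imageK cs sN).
Qed.

Lemma rel_image_openE M : st1 M -> open_in A1 M <-> open_in A2 (Phi M).
Proof.
move=> sM; split; first exact: (rel_image_open sc).
move/(rel_image_open cs (rel_image_stable sc M)).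
by rewrite (rel_imageK sc sM).
Qed.

Lemma rel_image_closureE M x y : st1 M -> E x y ->
  closure M x <-> closure (Phi M) y.
Proof.
move=> sM Exy; split; first exact: (rel_image_closure sc sM Exy).
move/(@rel_image_closure _ _ _ _ _ _ _ cs _ y x (rel_image_stable sc M) Exy).
by rewrite (rel_imageK sc sM).
Qed.

Lemma closure_in_stable M : st1 M -> st1 (closure_in A1 M).
Proof.
move=> sM; rewrite closure_inE; last exact: sM.1.
split=> [x []//|x x' [Ax Mx] xx'].
have [y Exy] := sc_tot1 sc Ax.
have Ex'y : E x' y by exact/(sc_orb1 sc x' Exy).
split; first exact: (sc_dom1 sc Ex'y).
exact/(rel_image_closureE sM Ex'y)/(rel_image_closureE sM Exy).
Qed.

Lemma rel_image_closure_in M : st1 M ->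
  Phi (closure_in A1 M) = closure_in A2 (Phi M).
Proof.
move=> sM; rewrite !closure_inE; last exact: sM.1; last first.
  exact: (rel_image_stable sc M).1.
apply/seteqP; split=> [y [x [Ax Mx] Exy]|y [Ay My]].
  by split; [exact: (sc_dom2 sc Exy) | exact/(rel_image_closureE sM Exy)].
have [x Exy] := sc_tot2 sc Ay; exists x => //.
by split; [exact: (sc_dom1 sc Exy) | exact/(rel_image_closureE sM Exy)].
Qed.

(** The given open and closed sets are not unions of orbits, but the closure of [M] is one inside
    [A1], by [rel_image_closureE]. It replaces [F]: a point of [closure (Phi M)] related to a point
    [x] of the enlarged open set forces [x] into [closure M], hence into [O] and [F], hence into
    [M]. *)
Lemma rel_image_locally_closed M : st1 M ->
  (exists O F : set T1, [/\ open O, closed F & M = A1 `&` O `&` F]) ->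
  exists O F : set T2, [/\ open O, closed F & Phi M = A2 `&` O `&` F].
Proof.
move=> sM [O [F [oO cF ME]]].
have clF : closure M `<=` F.
  have /closure_id -> := cF; apply: closureS; rewrite ME => x.
  by case.
have oN : open (O `|` ~` closure M).
  by apply: openU => //; apply: closed_openC; exact: closed_closure.
have [O' oO' O'E] := sc_open1 sc oN.
exists O', (closure (Phi M)); split=> //; first exact: closed_closure.
rewrite O'E; apply/seteqP; split=> y.
  move=> /[dup] My [x Mx Exy]; split; last exact: subset_closure.
  by exists x => //; left; move: Mx; rewrite ME => -[[]].
case=> -[x Nx Exy] /(rel_image_closureE sM Exy) clx; exists x => //.
rewrite ME; split; last exact: clF.
by split; [exact: (sc_dom1 sc Exy) | case: Nx].
Qed.

(** Each inclusion is the maximality of one component tested against the image of the other, so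
    connectedness is transported both ways. *)
Lemma rel_image_connected_component M C : st1 M -> st1 C ->
  is_connected_component M C -> is_connected_component (Phi M) (Phi C).
Proof.
move=> sM sC [x Mx CE]; have [y Exy] := sc_tot1 sc (sM.1 _ Mx).
have CM : C `<=` M by rewrite CE; exact: connected_component_sub.
have Cx : C x by rewrite CE; exact: connected_component_refl.
have cC : connected C by rewrite CE; exact: component_connected.
have My : Phi M y by exists x.
exists y => //; set D := connected_component _ _.
have sD : st2 D.
  by apply: (connected_component_stable cs (rel_image_stable sc M)); exists y.
apply/seteqP; split.
  apply: connected_component_max; first by exists x.
    exact/(rel_image_sub sc sC sM).
  exact: (connected_rel_image sc).
rewrite -(rel_imageK cs sD); apply/(rel_image_sub sc _ sC).
  exact: (rel_image_stable cs D).
rewrite CE; apply: connected_component_max.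
- by exists y => //; exact: connected_component_refl.
- rewrite -(rel_imageK sc sM); apply/(rel_image_sub cs sD).
    exact: (rel_image_stable sc M).
  exact: connected_component_sub.
- apply: (connected_rel_image cs sD); exact: component_connected.
Qed.

(** The saturation [Psi (Phi C)] is again irreducible and stays in [M], so maximality makes it equal
    to [C]. *)
Lemma irreducible_component_stable M C : st1 M -> is_irreducible_component M C ->
  st1 C.
Proof.
move=> sM [CM irr maxC].
have CA : C `<=` A1 by move=> x /CM /sM.1.
have CP : C `<=` Psi (Phi C).
  by move=> x Cx; have [y Exy] := sc_tot1 sc (CA _ Cx); exists y => //; exists x.
rewrite -(maxC (Psi (Phi C)) _ _ CP); first exact: (rel_image_stable cs _).
  move=> x [y [x' Cx' Ex'y] Exy].
  by apply: (stable_swap sc sM Ex'y Exy); exact: CM.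
apply: (irreducible_rel_image cs); first exact: (rel_image_stable sc C).1.
exact: (irreducible_rel_image sc).
Qed.

Lemma rel_image_irreducible_component M C : st1 M -> st1 C ->
  is_irreducible_component M C -> is_irreducible_component (Phi M) (Phi C).
Proof.
move=> sM sC [CM irr maxC]; split.
- exact/(rel_image_sub sc sC sM).
- exact: (irreducible_rel_image sc sC.1).
(* The competitor [D] is an arbitrary irreducible set. Its preimage is compared with [C] first, and
   [D] is then contained in the image of that preimage. *)
- move=> D DM irrD CD.
  have DA : D `<=` A2 by move=> y /DM /(rel_image_stable sc M).1.
  have DC : Psi D = C.
    apply: maxC.
    - by move=> x [y /DM My Exy]; exact/(rel_imageE sc sM Exy).
    - exact: (irreducible_rel_image cs DA).
    - by rewrite -{1}(rel_imageK sc sC) => x [y /CD]; exists y.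
  apply/seteqP; split=> // y Dy; have [x Exy] := sc_tot2 sc (DA _ Dy).
  by exists x => //; rewrite -DC; exists y.
Qed.

End StableCorrespondence2.

(** * Spaces with functions *)

Section Morphisms.
Context {K : fieldType}.
Implicit Types X Y Z : kspace K.

(** A pointwise notion, because [rho], [sigma], matrix inversion and the local sections are total
    functions that are morphisms only at some points. *)
Definition morph_at X Y (f : X -> Y) (x : X) : Prop :=
  {for x, continuous f} /\
  forall g, regular_at (f x) g -> regular_at x (g \o f).

Lemma morph_atI X Y (f : X -> Y) x :
  (forall B, nbhs (f x) B -> nbhs x (f @^-1` B)) ->
  (forall g, regular_at (f x) g -> regular_at x (g \o f)) -> morph_at f x.
Proof. by []. Qed.

Lemma morph_at_nbhs X Y (f : X -> Y) x B :
  morph_at f x -> nbhs (f x) B -> nbhs x (f @^-1` B).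
Proof. by case=> cf _; exact: cf. Qed.

Lemma kmorphismP X Y (f : X -> Y) : kmorphism f <-> forall x, morph_at f x.
Proof.
split=> [[cf rf] x|h]; first by split=> [|g]; [exact: cf | exact: rf].
by split=> [x|x]; case: (h x).
Qed.

Lemma morph_at_near X Y (f g : X -> Y) x :
  (\forall y \near x, f y = g y) -> morph_at f x -> morph_at g x.
Proof.
move=> fg mf; have fgx : f x = g x by exact: nbhs_singleton fg.
apply: morph_atI => [B|h]; rewrite -fgx => gh.
  by apply: filterS2 fg (morph_at_nbhs mf gh) => y /= <-.
apply: regular_at_near (mf.2 _ gh).
by apply: filterS fg => y /= ->.
Qed.

Lemma morph_at_comp X Y Z (f : X -> Y) (g : Y -> Z) x :
  morph_at f x -> morph_at g (f x) -> morph_at (g \o f) x.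
Proof.
move=> [cf rf] [cg rg]; split; first exact: continuous_comp.
by move=> h /rg/rf.
Qed.

Lemma morph_at_id X (x : X) : morph_at id x.
Proof. by split=> // B; rewrite nbhs_simpl. Qed.

Lemma nbhs_all (T : topologicalType) (x : T) (P : set T) :
  (forall y, P y) -> nbhs x P.
Proof. by move=> PT; apply: filterS filterT => y _; exact: PT. Qed.

Lemma near_open (T : topologicalType) (x : T) (P : set T) :
  nbhs x P -> exists U : set T, [/\ open U, U x & U `<=` P].
Proof. by rewrite nbhsE => -[U [oU Ux] UP]; exists U. Qed.

Lemma nbhs_subP (T : topologicalType) (A : set T) (x : A) (P : set A) :
  nbhs x P <-> exists2 U : set T, open U /\ U (val x) &
                 forall y : A, U (val y) -> P y.
Proof.
rewrite nbhsE; split=> [[O [[U oU <-] Ux] OP]|[U [oU Ux] UP]].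
  by exists U => // y Uy; exact: OP.
by exists (val @^-1` U) => //; split=> //; exists U.
Qed.

Lemma near_subT (T : topologicalType) (A : set T) (x : A) (P : set T) :
  (\forall y \near val x, P y) -> \forall y \near x, P (val y).
Proof.
by move=> /near_open[O [oO Ox OP]]; apply/nbhs_subP; exists O => // y /OP.
Qed.

Lemma near_subI (T : topologicalType) (A : set T) (x : A) (P : set A) :
  nbhs x P -> \forall y \near val x, forall Ay : A y, P (exist _ y (mem_set Ay)).
Proof.
move=> /nbhs_subP[U [oU Ux] UP].
by near=> y => Ay; apply: UP => /=; near: y; exact: open_nbhs_nbhs.
Unshelve. all: by end_near. Qed.

Lemma sub_val_morph X (A : set X) (x : sub_space A) :
  @morph_at (sub_space A) X val x.
Proof.
apply: morph_atI => [B|g rg]; first by move=> xB; exact: near_subT.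
by exists g => //; exact: nbhs_all.
Qed.

Lemma sub_lift_morph X Y (A : set Y) (f : X -> sub_space A) x :
  @morph_at X Y (val \o f) x -> morph_at f x.
Proof.
move=> mf; apply: morph_atI => [B /nbhs_subP[U [oU Ux] UB]|g [h rh hg]].
  have := morph_at_nbhs mf (open_nbhs_nbhs (conj oU Ux)).
  by apply: filterS => y /= Uy; exact: UB.
have [U [oU Ux] Uh] := (nbhs_subP _ _).1 hg.
apply: (regular_at_near _ (mf.2 _ rh)).
have := morph_at_nbhs mf (open_nbhs_nbhs (conj oU Ux)).
by apply: filterS => y /= Uy; rewrite -Uh.
Qed.

Definition to_sub X (A : set X) (x : X) (Ax : A x) : sub_space A :=
  exist _ x (mem_set Ax).

Definition sub_fun X Y (A : set X) (B : set Y) (f : X -> Y)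
    (fAB : forall x, A x -> B (f x)) (x : sub_space A) : sub_space B :=
  to_sub (fAB _ (set_mem (valP x))).

Lemma sub_fun_morph X Y (A : set X) (B : set Y) (f : X -> Y)
    (fAB : forall x, A x -> B (f x)) (x : sub_space A) :
  morph_at f (val x) -> morph_at (sub_fun fAB) x.
Proof.
move=> fx; apply: sub_lift_morph.
exact: (morph_at_comp (sub_val_morph x) fx).
Qed.

Lemma open_sub_regular X (A : set X) (x : sub_space A) (f : X -> K) :
  open A -> @regular_at K (sub_space A) x (f \o val) -> regular_at (val x) f.
Proof.
move=> oA [g rg /near_subI fg]; apply: regular_at_near rg.
have Ax : nbhs (val x) A.
  by apply: open_nbhs_nbhs; split=> //; exact: set_mem (valP x).
by apply: filterS2 fg Ax => y h Ay; rewrite -(h Ay).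
Qed.

Lemma sub_fun_iso X Y (A : set X) (B : set Y) (f : X -> Y) (g : Y -> X)
    (fAB : forall x, A x -> B (f x)) (gBA : forall y, B y -> A (g y)) :
  (forall x, A x -> morph_at f x /\ g (f x) = x) ->
  (forall y, B y -> morph_at g y /\ f (g y) = y) ->
  isomorphism (sub_fun fAB).
Proof.
move=> hf hg; exists (sub_fun gBA); split.
- by apply/kmorphismP => x; apply: sub_fun_morph; case: (hf _ (set_mem (valP x))).
- by apply/kmorphismP => x; apply: sub_fun_morph; case: (hg _ (set_mem (valP x))).
- by move=> x; apply: val_inj => /=; case: (hf _ (set_mem (valP x))).
- by move=> x; apply: val_inj => /=; case: (hg _ (set_mem (valP x))).
Qed.

Lemma kmorphism_comp X Y Z (f : X -> Y) (g : Y -> Z) :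
  kmorphism f -> kmorphism g -> kmorphism (g \o f).
Proof.
move=> /kmorphismP hf /kmorphismP hg; apply/kmorphismP => x.
exact: morph_at_comp.
Qed.

Lemma isomorphism_comp X Y Z (f : X -> Y) (g : Y -> Z) :
  isomorphism f -> isomorphism g -> isomorphism (g \o f).
Proof.
move=> [f' [mf mf' fK f'K]] [g' [mg mg' gK g'K]]; exists (f' \o g').
split; [exact: kmorphism_comp | exact: kmorphism_comp | |].
  by move=> x /=; rewrite gK.
by move=> x /=; rewrite f'K.
Qed.

Lemma sub_sub_iso X (A : set X) (B : set (sub_space A)) (C : set X) :
  (forall x, C x <-> exists2 y : sub_space A, B y & val y = x) ->
  exists f : sub_space B -> sub_space C,
    isomorphism f /\ forall x, val (f x) = val (val x).
Proof.
move=> CE.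
have fP (x : sub_space B) : C (val (val x)).
  by apply/CE; exists (val x) => //; exact: set_mem (valP x).
pose f (x : sub_space B) : sub_space C := to_sub (fP x).
have gP (x : sub_space C) : {y : sub_space A | B y & val y = val x}.
  by apply: cid2; apply/CE; exact: set_mem (valP x).
pose g (x : sub_space C) : sub_space B :=
  let: exist2 y By _ := gP x in exist _ y (mem_set By).
have gE x : val (val (g x)) = val x by rewrite /g; case: (gP x).
exists f; split=> //; exists g; split.
- apply/kmorphismP => x; apply: sub_lift_morph.
  exact: (morph_at_comp (sub_val_morph x) (sub_val_morph (val x))).
- apply/kmorphismP => x; do 2 apply: sub_lift_morph.
  apply: (morph_at_near _ (sub_val_morph x)).
  by apply: nbhs_all => y; rewrite /= gE.
- by move=> x; do 2 apply: val_inj; rewrite gE.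
- by move=> x; apply: val_inj; rewrite /= gE.
Qed.

(** Sheaf-like properties that a bare [kspace] does not guarantee: regularity spreads to a
    neighbourhood, nonvanishing is an open condition, differences are regular. They hold on affine
    spaces and pass to prevarieties through their charts. *)
Definition nice_at X (x : X) : Prop := forall f, regular_at x f ->
  [/\ \forall y \near x, regular_at y f,
      f x != 0 -> \forall y \near x, f y != 0 &
      forall g, regular_at x g -> regular_at x (fun y => f y - g y)].

Lemma nice_sub X (A : set X) (x : sub_space A) :
  nice_at (val x) -> nice_at x.
Proof.
move=> nx f [g rg fg]; have [ng zg dg] := nx _ rg; split.
- have fgn : \forall y \near x, \forall z \near y, f z = g (val z).
    exact: near_join.
  by apply: filterS2 fgn (near_subT ng) => y fgy rgy; exists g.
- rewrite (nbhs_singleton fg) => /zg/near_subT.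
  by apply: filterS2 fg => y ->.
- move=> f' [g' rg' fg']; exists (fun y => g y - g' y); first exact: dg.
  by apply: filterS2 fg fg' => y -> ->.
Qed.

Lemma nice_open_sub X (A : set X) (x : sub_space A) :
  open A -> nice_at x -> nice_at (val x).
Proof.
move=> oA nx f rf; have [_ rv] := sub_val_morph x.
have [nf zf df] := nx _ (rv _ rf).
have Ax : nbhs (val x) A.
  by apply: open_nbhs_nbhs; split=> //; exact: set_mem (valP x).
split.
- move/near_subI: nf; apply: filterS2 Ax => y Ay /(_ Ay).
  exact: open_sub_regular.
- by move=> /zf/near_subI; apply: filterS2 Ax => y Ay /(_ Ay).
- by move=> g /rv /df; exact: open_sub_regular.
Qed.

Lemma nice_iso X Y (f : X -> Y) (x : X) :
  isomorphism f -> nice_at (f x) -> nice_at x.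
Proof.
move=> [f' [/kmorphismP mf /kmorphismP mf' fK f'K]] nx g rg.
have rg' : regular_at (f x) (g \o f') by apply: (mf' _).2; rewrite fK.
have [ng zg dg] := nx _ rg'.
have back (h : X -> K) : h = (h \o f') \o f by apply/funext => y /=; rewrite fK.
split.
- have := morph_at_nbhs (mf x) ng; apply: filterS => y /= ry.
  by rewrite (back g); exact: (mf y).2.
- rewrite /= fK in zg => /zg h.
  by have := morph_at_nbhs (mf x) h; apply: filterS => y; rewrite /= fK.
- move=> h rh; rewrite (back (fun y => _)); apply: (mf x).2.
  by apply: dg; apply: (mf' _).2; rewrite fK.
Qed.

End Morphisms.

(** * Geometric quotients along maps with local sections *)

Section Quotients.
Context {K : fieldType}.
Implicit Types X Y Z : kspace K.

Definition has_local_sections X Y (f : X -> Y) : Prop :=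
  forall x, exists s : Y -> X,
    [/\ morph_at s (f x), s (f x) = x & \forall y \near f x, f (s y) = y].

Lemma local_sections_open X Y (f : X -> Y) U :
  has_local_sections f -> open U -> open (f @` U).
Proof.
move=> sf oU; rewrite openE => _ [x Ux <-]; rewrite /interior.
have [s [[cs _] sx fs]] := sf x.
have : nbhs (f x) (s @^-1` U) by apply: cs; rewrite sx; exact: open_nbhs_nbhs.
by apply: filterS2 fs => y fy Uy; exists (s y).
Qed.

(** Invariant functions on [X] descend to [X'] because composing with a local section keeps them
    regular; local sections also make [f] open. *)
Lemma quotient_pull X X' Y (orb : X -> X -> Prop) (orb' : X' -> X' -> Prop)
    (f : X -> X') (phi : X' -> Y) :
  kmorphism f -> (forall x', exists x, f x = x') -> has_local_sections f ->
  (forall x y, orb x y <-> orb' (f x) (f y)) ->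
  geometric_quotient orb' phi -> geometric_quotient orb (phi \o f).
Proof.
move=> mf surf sf oo [[vY mphi] surphi ophi fphi dphi]; split.
- by split=> //; exact: kmorphism_comp.
- by move=> y; have [x' <-] := surphi y; have [x <-] := surf x'; exists x.
- by move=> U oU; rewrite -image_comp; apply: ophi; exact: local_sections_open.
- by move=> x x'; split=> [/fphi/oo|/oo/fphi].
move=> U oU g rg gorb.
(* [r] is a section obtained by choice, without any regularity. Near [f x] the function [g \o r]
   agrees with [g \o s] for the regular section [s], since [g] is constant on orbits. *)
have [r rK] : {r : X' -> X | forall x', f (r x') = x'}.
  by exists (fun x' => projT1 (cid (surf x'))) => x'; case: cid.
have grE x : U (phi (f x)) -> g (r (f x)) = g x.
  move=> Ux; apply: gorb; first by rewrite /= rK.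
  by apply/oo; rewrite rK; apply/fphi.
have [||h rh hE] := dphi U oU (g \o r).
- move=> x'; rewrite -(rK x') => Ux; set x := r x' in Ux *.
  have [s [[cs rs] sx fs]] := sf x.
  have : regular_at (f x) (g \o s) by apply: rs; rewrite sx; exact: rg.
  apply: regular_at_near.
  have : nbhs (f x) (phi @^-1` U) by apply: mphi.1; exact: open_nbhs_nbhs.
  apply: filterS2 fs => y fy Uy /=.
  by rewrite -[in RHS]fy grE // fy.
- move=> x y Ux xy; apply: gorb; first by rewrite /= rK.
  by apply/oo; rewrite !rK.
by exists h => // x Ux; rewrite hE //= grE.
Qed.

(** The map on [X'] is [phi] composed with a chosen section; the choice is harmless because [phi] is
    constant on the fibres of [f], so a regular local section may replace it near each point. *)
Lemma quotient_push X X' Y (orb : X -> X -> Prop) (orb' : X' -> X' -> Prop)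
    (f : X -> X') (phi : X -> Y) :
  kmorphism f -> (forall x', exists x, f x = x') -> has_local_sections f ->
  (forall x y, orb x y <-> orb' (f x) (f y)) ->
  geometric_quotient orb phi -> exists phi' : X' -> Y, geometric_quotient orb' phi'.
Proof.
move=> mf surf sf oo [[vY mphi] surphi ophi fphi dphi].
have [r rK] : {r : X' -> X | forall x', f (r x') = x'}.
  by exists (fun x' => projT1 (cid (surf x'))) => x'; case: cid.
have phiE x : phi (r (f x)) = phi x.
  by apply/fphi/oo; rewrite rK; apply/oo/fphi.
have mphi' : kmorphism (phi \o r).
  apply/kmorphismP => x'; rewrite -(rK x'); set x := r x'.
  have [s [ms sx fs]] := sf x.
  apply: (@morph_at_near _ _ _ (phi \o s)).
    by apply: filterS fs => y fy /=; rewrite -[in RHS]fy phiE.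
  apply: morph_at_comp ms _; rewrite sx.
  by move/kmorphismP: mphi.
exists (phi \o r); split=> //.
- by move=> y; have [x <-] := surphi y; exists (f x); exact: phiE.
- move=> U oU; suff -> : (phi \o r) @` U = phi @` (f @^-1` U).
    by apply: ophi; move/continuousP: mf.1; exact.
  apply/seteqP; split=> _ [x Ux <-].
    by exists (r x) => //=; rewrite rK.
  by exists (f x) => //=; exact: phiE.
- by move=> x x'; rewrite -{2}(rK x) -{2}(rK x'); split=> [/fphi/oo|/oo/fphi].
move=> U oU g rg gorb; have [||h rh hE] := dphi U oU (g \o f).
- by move=> x Ux; apply: mf.2; apply: rg; rewrite /= phiE.
- by move=> x y Ux xy; apply: gorb; [rewrite /= phiE | exact/oo].
by exists h => // x Ux; rewrite hE //= rK.
Qed.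

(** Continuity of the factor map comes from openness of [phi1]. Regularity is checked on germs,
    whereas the quotient axiom concerns functions regular on an open set; niceness of [Y2] bridges
    the two. *)
Lemma quotient_factor X Y1 Y2 (orb : X -> X -> Prop) (phi1 : X -> Y1)
    (phi2 : X -> Y2) : (forall y : Y2, nice_at y) ->
  geometric_quotient orb phi1 -> geometric_quotient orb phi2 ->
  exists2 psi : Y1 -> Y2, kmorphism psi & forall x, psi (phi1 x) = phi2 x.
Proof.
move=> nY2 [[vY1 m1] s1 o1 f1 d1] [[vY2 m2] s2 o2 f2 d2].
have [r rK] : {r : Y1 -> X | forall y, phi1 (r y) = y}.
  by exists (fun y => projT1 (cid (s1 y))) => y; case: cid.
have psiE x : phi2 (r (phi1 x)) = phi2 x by apply/f2/f1; rewrite rK.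
exists (phi2 \o r) => //.
have cpsi : continuous (phi2 \o r).
  apply/continuousP => U oU.
  suff -> : (phi2 \o r) @^-1` U = phi1 @` (phi2 @^-1` U).
    by apply: o1; move/continuousP: m2.1; exact.
  apply/seteqP; split=> [y Uy|_ [x Ux <-]]; first by exists (r y).
  by rewrite /= psiE.
split=> // y g rg.
have [/near_open[U [oU Uy Ug]] _ _] := nY2 _ _ rg.
have [|||h rh hE] := d1 ((phi2 \o r) @^-1` U) _ (g \o phi2).
- by move/continuousP: cpsi; exact.
- by move=> x /= Ux; apply: m2.2; apply: Ug; rewrite -psiE.
- by move=> x x' _ /f2 /= ->.
have := rh y Uy; apply: regular_at_near.
have : nbhs y ((phi2 \o r) @^-1` U) by apply: cpsi; exact: open_nbhs_nbhs.
by apply: filterS => z Uz; rewrite -{1}(rK z) hE /= ?rK.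
Qed.

Lemma quotient_unique X Y1 Y2 (orb : X -> X -> Prop) (phi1 : X -> Y1)
    (phi2 : X -> Y2) :
  (forall y : Y1, nice_at y) -> (forall y : Y2, nice_at y) ->
  geometric_quotient orb phi1 -> geometric_quotient orb phi2 ->
  isomorphic Y1 Y2.
Proof.
move=> n1 n2 q1 q2.
have [psi m psiE] := quotient_factor n2 q1 q2.
have [psi' m' psi'E] := quotient_factor n1 q2 q1.
exists psi, psi'; split=> // y.
  by case: q1 => _ s1 _ _ _; have [x <-] := s1 y; rewrite psiE psi'E.
by case: q2 => _ s2 _ _ _; have [x <-] := s2 y; rewrite psi'E psiE.
Qed.

(** The section lives on the ambient [Y] and is one only near [f x] and on points of [B]. In this
    form the property restricts to the preimage of any subset of [B], so it is proved once for [rho]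
    and once for [sigma]. *)
Record good_map X Y (A : set X) (B : set Y) (f : X -> Y) : Prop := GoodMap {
  gm_morph : forall x, A x -> morph_at f x;
  gm_im : forall x, A x -> B (f x);
  gm_surj : forall y, B y -> exists2 x, A x & f x = y;
  gm_sec : forall x, A x -> exists s : Y -> X,
    [/\ morph_at s (f x), s (f x) = x &
        \forall y \near f x, B y -> A (s y) /\ f (s y) = y] }.

Lemma good_map_restrict X Y (A : set X) (B M : set Y) (f : X -> Y) :
  M `<=` B -> good_map A B f -> good_map (A `&` f @^-1` M) M f.
Proof.
move=> MB [mf imf surf sf]; split.
- by move=> x [/mf].
- by move=> x [].
- by move=> y My; have [x Ax fx] := surf _ (MB _ My); exists x => //; split=> //=;
    rewrite fx.
- move=> x [Ax Mx]; have [s [ms sx fs]] := sf _ Ax; exists s; split=> //.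
  apply: filterS fs => y h My; have [As fsy] := h (MB _ My).
  by split=> //; split=> //=; rewrite fsy.
Qed.

Lemma good_map_open X Y (A : set X) (B : set Y) (f : X -> Y) O :
  good_map A B f -> open O ->
  exists2 O', open O' & B `&` O' = f @` (A `&` O).
Proof.
move=> [mf imf surf sf] oO.
exists (interior [set y | B y -> (f @` (A `&` O)) y]); first exact: open_interior.
apply/seteqP; split=> [y [By /interior_subset] |_ [x [Ax Ox] <-]]; first exact.
split; first exact: imf.
have [s [ms sx fs]] := sf _ Ax.
have := ms.1 O; rewrite sx => /(_ (open_nbhs_nbhs (conj oO Ox))).
by apply: filterS2 fs => y h Oy /h[As fsy]; exists (s y).
Qed.

Lemma good_map_sub X Y (A : set X) (B : set Y) (f : X -> Y)
    (gf : good_map A B f) :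
  [/\ kmorphism (sub_fun (gm_im gf)),
      forall y, exists x, sub_fun (gm_im gf) x = y &
      has_local_sections (sub_fun (gm_im gf))].
Proof.
split.
- by apply/kmorphismP => x; apply/sub_fun_morph/(gm_morph gf)/set_mem/(valP x).
- move=> y; have [x Ax fx] := gm_surj gf (set_mem (valP y)).
  by exists (to_sub Ax); apply: val_inj.
move=> x; have Ax := set_mem (valP x); have [s [ms sx fs]] := gm_sec gf Ax.
(* The value [x] is a default where the ambient section leaves [A], which does not happen near the
   point considered. *)
pose s' (y : sub_space B) : sub_space A :=
  if pselect (A (s (val y))) is left h then to_sub h else x.
have s'E (y : sub_space B) : A (s (val y)) -> val (s' y) = s (val y).
  by rewrite /s'; case: pselect.
have nA : \forall y \near sub_fun (gm_im gf) x,
    A (s (val y)) /\ f (s (val y)) = val y.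
  have : \forall y \near sub_fun (gm_im gf) x,
      B (val y) -> A (s (val y)) /\ f (s (val y)) = val y.
    exact: (@near_subT _ B (sub_fun (gm_im gf) x) _ fs).
  by apply: filterS => y; apply; exact: set_mem (valP y).
exists s'; split.
- apply: sub_lift_morph; apply: (@morph_at_near _ (sub_space B) X (s \o val)).
    by apply: filterS nA => y [As _] /=; rewrite s'E.
  exact: (morph_at_comp (sub_val_morph _)).
- by apply: val_inj; rewrite s'E /= sx.
- by apply: filterS nA => y [As fsy]; apply: val_inj => /=; rewrite s'E.
Qed.

End Quotients.

(** * Regular maps between affine spaces *)

Section Affine.
Context {K : fieldType}.
Implicit Types V W : vectType K.

Lemma polyfun_sum V (I : Type) (r : seq I) (P : pred I) (f : I -> V -> K) :
  (forall i, P i -> polyfun (f i)) ->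
  polyfun (fun v => \sum_(i <- r | P i) f i v).
Proof.
move=> pf; elim: r => [|i r IHr].
  have -> : (fun v => \sum_(i <- [::] | P i) f i v) = fun=> 0.
    by apply/funext => v; rewrite big_nil.
  exact: polyfun_cst.
case Pi: (P i); last first.
  by have -> : (fun v => \sum_(j <- i :: r | P j) f j v) =
    (fun v => \sum_(j <- r | P j) f j v) by apply/funext => v; rewrite big_cons Pi.
have -> : (fun v => \sum_(j <- i :: r | P j) f j v) =
    (fun v => f i v + \sum_(j <- r | P j) f j v).
  by apply/funext => v; rewrite big_cons Pi.
by apply: polyfun_add IHr; exact: pf.
Qed.

Lemma open_nonzero V (q : V -> K) : polyfun q ->
  open ([set y | q y != 0] : set (zariski V)).
Proof.
move=> pq; suff : zariski_open [set y : zariski V | q y != 0] by [].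
by move=> y qy; exists q => //; split.
Qed.

Lemma nbhs_zariskiP V (x : zariski V) (P : set (zariski V)) :
  nbhs x P <-> exists2 q : V -> K, polyfun q &
                 q x != 0 /\ [set y | q y != 0] `<=` P.
Proof.
split=> [/near_open[U [oU Ux UP]]|[q pq [qx qP]]].
  have [q pq [qx qU]] := (oU : zariski_open U) x Ux.
  by exists q => //; split=> // y /qU /UP.
rewrite nbhsE; exists [set y | q y != 0] => //; split=> //.
exact: open_nonzero.
Qed.

Lemma near_nonzero V (q : V -> K) (x : zariski V) : polyfun q -> q x != 0 ->
  \forall y \near x, q y != 0.
Proof.
by move=> pq qx; apply/open_nbhs_nbhs; split=> //; exact: open_nonzero.
Qed.

Section Regular.
Context {V : vectType K} (x : affine_space V).
Implicit Types f g : V -> K.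
Local Notation reg f := (@regular_at K (affine_space V) x f).

Lemma regular_polyfun f : polyfun f -> reg f.
Proof.
move=> pf; exists f, (fun=> 1); split=> //; first exact: polyfun_cst.
  exact: oner_neq0.
by apply: nbhs_all => y; rewrite divr1.
Qed.

Lemma regular_cst c : reg (fun=> c).
Proof. by apply: regular_polyfun; exact: polyfun_cst. Qed.

Lemma regular_lin (l : {scalar V}) : reg l.
Proof. by apply: regular_polyfun; exact: polyfun_lin. Qed.

Lemma regular_add f g : reg f -> reg g -> reg (fun v => f v + g v).
Proof.
move=> [p [q [pp pq qx fE]]] [p' [q' [pp' pq' qx' gE]]].
exists (fun v => p v * q' v + p' v * q v), (fun v => q v * q' v); split.
- by apply: polyfun_add; exact: polyfun_mul.
- exact: polyfun_mul.
- by rewrite mulf_neq0.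
have := near_nonzero pq' qx'; have := near_nonzero pq qx.
apply: filterS3 (filterI fE gE) => y [-> ->] qy q'y.
by rewrite addf_div.
Qed.

Lemma regular_mul f g : reg f -> reg g -> reg (fun v => f v * g v).
Proof.
move=> [p [q [pp pq qx fE]]] [p' [q' [pp' pq' qx' gE]]].
exists (fun v => p v * p' v), (fun v => q v * q' v); split.
- exact: polyfun_mul.
- exact: polyfun_mul.
- by rewrite mulf_neq0.
by apply: filterS2 fE gE => y -> ->; rewrite mulf_div.
Qed.

Lemma regular_opp f : reg f -> reg (fun v => - f v).
Proof.
move=> rf; have -> : (fun v => - f v) = (fun v => -1 * f v).
  by apply/funext => v; rewrite mulN1r.
by apply: regular_mul rf; exact: regular_cst.
Qed.

Lemma regular_neq0 f : reg f -> f x != 0 -> \forall y \near x, f y != 0.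
Proof.
move=> [p [q [pp pq qx fE]]]; rewrite (nbhs_singleton fE) => fx.
have px : p x != 0 by apply: contraNneq fx => ->; rewrite mul0r.
have := near_nonzero pq qx; have := near_nonzero pp px.
apply: filterS3 fE => y -> py qy.
by rewrite mulf_neq0 // invr_neq0.
Qed.

Lemma regular_inv f : reg f -> f x != 0 -> reg (fun v => (f v)^-1).
Proof.
move=> [p [q [pp pq qx fE]]]; rewrite (nbhs_singleton fE) => fx.
have px : p x != 0 by apply: contraNneq fx => ->; rewrite mul0r.
exists q, p; split=> //.
by apply: filterS fE => y ->; rewrite invf_div.
Qed.

Lemma regular_sum (I : Type) (r : seq I) (P : pred I) (f : I -> V -> K) :
  (forall i, P i -> reg (f i)) -> reg (fun v => \sum_(i <- r | P i) f i v).
Proof.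
move=> pf; elim: r => [|i r IHr].
  have -> : (fun v => \sum_(i <- [::] | P i) f i v) = fun=> 0.
    by apply/funext => v; rewrite big_nil.
  exact: regular_cst.
case Pi: (P i); last first.
  by have -> : (fun v => \sum_(j <- i :: r | P j) f j v) =
    (fun v => \sum_(j <- r | P j) f j v) by apply/funext => v; rewrite big_cons Pi.
have -> : (fun v => \sum_(j <- i :: r | P j) f j v) =
    (fun v => f i v + \sum_(j <- r | P j) f j v).
  by apply/funext => v; rewrite big_cons Pi.
by apply: regular_add IHr; exact: pf.
Qed.

Lemma regular_prod (I : Type) (r : seq I) (P : pred I) (f : I -> V -> K) :
  (forall i, P i -> reg (f i)) -> reg (fun v => \prod_(i <- r | P i) f i v).
Proof.
move=> pf; elim: r => [|i r IHr].
  have -> : (fun v => \prod_(i <- [::] | P i) f i v) = fun=> 1.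
    by apply/funext => v; rewrite big_nil.
  exact: regular_cst.
case Pi: (P i); last first.
  by have -> : (fun v => \prod_(j <- i :: r | P j) f j v) =
    (fun v => \prod_(j <- r | P j) f j v) by apply/funext => v; rewrite big_cons Pi.
have -> : (fun v => \prod_(j <- i :: r | P j) f j v) =
    (fun v => f i v * \prod_(j <- r | P j) f j v).
  by apply/funext => v; rewrite big_cons Pi.
by apply: regular_mul IHr; exact: pf.
Qed.

Lemma regular_sub f g : reg f -> reg g -> reg (fun v => f v - g v).
Proof. by move=> rf rg; apply: regular_add rf _; exact: regular_opp. Qed.

Lemma nice_affine : nice_at x.
Proof.
move=> f rf; split; last 2 first.
- exact: regular_neq0.
- by move=> g; exact: regular_sub.
have [p [q [pp pq qx fE]]] := rf.
apply: filterS2 (near_join fE) (near_nonzero pq qx) => y fy qy.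
by exists p, q; split.
Qed.

End Regular.

Lemma closed_regular V (f : V -> K) c :
  (forall x, @regular_at K (affine_space V) x f) ->
  closed ([set v | f v = c] : set (affine_space V)).
Proof.
move=> rf; rewrite -openC openE => x /= fx; rewrite /interior.
have fx0 : f x - c != 0 by rewrite subr_eq0; apply/eqP.
have := regular_neq0 (regular_sub (rf x) (regular_cst x c)) fx0.
by apply: filterS => y /= + fy; rewrite fy subrr eqxx.
Qed.

(** Testing linear forms is enough because they generate the polynomial functions; no basis of [W]
    is chosen. *)
Definition vregular_at V W (F : V -> W) (x : affine_space V) : Prop :=
  forall l : {scalar W}, @regular_at K (affine_space V) x (l \o F).

Lemma regular_polyfun_comp V W (F : V -> W) (x : affine_space V) (q : W -> K) :
  vregular_at F x -> polyfun q -> @regular_at K (affine_space V) x (q \o F).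
Proof.
move=> rF; elim=> [c|l|f g _ rf _ rg|f g _ rf _ rg].
- exact: regular_cst.
- exact: rF.
- exact: regular_add.
- exact: regular_mul.
Qed.

Lemma vregular_morph V W (F : affine_space V -> affine_space W) (x : affine_space V) :
  vregular_at F x -> morph_at F x.
Proof.
move=> rF.
have cF B : nbhs (F x) B -> nbhs x (F @^-1` B).
  move=> /nbhs_zariskiP[q pq [qx qB]].
  have := regular_neq0 (regular_polyfun_comp rF pq) qx.
  by apply: filterS => y /qB.
apply: morph_atI => // g [p [q [pp pq qx gE]]].
have := regular_mul (regular_polyfun_comp rF pp)
  (regular_inv (regular_polyfun_comp rF pq) qx).
by apply: regular_at_near; apply: filterS (cF _ gE) => y /= ->.
Qed.

Lemma morph_regular V W (F : affine_space V -> affine_space W) (x : affine_space V) :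
  morph_at F x -> vregular_at F x.
Proof. by move=> mF l; apply: mF.2; exact: regular_lin. Qed.

Lemma vregular_linear V W (L : {linear V -> W}) (x : affine_space V) :
  vregular_at L x.
Proof.
move=> l; apply: regular_polyfun; exact: (polyfun_lin (l \o L : {scalar V})).
Qed.

Lemma vregular_near V W (F G : V -> W) (x : affine_space V) :
  (\forall y \near x, F y = G y) -> vregular_at F x -> vregular_at G x.
Proof.
by move=> FG rF l; apply: regular_at_near (rF l); apply: filterS FG => y /= ->.
Qed.

Lemma vregular_comp V W W' (F : V -> W) (G : W -> W') (x : affine_space V) :
  vregular_at F x -> vregular_at G (F x) -> vregular_at (G \o F) x.
Proof.
move=> /vregular_morph mF /vregular_morph mG.
exact: morph_regular (morph_at_comp mF mG).
Qed.

Lemma vregular_lin_comp V W W' (F : V -> W) (L : {linear W -> W'})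
    (x : affine_space V) :
  vregular_at F x -> vregular_at (fun v => L (F v)) x.
Proof. by move=> rF; apply: vregular_comp rF _; exact: vregular_linear. Qed.

Lemma vregular_id V (x : affine_space V) : vregular_at (fun v : V => v) x.
Proof. by move=> l; exact: regular_lin. Qed.

Lemma vregular_cst V W (w : W) (x : affine_space V) :
  vregular_at (fun=> w : W) x.
Proof. by move=> l; exact: regular_cst. Qed.

Lemma vregular_add V W (F G : V -> W) (x : affine_space V) :
  vregular_at F x -> vregular_at G x -> vregular_at (fun v => F v + G v) x.
Proof.
move=> rF rG l; have -> : l \o (fun v => F v + G v) = fun v => l (F v) + l (G v).
  by apply/funext => v; rewrite /= raddfD.
by apply: regular_add; [exact: rF | exact: rG].
Qed.

Lemma vregular_opp V W (F : V -> W) (x : affine_space V) :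
  vregular_at F x -> vregular_at (fun v => - F v) x.
Proof.
move=> rF l; have -> : l \o (fun v => - F v) = fun v => - l (F v).
  by apply/funext => v; rewrite /= raddfN.
by apply: regular_opp; exact: rF.
Qed.

Lemma vregular_scale V W (c : V -> K) (F : V -> W) (x : affine_space V) :
  @regular_at K (affine_space V) x c ->
  vregular_at F x -> vregular_at (fun v => c v *: F v) x.
Proof.
move=> rc rF l; have -> : l \o (fun v => c v *: F v) = fun v => c v * l (F v).
  by apply/funext => v; rewrite /= linearZ.
by apply: regular_mul => //; exact: rF.
Qed.

Lemma vregular_sum V W (I : finType) (F : I -> V -> W) (x : affine_space V) :
  (forall i, vregular_at (F i) x) -> vregular_at (fun v => \sum_i F i v) x.
Proof.
move=> rF l.
have -> : l \o (fun v => \sum_i F i v) = fun v => \sum_i l (F i v).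
  by apply/funext => v; rewrite /= raddf_sum.
by apply: regular_sum => i _; exact: rF.
Qed.

Definition linear_of (V W : lmodType K) (f : V -> W) (fl : linear f) : {linear V -> W} :=
  HB.pack f (GRing.isLinear.Build _ _ _ _ f fl).

Lemma vregular_pair V W1 W2 (F1 : V -> W1) (F2 : V -> W2) (x : affine_space V) :
  vregular_at F1 x -> vregular_at F2 x ->
  vregular_at (fun v => (F1 v, F2 v) : (W1 * W2)%type) x.
Proof.
move=> rF1 rF2.
have l1 : linear (fun w : W1 => (w, 0) : (W1 * W2)%type).
  by move=> a u v; congr (_, _); rewrite /= scaler0 addr0.
have l2 : linear (fun w : W2 => (0, w) : (W1 * W2)%type).
  by move=> a u v; congr (_, _); rewrite /= scaler0 addr0.
have -> : (fun v => (F1 v, F2 v) : (W1 * W2)%type) =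
    fun v => linear_of l1 (F1 v) + linear_of l2 (F2 v).
  by apply/funext => v; congr (_, _); rewrite ?addr0 ?add0r.
by apply: vregular_add; exact: vregular_lin_comp.
Qed.

Lemma vregular_fst V W1 W2 (F : V -> (W1 * W2)%type) (x : affine_space V) :
  vregular_at F x -> vregular_at (fun v => (F v).1) x.
Proof.
have fl : linear (fun w : (W1 * W2)%type => w.1) by [].
exact: (vregular_lin_comp (linear_of fl)).
Qed.

Lemma vregular_snd V W1 W2 (F : V -> (W1 * W2)%type) (x : affine_space V) :
  vregular_at F x -> vregular_at (fun v => (F v).2) x.
Proof.
have fl : linear (fun w : (W1 * W2)%type => w.2) by [].
exact: (vregular_lin_comp (linear_of fl)).
Qed.

Lemma vregular_ffun V W (T : finType) (F : V -> {ffun T -> W}) (x : affine_space V) :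
  vregular_at F x <-> forall a, vregular_at (fun v => F v a) x.
Proof.
split=> [rF a|rF].
  have fl : linear (fun w : {ffun T -> W} => w a) by move=> c u v; rewrite !ffunE.
  exact: (vregular_lin_comp (linear_of fl)).
have fl a : linear (fun w : W => [ffun b => if b == a then w else 0] : {ffun T -> W}).
  by move=> c u v; apply/ffunP => b; rewrite !ffunE; case: eqP; rewrite ?scaler0 ?addr0.
have -> : F = fun v => \sum_a linear_of (fl a) (F v a).
  apply/funext => v; apply/ffunP => b; rewrite sum_ffunE (bigD1 b) //= ffunE eqxx.
  by rewrite big1 ?addr0 // => a /negPf ab; rewrite ffunE eq_sym ab.
by apply: vregular_sum => a; exact: vregular_lin_comp.
Qed.

Section Matrices.
Context {V : vectType K} (x : affine_space V).

Lemma regular_entry m n (F : V -> 'M[K]_(m, n)) i j :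
  vregular_at F x -> @regular_at K (affine_space V) x (fun v => F v i j).
Proof.
have fl : scalar (fun A : 'M[K]_(m, n) => A i j).
  by move=> c A B; rewrite !mxE.
pose l : {scalar 'M[K]_(m, n)} := HB.pack (fun A : 'M[K]_(m, n) => A i j)
  (GRing.isLinear.Build _ _ _ _ _ fl).
by move/(_ l).
Qed.

Lemma vregular_mx m n (F : V -> 'M[K]_(m, n)) :
  (forall i j, @regular_at K (affine_space V) x (fun v => F v i j)) ->
  vregular_at F x.
Proof.
move=> rF.
have -> : F = fun v => \sum_i \sum_j F v i j *: delta_mx i j.
  by apply/funext => v; exact: matrix_sum_delta.
apply: vregular_sum => i; apply: vregular_sum => j.
by apply: vregular_scale => //; exact: vregular_cst.
Qed.

Lemma vregular_mulmx m n k (F : V -> 'M[K]_(m, n)) (G : V -> 'M[K]_(n, k)) :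
  vregular_at F x -> vregular_at G x -> vregular_at (fun v => F v *m G v) x.
Proof.
move=> rF rG; apply: vregular_mx => i j.
have -> : (fun v => (F v *m G v) i j) = fun v => \sum_l F v i l * G v l j.
  by apply/funext => v; rewrite mxE.
by apply: regular_sum => l _; apply: regular_mul; exact: regular_entry.
Qed.

Lemma regular_det n (F : V -> 'M[K]_n) :
  vregular_at F x -> @regular_at K (affine_space V) x (fun v => \det (F v)).
Proof.
move=> rF; apply: regular_sum => s _; apply: regular_mul; first exact: regular_cst.
by apply: regular_prod => i _; exact: regular_entry.
Qed.

Lemma near_unitmx n (F : V -> 'M[K]_n) :
  vregular_at F x -> F x \in unitmx -> \forall y \near x, F y \in unitmx.
Proof.
move=> rF; rewrite unitmxE unitfE => /(regular_neq0 (regular_det rF)).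
by apply: filterS => y; rewrite unitmxE unitfE.
Qed.

Lemma vregular_invmx n (F : V -> 'M[K]_n) :
  vregular_at F x -> F x \in unitmx -> vregular_at (fun v => invmx (F v)) x.
Proof.
move=> rF Fx.
apply: (@vregular_near _ _ (fun v => (\det (F v))^-1 *: \adj (F v))).
  by apply: filterS (near_unitmx rF Fx) => y Fy; rewrite /invmx Fy.
apply: vregular_scale.
  by apply: regular_inv; [exact: regular_det | rewrite -unitfE -unitmxE].
apply: vregular_mx => i j.
have -> : (fun v => (\adj (F v)) i j) =
    fun v => (-1) ^+ (j + i) * \det (row' j (col' i (F v))).
  by apply/funext => v; rewrite mxE.
apply: regular_mul; first exact: regular_cst.
apply: regular_det; apply: vregular_mx => k l.
have -> : (fun v => row' j (col' i (F v)) k l) = fun v => F v (lift j k) (lift i l).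
  by apply/funext => v; rewrite !mxE.
exact: regular_entry.
Qed.

Lemma vregular_lsubmx m n1 n2 (F : V -> 'M[K]_(m, n1 + n2)) :
  vregular_at F x -> vregular_at (fun v => lsubmx (F v)) x.
Proof. exact: vregular_lin_comp. Qed.

Lemma vregular_rsubmx m n1 n2 (F : V -> 'M[K]_(m, n1 + n2)) :
  vregular_at F x -> vregular_at (fun v => rsubmx (F v)) x.
Proof. exact: vregular_lin_comp. Qed.

Lemma vregular_usubmx m1 m2 n (F : V -> 'M[K]_(m1 + m2, n)) :
  vregular_at F x -> vregular_at (fun v => usubmx (F v)) x.
Proof. exact: vregular_lin_comp. Qed.

Lemma vregular_dsubmx m1 m2 n (F : V -> 'M[K]_(m1 + m2, n)) :
  vregular_at F x -> vregular_at (fun v => dsubmx (F v)) x.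
Proof. exact: vregular_lin_comp. Qed.

Lemma vregular_col_mx m1 m2 n (F : V -> 'M[K]_(m1, n)) (G : V -> 'M[K]_(m2, n)) :
  vregular_at F x -> vregular_at G x -> vregular_at (fun v => col_mx (F v) (G v)) x.
Proof.
move=> rF rG; apply: vregular_mx => i j.
case: (split_ordP i) => k ->.
- have -> : (fun v => col_mx (F v) (G v) (lshift m2 k) j) = fun v => F v k j.
    by apply/funext => v; rewrite col_mxEu.
  exact: regular_entry.
- have -> : (fun v => col_mx (F v) (G v) (rshift m1 k) j) = fun v => G v k j.
    by apply/funext => v; rewrite col_mxEd.
  exact: regular_entry.
Qed.

Lemma vregular_row_mx m n1 n2 (F : V -> 'M[K]_(m, n1)) (G : V -> 'M[K]_(m, n2)) :
  vregular_at F x -> vregular_at G x -> vregular_at (fun v => row_mx (F v) (G v)) x.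
Proof.
move=> rF rG; apply: vregular_mx => i j.
case: (split_ordP j) => k ->.
- have -> : (fun v => row_mx (F v) (G v) i (lshift n2 k)) = fun v => F v i k.
    by apply/funext => v; rewrite row_mxEl.
  exact: regular_entry.
- have -> : (fun v => row_mx (F v) (G v) i (rshift n1 k)) = fun v => G v i k.
    by apply/funext => v; rewrite row_mxEr.
  exact: regular_entry.
Qed.

End Matrices.
End Affine.

Import VectorInternalTheory.

(** * Affine charts and smoothness *)

Section AffineVarieties.
Context {K : fieldType}.

Section Embedding.
Context {V : vectType K} (q : V -> K).

(** [D(q)] is identified with the closed set [t * q v = 1] of [V * K]. *)
Definition aff_emb (v : V) : 'rV[K]_(dim V + 1) := row_mx (v2r v) (q v)^-1%:M.
Definition aff_prj (s : 'rV[K]_(dim V + 1)) : V := r2v (lsubmx s).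
Definition aff_img (F : set (affine_space V)) :
    set (affine_space 'rV[K]_(dim V + 1)) :=
  [set s | F (aff_prj s) /\ q (aff_prj s) * s 0 (rshift (dim V) 0) = 1].

Lemma aff_embK : cancel aff_emb aff_prj.
Proof. by move=> v; rewrite /aff_prj row_mxKl v2rK. Qed.

Lemma aff_prjK s : q (aff_prj s) * s 0 (rshift (dim V) 0) = 1 ->
  aff_emb (aff_prj s) = s.
Proof.
move=> qs; have q0 : q (aff_prj s) != 0.
  by apply/eqP => q0; move: qs; rewrite q0 mul0r => /eqP; rewrite eq_sym oner_eq0.
rewrite -[RHS]hsubmxK; congr row_mx; first by rewrite /aff_prj r2vK.
apply/rowP => i; rewrite ord1 !mxE mulr1n.
by apply: (mulfI q0); rewrite divff.
Qed.

Lemma aff_emb_img (F : set (affine_space V)) v : F v -> q v != 0 ->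
  aff_img F (aff_emb v).
Proof.
move=> Fv qv; split; first by rewrite aff_embK.
by rewrite aff_embK row_mxEr mxE mulr1n divff.
Qed.

Lemma aff_img_prj (F : set (affine_space V)) s : aff_img F s ->
  F (aff_prj s) /\ q (aff_prj s) != 0.
Proof.
move=> [Fs qs]; split=> //; apply/eqP => q0.
by move: qs; rewrite q0 mul0r => /eqP; rewrite eq_sym oner_eq0.
Qed.

Lemma aff_emb_regular (x : affine_space V) : polyfun q -> q x != 0 ->
  vregular_at aff_emb x.
Proof.
move=> pq qx; apply: vregular_row_mx; first exact: vregular_linear.
apply: vregular_mx => i j; rewrite (ord1 i) (ord1 j).
have -> : (fun v => ((q v)^-1%:M : 'M_1) 0 0) = fun v => (q v)^-1.
  by apply/funext => v; rewrite mxE mulr1n.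
by apply: regular_inv => //; exact: regular_polyfun.
Qed.

Lemma aff_prj_regular (s : affine_space 'rV[K]_(dim V + 1)) :
  vregular_at aff_prj s.
Proof. by apply: vregular_lin_comp; exact: vregular_linear. Qed.

Lemma aff_img_closed (F : set (affine_space V)) : polyfun q -> closed F ->
  closed (aff_img F).
Proof.
move=> pq cF; apply: closedI.
  have : continuous (aff_prj : affine_space _ -> affine_space V).
    by move=> s; case: (vregular_morph (aff_prj_regular s)).
  by move/continuous_closedP; exact.
apply: closed_regular => s; apply: regular_mul.
  exact: regular_polyfun_comp (aff_prj_regular s) pq.
by apply: regular_entry; exact: vregular_id.
Qed.

Lemma aff_iso (F : set (affine_space V)) : polyfun q ->
  exists f : sub_space (F `&` [set v | q v != 0]) -> sub_space (aff_img F),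
    isomorphism f.
Proof.
move=> pq; set D := _ `&` _.
have h1 x : D x -> aff_img F (aff_emb x) by case; exact: aff_emb_img.
have h2 s : aff_img F s -> D (aff_prj s) by exact: aff_img_prj.
exists (sub_fun (f := aff_emb : affine_space V -> affine_space _) h1).
apply: (sub_fun_iso (g := aff_prj : affine_space _ -> affine_space V)) => //.
- move=> x [_ qx]; split; last exact: aff_embK.
  exact/vregular_morph/aff_emb_regular.
- move=> s As; split; last by case: As => _; exact: aff_prjK.
  exact/vregular_morph/aff_prj_regular.
Qed.

End Embedding.

(** Flattens a product chart to row vectors with the base in the left block, as [smooth_at] requires
    its projection to be [lsubmx]. The additional base coordinate carries the inverse of [q]. *)
Definition chart_dec {V W : vectType K} (s : 'rV[K]_(dim V + 1 + dim W)) :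
  (V * W)%type := (aff_prj (lsubmx s), @r2v K W (rsubmx s)).

Definition chart_enc {V W : vectType K} (q : V -> K) (t : (V * W)%type) :
  'rV[K]_(dim V + 1 + dim W) := row_mx (aff_emb q t.1) (v2r t.2).

Lemma chart_dec_regular (V W : vectType K)
    (s : affine_space 'rV[K]_(dim V + 1 + dim W)) :
  vregular_at (@chart_dec V W) s.
Proof.
apply: vregular_pair.
  apply: (@vregular_comp _ _ _ V lsubmx (@aff_prj V)).
    exact: vregular_linear.
  exact: aff_prj_regular.
by apply: (@vregular_comp _ _ _ W rsubmx (@r2v K W)); exact: vregular_linear.
Qed.

Lemma chart_enc_regular (V W : vectType K) (q : V -> K)
    (t : affine_space (V * W)%type) : polyfun q -> q t.1 != 0 ->
  vregular_at (@chart_enc V W q) t.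
Proof.
move=> pq qt; apply: vregular_row_mx.
  apply: (@vregular_comp _ _ V _ (fun u : (V * W)%type => u.1) (aff_emb q)).
    by apply: vregular_fst; exact: vregular_id.
  exact: aff_emb_regular.
apply: (@vregular_comp _ _ W _ (fun u : (V * W)%type => u.2) v2r).
  by apply: vregular_snd; exact: vregular_id.
exact: vregular_linear.
Qed.

Lemma chart_encK (V W : vectType K) (q : V -> K) :
  cancel (chart_enc q) (@chart_dec V W).
Proof.
by case=> v w; rewrite /chart_dec /chart_enc row_mxKl row_mxKr aff_embK v2rK.
Qed.

Lemma nice_prevariety (X : kspace K) (x : X) : prevariety X -> nice_at x.
Proof.
move=> [n [U [hU UT]]].
have [i _ Ux] : (\bigcup_i U i) x by rewrite UT.
have [oU [N [A [_ [f isof]]]]] := hU i.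
have : nice_at (f (to_sub Ux)) by apply: nice_sub; exact: nice_affine.
by move/(nice_iso isof)/(nice_open_sub oU).
Qed.

Lemma isomorphic_affine_variety (X Y : kspace K) :
  isomorphic X Y -> affine_variety Y -> affine_variety X.
Proof.
move=> [f isof] [n [A [cA [g isog]]]]; exists n, A; split=> //.
by exists (g \o f); exact: isomorphism_comp.
Qed.

Lemma principal_affine_variety (V : vectType K) (q : V -> K)
    (F : set (affine_space V)) : polyfun q -> closed F ->
  affine_variety (sub_space (F `&` [set v | q v != 0])).
Proof.
move=> pq cF; exists (dim V + 1)%N, (aff_img q F); split.
  exact: aff_img_closed.
by have [f isof] := aff_iso F pq; exists f.
Qed.

(** Where two morphisms differ, some coordinate differs. The difference of these coordinate
    functions is regular on the prevariety [Z] and nonzero at the point, hence nonzero nearby. *)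
Lemma separated_sub_affine (V : vectType K) (A : set (affine_space V)) :
  separated_space (sub_space A).
Proof.
move=> Z f g pZ /kmorphismP mf /kmorphismP mg.
rewrite -openC openE => z /= /eqP fgz; rewrite /interior.
have [i fgi] : exists i, (v2r (val (f z)) - v2r (val (g z))) 0 i != 0.
  apply: contrapT => h; move: fgz; apply/negP/negPn/eqP/val_inj/v2r_inj/rowP => i.
  apply/eqP; rewrite -subr_eq0; apply/negPn/negP => hi; apply: h; exists i.
  by rewrite !mxE.
have reg (u : Z -> sub_space A) : morph_at u z ->
    regular_at z (fun y => v2r (val (u y)) 0 i).
  move=> mu; have := morph_at_comp mu (sub_val_morph (u z)).
  case=> _ /(_ (fun v => v2r v 0 i)); apply.
  by apply: regular_entry; exact: vregular_linear.
have [_ _ dz] := nice_prevariety (x := z) pZ (reg _ (mf z)).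
have rd := dz _ (reg _ (mg z)).
have [_ /(_ _) nz _] := nice_prevariety (x := z) pZ rd.
have := nz; rewrite !mxE in fgi => /(_ fgi).
by apply: filterS => y hy /= fgy; move: hy; rewrite fgy subrr eqxx.
Qed.

Lemma affine_variety_sub (V : vectType K) (A : set (affine_space V)) :
  affine_variety (sub_space A) -> variety (sub_space A).
Proof.
move=> aA; split; last exact: separated_sub_affine.
exists 1%N, (fun=> setT); split; last first.
  by apply/seteqP; split=> // x _; exists ord0.
move=> _; split; first exact: openT.
apply: isomorphic_affine_variety aA.
have [|f [isof _]] := @sub_sub_iso _ _ A setT A; last by exists f.
move=> x; split=> [Ax|[y _ <-]]; first by exists (to_sub Ax).
exact: set_mem (valP y).
Qed.

(** Only the case [c = 0] of the Jacobian criterion is needed: both [rho] and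
    [sigma] are locally open pieces of projections [A * W -> A]. *)
Lemma smooth_at_chart (X0 Y0 : kspace K) (R : set X0) (M : set Y0)
    (phi : sub_space R -> sub_space M) (F : X0 -> Y0) (x : sub_space R)
    (V W : vectType K) (V0 : set X0) (U0 : set Y0) (OA FA : set (affine_space V))
    (O : set (affine_space (V * W)%type))
    (alpha : Y0 -> affine_space V) (gamma : affine_space V -> Y0)
    (beta : X0 -> W) (eps : affine_space (V * W)%type -> X0) :
  (forall z, val (phi z) = F (val z)) ->
  open V0 -> V0 (val x) -> open U0 -> open OA -> closed FA -> open O ->
  (forall z, R z -> V0 z -> U0 (F z)) ->
  (forall y, M y -> U0 y -> [/\ morph_at alpha y, OA (alpha y), FA (alpha y) &
     gamma (alpha y) = y]) ->
  (forall v, OA v -> FA v -> [/\ morph_at gamma v, M (gamma v), U0 (gamma v) &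
     alpha (gamma v) = v]) ->
  (forall z, R z -> V0 z ->
     [/\ morph_at (fun z => (alpha (F z), beta z) : affine_space (V * W)%type) z,
         O (alpha (F z), beta z) & eps (alpha (F z), beta z) = z]) ->
  (forall t, OA t.1 -> FA t.1 -> O t ->
     [/\ morph_at eps t, R (eps t), V0 (eps t), F (eps t) = gamma t.1 &
         beta (eps t) = t.2]) ->
  smooth_at phi x.
Proof.
move=> phiE oV0 V0x oU0 oOA cFA oO FU0 hal hga hbe hep.
have Rx : R (val x) := set_mem (valP x).
have Mphi z : M (val (phi z)) := set_mem (valP (phi z)).
have MF z : R z -> M (F z).
  by move=> Rz; have := Mphi (to_sub Rz); rewrite phiE.
have U0x := FU0 _ Rx V0x.
have [ma OAx FAx gax] := hal _ (MF _ Rx) U0x.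
(* The base chart is only locally closed. It is shrunk to a principal open set inside [OA], on which
   [FA] becomes the closed set [aff_img q FA] of one more coordinate. *)
have [q pq [qx qOA]] := (oOA : zariski_open OA) _ OAx.
pose U : set (sub_space M) := [set y | U0 (val y) /\ q (alpha (val y)) != 0].
pose V1 : set (sub_space R) :=
  [set z | V0 (val z) /\ q (alpha (F (val z))) != 0].
have oU : open U.
  rewrite openE => y [Uy qy]; rewrite /interior.
  have My : M (val y) := set_mem (valP y).
  have [mal _ _ _] := hal _ My Uy.
  have n1 := morph_at_nbhs mal (near_nonzero pq qy).
  have n2 := open_nbhs_nbhs (conj oU0 Uy).
  have nU : nbhs (val y) [set y' | U0 y' /\ q (alpha y') != 0].
    by apply: filterS2 n1 n2 => y' qy' Uy'.
  exact: (@near_subT _ M y _ nU).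
have oV1 : open V1.
  rewrite openE => z [Vz qz]; rewrite /interior.
  have [mal _ _] := hbe _ (set_mem (valP z)) Vz.
  have pq1 : polyfun (fun t : (V * W)%type => q t.1).
    have fl : linear (fun w : (V * W)%type => w.1) by [].
    elim: pq => [c|l|f g _ pf _ pg|f g _ pf _ pg].
    - exact: polyfun_cst.
    - exact: (polyfun_lin (l \o linear_of fl : {scalar _})).
    - exact: polyfun_add.
    - exact: polyfun_mul.
  have n1 := morph_at_nbhs mal (near_nonzero
    (x := (alpha (F (val z)), beta (val z)) : zariski (V * W)%type) pq1 qz).
  have n2 := open_nbhs_nbhs (conj oV0 Vz).
  have nV : nbhs (val z) [set z' | V0 z' /\ q (alpha (F z')) != 0].
    by apply: filterS2 n1 n2 => z' qz' Vz'.
  exact: (@near_subT _ R z _ nV).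
pose A := aff_img q FA.
pose N := (dim V + 1)%N; pose n := dim W.
pose dec : 'rV[K]_(N + n) -> (V * W)%type := @chart_dec V W.
pose enc : (V * W)%type -> 'rV[K]_(N + n) := chart_enc q.
have rdec s : vregular_at dec s by exact: chart_dec_regular.
pose O1 : set (affine_space 'rV[K]_(N + n)) := [set s | O (dec s)].
have oO1 : open O1.
  have : continuous (dec : affine_space _ -> affine_space (V * W)%type).
    by move=> s; case: (vregular_morph (rdec s)).
  by move/continuousP; exact.
exists V1, U, N, n, 0%N, A, O1, (fun i : 'I_0 => False_rect _ (notF (ltn_ord i))).
split.
- split=> // _ [z [Vz qz] <-]; split; rewrite /= phiE //; apply: FU0 => //.
  exact: set_mem (valP z).
- by split=> //; exact: aff_img_closed.
- by move=> s _; rewrite flatmx0 mxrank0.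
pose U' : set Y0 := [set y | [/\ M y, U0 y & q (alpha y) != 0]].
pose V' : set X0 := [set z | [/\ R z, V0 z & q (alpha (F z)) != 0]].
have [|u1 [isou1 u1E]] := @sub_sub_iso _ _ M U U'.
  move=> y; split=> [[My Uy qy]|[y' [Uy qy] <-]]; first by exists (to_sub My).
  by split=> //; exact: set_mem (valP y').
have [|v1 [isov1 v1E]] := @sub_sub_iso _ _ R V1 V'.
  move=> z; split=> [[Rz Vz qz]|[z' [Vz qz] <-]]; first by exists (to_sub Rz).
  by split=> //; exact: set_mem (valP z').
set E : set (affine_space 'rV[K]_(N + n)) := (X in sub_space X).
have EP s : E s <-> O1 s /\ A (lsubmx s).
  by split=> [[]|[]] //; split=> // -[].
pose F2 : Y0 -> affine_space 'rV[K]_N := aff_emb q \o alpha.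
pose G2 : affine_space 'rV[K]_N -> Y0 := gamma \o (@aff_prj V).
have F2A y : U' y -> A (F2 y).
  by move=> [My Uy qy]; have [_ _ FAy _] := hal _ My Uy; exact: aff_emb_img.
have G2U s : A s -> U' (G2 s).
  move=> As; have [FAs qs] := aff_img_prj As.
  by have [_ Ms Us as_] := hga _ (qOA _ qs) FAs; split=> //; rewrite as_.
pose F3 : X0 -> affine_space 'rV[K]_(N + n) := fun z => enc (alpha (F z), beta z).
pose G3 : affine_space 'rV[K]_(N + n) -> X0 := eps \o dec.
have decenc t : dec (enc t) = t by exact: chart_encK.
have F3E z : V' z -> E (F3 z).
  move=> [Rz Vz qz]; have [_ Oz _] := hbe _ Rz Vz; apply/EP; split.
    by rewrite /O1 /= decenc.
  by rewrite /F3 /enc row_mxKl; apply: F2A; split=> //; [exact: MF | exact: FU0].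
have G3V s : E s -> V' (G3 s).
  move=> /EP[Os As]; have [FAs qs] := aff_img_prj As.
  have [_ Rs Vs Fs bs] := hep (dec s) (qOA _ qs) FAs Os.
  have [_ _ _ ag] := hga _ (qOA _ qs) FAs.
  by split=> //; rewrite /G3 /= Fs ag.
exists (sub_fun F2A \o u1), (sub_fun F3E \o v1); split.
- apply: isomorphism_comp isou1 _; apply: (sub_fun_iso _ G2U).
    move=> y [My Uy qy]; have [may _ _ gy] := hal _ My Uy; split.
      exact: morph_at_comp may (vregular_morph (aff_emb_regular pq qy)).
    by rewrite /G2 /F2 /= aff_embK.
  move=> s As; have [FAs qs] := aff_img_prj As.
  have [mg _ _ ag] := hga _ (qOA _ qs) FAs; split.
    exact: morph_at_comp (vregular_morph (aff_prj_regular _)) mg.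
  by rewrite /G2 /F2 /= ag; case: As => _; exact: aff_prjK.
- apply: isomorphism_comp isov1 _; apply: (sub_fun_iso _ G3V).
    move=> z [Rz Vz qz]; have [mz _ ez] := hbe _ Rz Vz; split; last first.
      by rewrite /G3 /F3 /= decenc.
    by apply: morph_at_comp mz _; apply/vregular_morph/chart_enc_regular.
  move=> s /EP[Os As]; have [FAs qs] := aff_img_prj As.
  have [me _ _ Fs bs] := hep (dec s) (qOA _ qs) FAs Os.
  have [_ _ _ ag] := hga _ (qOA _ qs) FAs; split.
    exact: morph_at_comp (vregular_morph (rdec s)) me.
  rewrite /F3 /G3 /= Fs ag bs /enc /dec /chart_enc /chart_dec /= r2vK aff_prjK ?hsubmxK //.
  by case: As.
- move=> z y zy; rewrite /= u1E v1E /F3 /enc /chart_enc row_mxKl /F2 /= -zy phiE.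
  by [].
Qed.

End AffineVarieties.

(** * The Grassmannian as a quotient of the general linear group *)

Section MatrixFacts.
Context {F : fieldType}.

Lemma unitmx_ker n (A : 'M[F]_n) :
  (forall c : 'cV_n, A *m c = 0 -> c = 0) -> A \in unitmx.
Proof.
move=> kerA; rewrite -unitmx_tr unitmxE unitfE; apply/det0P => -[v v0 vA].
have /kerA/(congr1 trmx) : A *m v^T = 0.
  by apply: trmx_inj; rewrite trmx_mul trmxK vA trmx0.
by rewrite trmxK trmx0 => vE; rewrite vE eqxx in v0.
Qed.

Lemma invmx_mul n (A B : 'M[F]_n) : A \in unitmx -> B \in unitmx ->
  invmx (A *m B) = invmx B *m invmx A.
Proof.
move=> uA uB; have uAB : A *m B \in unitmx by rewrite unitmx_mul uA.
apply: (can_inj (mulKmx uAB)).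
by rewrite mulmxV // mulmxA mulmxK // mulmxV.
Qed.

Lemma vspace_matrix n (U : {vspace 'cV[F]_n}) (k : nat) : \dim U = k ->
  exists M : 'M[F]_(n, k), (forall v, v \in U <-> exists c : 'cV_k, v = M *m c) /\
    (forall c : 'cV_k, M *m c = 0 -> c = 0).
Proof.
move=> <-; pose M := \matrix_(i, j) ((vbasis U)`_j) i 0 : 'M[F]_(n, \dim U).
have ME (c : 'cV_(\dim U)) : M *m c = \sum_j c j 0 *: (vbasis U)`_j.
  apply/colP => i; rewrite mxE summxE; apply: eq_bigr => j _.
  by rewrite !mxE mulrC.
exists M; split=> [v|c].
  split=> [vU|[c ->]]; last first.
    rewrite ME; apply: memv_suml => j _; apply: memvZ; apply: vbasis_mem.
    by apply: mem_nth; rewrite size_tuple.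
  exists (\col_j coord (vbasis U) j v); rewrite ME {1}(coord_vbasis vU).
  by apply: eq_bigr => j _; rewrite mxE.
rewrite ME => c0; apply/colP => j; rewrite mxE.
have /freeP := basis_free (vbasisP U).
by move/(_ (fun j => c j 0) c0).
Qed.

Lemma mul_mx_row_col m n1 n2 k (A : 'M[F]_(m, n1 + n2)) (B : 'M[F]_(n1 + n2, k)) :
  A *m B = lsubmx A *m usubmx B + rsubmx A *m dsubmx B.
Proof. by rewrite -{1}(hsubmxK A) -{1}(vsubmxK B) mul_row_col. Qed.

End MatrixFacts.

Section Grassmannian.
Context {K : closedFieldType} {m d : nat}.
Local Notation V := 'cV[K]_(m + d).
Local Notation GL := [set b : affine_space 'M[K]_(m + d) | b \in unitmx].
Local Notation rho := (@rho K m d).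
Implicit Types b : 'M[K]_(m + d).

Lemma mem_rho b (v : V) : v \in rho b <-> exists c, v = lsubmx b *m c.
Proof.
have fl : linear (fun c : 'cV[K]_m => lsubmx b *m c).
  by move=> a u w; rewrite mulmxDr scalemxAr.
have LE c : linfun (linear_of fl) c = lsubmx b *m c by rewrite lfunE.
suff -> : rho b = limg (linfun (linear_of fl)).
  by split=> [/memv_imgP[c _ ->]|[c ->]]; [exists c | rewrite -LE memv_img ?memvf].
apply/eqP; rewrite eqEsubv; apply/andP; split.
  apply/span_subvP => _ /mapP[i _ ->].
  have -> : col (lshift d i) b = linfun (linear_of fl) (delta_mx i 0).
    by rewrite LE -colE; apply/colP => k; rewrite !mxE.
  by rewrite memv_img ?memvf.
apply/subvP => _ /memv_imgP[c _ ->]; rewrite LE.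
have -> : lsubmx b *m c = \sum_i c i 0 *: col (lshift d i) b.
  apply/colP => k; rewrite mxE summxE; apply: eq_bigr => i _.
  by rewrite !mxE mulrC.
apply: memv_suml => i _; apply/memvZ/memv_span/mapP.
by exists i; rewrite ?mem_enum.
Qed.

Lemma mem_rho_unit b (v : V) : b \in unitmx ->
  v \in rho b <-> dsubmx (invmx b *m v) = 0.
Proof.
move=> ub; split.
  case/mem_rho => c ->.
  have -> : lsubmx b *m c = b *m col_mx c 0.
    by rewrite mul_mx_row_col col_mxKu col_mxKd mulmx0 addr0.
  by rewrite mulKmx // col_mxKd.
move=> v0; apply/mem_rho; exists (usubmx (invmx b *m v)).
by rewrite -{1}(mulKVmx ub v) mul_mx_row_col v0 mulmx0 addr0.
Qed.

Lemma dim_rho b : b \in unitmx -> \dim (rho b) = m.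
Proof.
move=> ub.
have fl : linear (fun c : 'cV[K]_m => lsubmx b *m c).
  by move=> a u w; rewrite mulmxDr scalemxAr.
have LE c : linfun (linear_of fl) c = lsubmx b *m c by rewrite lfunE.
have -> : rho b = limg (linfun (linear_of fl)).
  apply/vspaceP => v; apply/idP/idP => [/mem_rho[c ->]|/memv_imgP[c _ ->]].
    by rewrite -LE memv_img ?memvf.
  by rewrite LE; apply/mem_rho; exists c.
rewrite limg_dim_eq; last first.
  apply/eqP; rewrite -subv0; apply/subvP => c; rewrite memv_cap => /andP[_].
  rewrite memv_ker LE memv0 => /eqP bc.
  have : b *m col_mx c 0 = 0.
    by rewrite mul_mx_row_col col_mxKu col_mxKd mulmx0 addr0.
  move/(congr1 (mulmx (invmx b))); rewrite mulKmx // mulmx0.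
  by move/(congr1 usubmx); rewrite col_mxKu linear0 => ->.
by rewrite dimvf /dim /= muln1.
Qed.

Lemma rho_sub b b' : b \in unitmx ->
  (rho b' <= rho b)%VS <-> dlsubmx (invmx b *m b') = 0.
Proof.
move=> ub; have E (c : 'cV_m) : dsubmx (invmx b *m (lsubmx b' *m c)) =
    dlsubmx (invmx b *m b') *m c.
  by rewrite -mul_dsub_mx mulmxA mulmx_lsub mul_dsub_mx.
split=> [/subvP sub|h].
  apply/matrixP => i j; rewrite [RHS]mxE.
  have /(mem_rho_unit _ ub) : lsubmx b' *m delta_mx j 0 \in rho b.
    by apply: sub; apply/mem_rho; exists (delta_mx j 0).
  by rewrite E -colE => /colP/(_ i); rewrite !mxE.
apply/subvP => _ /mem_rho[c ->]; apply/mem_rho_unit => //.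
by rewrite E h mul0mx.
Qed.

Lemma rho_eq b b' : b \in unitmx -> b' \in unitmx ->
  rho b' = rho b <-> dlsubmx (invmx b *m b') = 0.
Proof.
move=> ub ub'; split=> [e|/(rho_sub _ ub) s].
  by apply/rho_sub => //; rewrite e.
have : (rho b' : {vspace V}) == rho b by rewrite eqEdim s !dim_rho ?leqnn.
by move/eqP.
Qed.

Lemma parabolicP (h : 'M[K]_(m + d)) :
  parabolic h <-> h \in unitmx /\ dlsubmx h = 0.
Proof.
split=> [[h1 [h2 [h3 [u1 u3 ->]]]]|[uh h0]].
  rewrite block_mxKdl unitmxE det_ublock unitrM -!unitmxE; split=> //.
  exact/andP.
exists (ulsubmx h), (ursubmx h), (drsubmx h).
have hE : h = block_mx (ulsubmx h) (ursubmx h) 0 (drsubmx h).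
  by rewrite -{1}(submxK h) h0.
rewrite hE unitmxE det_ublock unitrM -!unitmxE in uh.
by case/andP: uh.
Qed.

Lemma rho_parabolic b b' : b \in unitmx -> b' \in unitmx ->
  rho b' = rho b <-> exists2 h, parabolic h & b' = b *m h.
Proof.
move=> ub ub'; split=> [/(rho_eq ub ub') h0|[h /parabolicP[uh h0] ->]].
  exists (invmx b *m b'); last by rewrite mulKVmx.
  by apply/parabolicP; rewrite unitmx_mul unitmx_inv ub.
by apply/rho_eq; rewrite ?unitmx_mul ?ub ?uh // mulKmx.
Qed.

Lemma graph_chart_morph (W C : {vspace V})
    (A : affine_space 'Hom(subvs_of W, subvs_of C)) : complementary W C ->
  @morph_at K _ (grassmannian V) (@graph_chart K V W C) A.
Proof.
move=> cWC; apply: morph_atI => [B nB|g rg]; last exact: rg.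
by have := graph_chart_continuous cWC nB.
Qed.

Lemma mem_graph_chart (W C : {vspace V})
    (A : affine_space 'Hom(subvs_of W, subvs_of C)) (v : V) :
  v \in graph_chart A <->
  exists w : subvs_of W, v = vsval w + vsval (fun_of_lfun A w).
Proof.
have fl : linear (fun w : subvs_of W => vsval w + vsval (fun_of_lfun A w)).
  by move=> a u w; rewrite !linearP scalerDr addrACA.
have LE w : linfun (fun w : subvs_of W => vsval w + vsval (fun_of_lfun A w)) w =
    vsval w + vsval (fun_of_lfun A w).
  by rewrite (lfunE (linear_of fl)).
split=> [/memv_imgP[w _ ->]|[w ->]]; first by exists w; rewrite LE.
by rewrite -LE memv_img ?memvf.
Qed.

(** The unipotent group opposite to the parabolic one. Its translates by [b0] parametrize the big
    cell of the Grassmannian around [rho b0], and [slope] is the affine coordinate on that cell: if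
    the upper left block is invertible, the first columns span the graph of [slope c]. *)
Definition lower (a : 'M[K]_(d, m)) : 'M[K]_(m + d) := block_mx 1%:M 0 a 1%:M.

Lemma lower_unit a : lower a \in unitmx.
Proof. by rewrite unitmxE det_lblock !det1 mulr1 unitr1. Qed.

Definition slope (c : 'M[K]_(m + d)) : 'M[K]_(d, m) :=
  dlsubmx c *m invmx (ulsubmx c).

Lemma lower_slope c : ulsubmx c \in unitmx ->
  dlsubmx (lower (- slope c) *m c) = 0.
Proof.
move=> uc; rewrite -{2}(submxK c) mulmx_block block_mxKdl mul1mx mulNmx.
by rewrite mulmxKV // addNr.
Qed.

Lemma slope_lower a : slope (lower a) = a.
Proof. by rewrite /slope block_mxKdl block_mxKul invmx1 mulmx1. Qed.

Lemma lowerN a : lower (- a) *m lower a = 1%:M.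
Proof.
rewrite mulmx_block !mul1mx !mulmx1 !mul0mx !mulmx0 !addr0 addNr add0r.
by rewrite -scalar_mx_block.
Qed.

Lemma invmx_lower a : invmx (lower a) = lower (- a).
Proof.
by rewrite -[LHS]mul1mx -(lowerN a) mulmxK // lower_unit.
Qed.

Lemma rho_lower_slope b0 b : b0 \in unitmx -> b \in unitmx ->
  ulsubmx (invmx b0 *m b) \in unitmx ->
  rho (b0 *m lower (slope (invmx b0 *m b))) = rho b.
Proof.
move=> u0 ub uc; symmetry; apply/rho_eq => //.
  by rewrite unitmx_mul u0 lower_unit.
rewrite invmx_mul ?lower_unit // invmx_lower -mulmxA.
exact: lower_slope.
Qed.

Lemma slope_parabolic c h : parabolic h -> ulsubmx c \in unitmx ->
  ulsubmx (c *m h) \in unitmx /\ slope (c *m h) = slope c.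
Proof.
move=> [h1 [h2 [h3 [u1 u3 ->]]]] uc; rewrite -(submxK c) mulmx_block.
rewrite /slope !block_mxKul !block_mxKdl !mulmx0 !addr0.
rewrite unitmx_mul uc u1; split=> //.
by rewrite invmx_mul // -mulmxA [X in _ *m X]mulmxA mulmxV // mul1mx.
Qed.

Lemma lower_regular (a : affine_space 'M[K]_(d, m)) : vregular_at lower a.
Proof.
apply: vregular_col_mx; apply: vregular_row_mx.
- exact: vregular_cst.
- exact: vregular_cst.
- exact: vregular_id.
- exact: vregular_cst.
Qed.

Lemma slope_regular (c : affine_space 'M[K]_(m + d)) : ulsubmx c \in unitmx ->
  vregular_at slope c.
Proof.
have ul : vregular_at (fun c : 'M[K]_(m + d) => ulsubmx c) c.
  by apply: vregular_lsubmx; apply: vregular_usubmx; exact: vregular_id.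
move=> uc; apply: vregular_mulmx; last exact: vregular_invmx.
by apply: vregular_lsubmx; apply: vregular_dsubmx; exact: vregular_id.
Qed.

Lemma mulmxl_regular n k l (A : 'M[K]_(n, k)) (x : affine_space 'M[K]_(k, l)) :
  vregular_at (mulmx A) x.
Proof. by apply: vregular_mulmx; [exact: vregular_cst | exact: vregular_id]. Qed.

Lemma mulmxr_regular n k l (A : 'M[K]_(k, l)) (x : affine_space 'M[K]_(n, k)) :
  vregular_at (fun B => B *m A) x.
Proof. by apply: vregular_mulmx; [exact: vregular_id | exact: vregular_cst]. Qed.

(** In the chart given by the spans of the first [m] and of the last [d] columns of [b0], the space
    [rho (b0 *m lower a)] is the graph of a map depending linearly on [a]. Near [b0], [rho b] has
    this form with [a] the slope of [invmx b0 *m b], a regular function of [b]. *)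
Lemma rho_morph b0 : b0 \in unitmx ->
  @morph_at K (affine_space 'M[K]_(m + d)) (grassmannian V) rho b0.
Proof.
move=> u0; set W : {vspace V} := rho b0.
have fl : linear (fun c : 'cV[K]_d => rsubmx b0 *m c).
  by move=> a u w; rewrite mulmxDr scalemxAr.
pose C : {vspace V} := limg (linfun (linear_of fl)).
have memC v : v \in C <-> exists c, v = rsubmx b0 *m c.
  split=> [/memv_imgP[c _ ->]|[c ->]]; first by exists c; rewrite lfunE.
  have -> : rsubmx b0 *m c = linfun (linear_of fl) c by rewrite lfunE.
  by rewrite memv_img ?memvf.
have cWC : complementary W C.
  split; apply/eqP; rewrite eqEsubv.
    rewrite subvf; apply/subvP => v _.
    rewrite -(mulKVmx u0 v) mul_mx_row_col; apply: memv_add.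
      by apply/mem_rho; exists (usubmx (invmx b0 *m v)).
    by apply/memC; exists (dsubmx (invmx b0 *m v)).
  rewrite sub0v andbT; apply/subvP => v; rewrite memv_cap memv0.
  case/andP => /mem_rho[c ->] /memC[c' cc'].
  have : b0 *m col_mx c (- c') = 0.
    by rewrite mul_mx_row_col col_mxKu col_mxKd mulmxN cc' subrr.
  move/(congr1 (mulmx (invmx b0))); rewrite mulKmx // mulmx0.
  by move/(congr1 usubmx); rewrite col_mxKu linear0 => ->; rewrite mulmx0.
pose f (a : 'M[K]_(d, m)) (w : subvs_of W) : subvs_of C :=
  vsproj C (rsubmx b0 *m (a *m usubmx (invmx b0 *m vsval w))).
have flin a : linear (f a).
  move=> c u v; rewrite /f [vsval _]linearP /= mulmxDr -scalemxAr.
  rewrite [usubmx _]linearP /= mulmxDr -scalemxAr mulmxDr -scalemxAr.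
  by rewrite linearP.
pose L (a : 'M[K]_(d, m)) : 'Hom(subvs_of W, subvs_of C) :=
  linfun (linear_of (flin a)).
have Llin : linear L.
  move=> c u v; apply/lfunP => w.
  rewrite add_lfunE scale_lfunE !lfunE /= /f mulmxDl mulmxDr linearD /=.
  by rewrite -scalemxAl -scalemxAr linearZ.
have LE a : graph_chart (L a : affine_space _) = rho (b0 *m lower a).
  apply/vspaceP => v.
  have colE (c : 'cV_m) : lsubmx (b0 *m lower a) *m c = lsubmx b0 *m c + rsubmx b0 *m (a *m c).
    rewrite -mulmx_lsub /lower block_mxEh row_mxKl -mulmxA mul_col_mx.
    by rewrite mul_mx_row_col col_mxKu col_mxKd mul1mx.
  have wE (w : subvs_of W) c : vsval w = lsubmx b0 *m c ->
      vsval (fun_of_lfun (L a) w) = rsubmx b0 *m (a *m c).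
    move=> wc; rewrite lfunE /= /f vsprojK; last first.
      by apply/memC; exists (a *m usubmx (invmx b0 *m vsval w)).
    congr (_ *m (_ *m _)); rewrite wc.
    have -> : lsubmx b0 *m c = b0 *m col_mx c 0.
      by rewrite mul_mx_row_col col_mxKu col_mxKd mulmx0 addr0.
    by rewrite mulKmx // col_mxKu.
  apply/idP/idP => [/mem_graph_chart[w ->]|/mem_rho[c ->]].
    have /mem_rho[c wc] := subvsP w.
    by rewrite (wE _ _ wc) wc; apply/mem_rho; exists c; rewrite colE.
  apply/mem_graph_chart.
  have cW : lsubmx b0 *m c \in W by apply/mem_rho; exists c.
  exists (vsproj W (lsubmx b0 *m c)).
  by rewrite (wE _ c) vsprojK // colE.
have ul0 : ulsubmx (invmx b0 *m b0) \in unitmx.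
  by rewrite mulVmx // scalar_mx_block block_mxKul unitmx1.
apply: (@morph_at_near K (affine_space 'M[K]_(m + d)) (grassmannian V)
  (@graph_chart K V W C \o (fun b => linear_of Llin (slope (invmx b0 *m b))))).
  have n1 : \forall b \near (b0 : affine_space 'M[K]_(m + d)), b \in unitmx.
    by apply: near_unitmx => //; exact: vregular_id.
  have n2 : \forall b \near (b0 : affine_space 'M[K]_(m + d)),
      ulsubmx (invmx b0 *m b) \in unitmx.
    apply: (near_unitmx (F := fun b => ulsubmx (invmx b0 *m b))) => //.
    by apply: vregular_lsubmx; apply: vregular_usubmx; exact: mulmxl_regular.
  by apply: filterS2 n1 n2 => b ub uc /=; rewrite LE rho_lower_slope.
apply: morph_at_comp (graph_chart_morph _ cWC).
apply: vregular_morph; apply: vregular_lin_comp.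
by apply: vregular_comp (mulmxl_regular _ _) _; exact: slope_regular.
Qed.

End Grassmannian.

Section GrassmannianQuotient.
Context {K : closedFieldType} {m d : nat}.
Local Notation V := 'cV[K]_(m + d).
Local Notation GL := [set b : affine_space 'M[K]_(m + d) | b \in unitmx].
Local Notation rho := (@rho K m d).
Implicit Types b : 'M[K]_(m + d).

Lemma dim_graph_chart (W C : {vspace V})
    (A : affine_space 'Hom(subvs_of W, subvs_of C)) : complementary W C ->
  \dim (graph_chart A) = \dim W.
Proof.
move=> [_ WC0].
have fl : linear (fun w : subvs_of W => vsval w + vsval (fun_of_lfun A w)).
  by move=> a u w; rewrite !linearP scalerDr addrACA.
rewrite /graph_chart limg_dim_eq; first by rewrite dimvf.
apply/eqP; rewrite -subv0; apply/subvP => w; rewrite memv_cap memvf /=.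
rewrite memv_ker (lfunE (linear_of fl)) /= => /eqP wA.
have : vsval w \in (W :&: C)%VS.
  rewrite memv_cap subvsP; move/eqP: wA; rewrite addr_eq0 => /eqP ->.
  by rewrite memvN subvsP.
by rewrite WC0 !memv0 => /eqP w0; apply/eqP/val_inj; rewrite /= w0.
Qed.

(** A regular section of [rho] over each chart: a basis of [W] displaced by its image under [A],
    completed by a basis of [C]. It turns statements on charts into statements on matrices. *)
Lemma graph_chart_lift (W C : {vspace V}) : complementary W C -> \dim W = m ->
  exists t : affine_space 'Hom(subvs_of W, subvs_of C) -> affine_space 'M[K]_(m + d),
    forall A, [/\ morph_at t A, t A \in unitmx & rho (t A) = graph_chart A].
Proof.
move=> [WCT WC0] dW.
have dC : \dim C = d.
  apply/eqP; rewrite -(eqn_add2l m) -{1}dW -dimv_disjoint_sum // WCT.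
  by rewrite dimvf /dim /= muln1.
have [Wm [memW injW]] := vspace_matrix dW.
have [Cm [memC injC]] := vspace_matrix dC.
pose N (A : 'Hom(subvs_of W, subvs_of C)) : 'M[K]_(m + d, m) :=
  \matrix_(i, j) (vsval (fun_of_lfun A (vsproj W (col j Wm)))) i 0.
have Nlin : linear N.
  move=> c A B; apply/matrixP => i j.
  by rewrite !mxE add_lfunE scale_lfunE [vsval _]linearP !mxE.
have NE A (c : 'cV_m) : N A *m c = vsval (fun_of_lfun A (vsproj W (Wm *m c))).
  have -> : Wm *m c = \sum_j c j 0 *: col j Wm.
    apply/colP => i; rewrite mxE summxE; apply: eq_bigr => j _.
    by rewrite !mxE mulrC.
  rewrite !linear_sum; apply/colP => i; rewrite mxE summxE.
  by apply: eq_bigr => j _; rewrite !linearZ !mxE mulrC.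
pose t (A : 'Hom(subvs_of W, subvs_of C)) : 'M[K]_(m + d) :=
  row_mx (Wm + linear_of Nlin A) Cm.
exists t => A; split.
- apply: vregular_morph; apply: vregular_row_mx; last exact: vregular_cst.
  by apply: vregular_add; [exact: vregular_cst | exact: vregular_linear].
- apply: unitmx_ker => c; rewrite -(vsubmxK c) /t mul_row_col mulmxDl /= NE.
  set c1 := usubmx c; set c2 := dsubmx c => c0.
  have WC : Wm *m c1 \in (W :&: C)%VS.
    rewrite memv_cap; apply/andP; split; first by apply/memW; exists c1.
    move/eqP: c0; rewrite -addrA addr_eq0 => /eqP ->.
    by rewrite memvN memvD ?subvsP //; apply/memC; exists c2.
  move: WC; rewrite WC0 memv0 => /eqP W0.
  move: c0; rewrite W0 !linear0 addr0 add0r => /injC ->.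
  by rewrite (injW _ W0) col_mx0.
- have mt (c : 'cV_m) : lsubmx (t A) *m c =
      Wm *m c + vsval (fun_of_lfun A (vsproj W (Wm *m c))).
    by rewrite row_mxKl mulmxDl -NE.
  apply/vspaceP => v; apply/idP/idP => [/mem_rho[c ->]|/mem_graph_chart[w ->]].
    apply/mem_graph_chart; exists (vsproj W (Wm *m c)).
    by rewrite mt vsprojK //; apply/memW; exists c.
  have /memW[c wc] := subvsP w; apply/mem_rho; exists c.
  by rewrite mt -wc vsvalK.
Qed.

Lemma rho_surj (U : {vspace V}) : \dim U = m -> exists2 b, b \in unitmx & rho b = U.
Proof.
move=> dU.
have cU : complementary U (U^C)%VS by split; [exact: addv_complf | exact: capv_compl].
have [t tP] := graph_chart_lift cU dU.
have [_ u0 t0] := tP (0 : 'Hom(_, _)); exists (t (0 : 'Hom(_, _))) => //.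
rewrite t0; apply/vspaceP => v; apply/idP/idP => [/mem_graph_chart[w ->]|vU].
  by rewrite zero_lfunE linear0 addr0 subvsP.
by apply/mem_graph_chart; exists (vsproj U v); rewrite zero_lfunE linear0 addr0 vsprojK.
Qed.

(** Openness is tested on charts. A point [b] of [O] over a graph differs from the value of the
    section [t] by a parabolic [h], and the translate of [t] by [h] stays in [O] nearby. *)
Lemma rho_open (O : set (affine_space 'M[K]_(m + d))) : open O ->
  @open (grassmannian V) (rho @` (GL `&` O)).
Proof.
move=> oO; suff : @grass_open K V (rho @` (GL `&` O)) by [].
move=> W C cWC; rewrite openE => A [b [ub Ob] bA]; rewrite /interior.
have dW : \dim W = m by rewrite -(dim_graph_chart A cWC) -bA dim_rho.
have [t tP] := graph_chart_lift cWC dW; have [mt ut tA] := tP A.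
have [h /parabolicP[uh h0] bE] : exists2 h, parabolic h & b = t A *m h.
  by apply/rho_parabolic; rewrite ?tA.
have mth : morph_at ((fun c : affine_space 'M[K]_(m + d) =>
    (c *m h : affine_space 'M[K]_(m + d))) \o t) A.
  exact: morph_at_comp mt (vregular_morph (mulmxr_regular _ _)).
have nO : nbhs (((fun c : affine_space 'M[K]_(m + d) =>
    (c *m h : affine_space 'M[K]_(m + d))) \o t) A) O.
  by rewrite /= -bE; exact: open_nbhs_nbhs.
have := morph_at_nbhs mth nO; apply: filterS => A' /= OA'.
have [_ ut' tA'] := tP A'; exists (t A' *m h).
  by split=> //=; rewrite unitmx_mul ut'.
rewrite -tA'; apply/rho_parabolic => //; first by rewrite unitmx_mul ut'.
by exists h => //; exact/parabolicP.
Qed.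

(** The quotient property of [rho]: morphisms out of the Grassmannian can be checked on invertible
    matrices. *)
Lemma grass_morph (Y : kspace K) (s : grassmannian V -> Y) (U : grassmannian V) :
  \dim U = m ->
  (forall b, b \in unitmx -> rho b = U ->
    @morph_at K (affine_space 'M[K]_(m + d)) Y (s \o rho) b) -> morph_at s U.
Proof.
move=> dU ms; apply: morph_atI => [B nB|g rg].
  have [b0 ub0 b0U] := rho_surj dU.
  rewrite -b0U in nB *.
  have /near_open[O [oO Ob OB]] := morph_at_nbhs (ms _ ub0 b0U) nB.
  rewrite nbhsE; exists (rho @` (GL `&` O)).
    by split; [exact: rho_open | exists b0].
  by move=> _ [b [_ /OB] ? <-].
move=> W C A cWC AU.
have dW : \dim W = m by rewrite -(dim_graph_chart A cWC) AU.
have [t tP] := graph_chart_lift cWC dW; have [mt ut tA] := tP A.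
have mst : morph_at ((s \o rho) \o t) A.
  by apply: morph_at_comp mt _; apply: ms => //; rewrite tA.
have -> : (g \o s) \o @graph_chart K V W C = g \o ((s \o rho) \o t).
  by apply/funext => A' /=; have [_ _ ->] := tP A'.
by apply: mst.2; rewrite /= tA AU.
Qed.

(** A representative of [U] is chosen; on the chart domain the result does not depend on it, because
    the slope is invariant under the parabolic group. The value 0 is a default when no invertible
    matrix represents [U]. *)
Definition chart_slope b0 (U : grassmannian V) : 'M[K]_(d, m) :=
  if pselect (exists2 b, b \in unitmx & rho b = U) is left h
  then slope (invmx b0 *m projT1 (cid2 h)) else 0.

Definition chart_domain b0 : set (grassmannian V) :=
  rho @` (GL `&` [set b | ulsubmx (invmx b0 *m b) \in unitmx]).

Lemma open_ul_unit b0 : open ([set b | ulsubmx (invmx b0 *m b) \in unitmx] :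
  set (affine_space 'M[K]_(m + d))).
Proof.
rewrite openE => b ub; rewrite /interior.
apply: (near_unitmx (F := fun b => ulsubmx (invmx b0 *m b))) => //.
by apply: vregular_lsubmx; apply: vregular_usubmx; exact: mulmxl_regular.
Qed.

Lemma chart_domain_open b0 : open (chart_domain b0).
Proof. exact: (rho_open (@open_ul_unit b0)). Qed.

Lemma chart_domain_ul b0 b : b \in unitmx -> chart_domain b0 (rho b) ->
  ulsubmx (invmx b0 *m b) \in unitmx.
Proof.
move=> ub [b' [ub' uc] /(rho_parabolic ub ub')[h ph b'E]].
have /parabolicP[uh _] := ph.
have [h1 [h2 [h3 [u1 u3 hE]]]] := ph.
move: uc => /=; rewrite b'E mulmxA hE -(submxK (invmx b0 *m b)) mulmx_block.
by rewrite !block_mxKul mulmx0 addr0 unitmx_mul => /andP[].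
Qed.

Lemma chart_slopeE b0 b : b \in unitmx -> ulsubmx (invmx b0 *m b) \in unitmx ->
  chart_slope b0 (rho b) = slope (invmx b0 *m b).
Proof.
move=> ub uc; rewrite /chart_slope; case: pselect => [h|]; last by case; exists b.
case: (cid2 h) => b' /= ub' /(rho_parabolic ub ub')[k pk ->].
by rewrite mulmxA (slope_parabolic pk uc).2.
Qed.

Lemma chart_slope_morph b0 U : chart_domain b0 U ->
  @morph_at K (grassmannian V) (affine_space 'M[K]_(d, m)) (chart_slope b0) U.
Proof.
move=> DU; have dU : \dim U = m by case: DU => b [ub _] <-; exact: dim_rho.
apply: grass_morph => // b ub bU; rewrite -bU in DU.
have uc := chart_domain_ul ub DU.
apply: (@morph_at_near K (affine_space _) (affine_space _)
  (fun b => slope (invmx b0 *m b))).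
  have n1 : nbhs (b : affine_space 'M[K]_(m + d)) GL.
    by apply: (near_unitmx (F := fun b => b)) => //; exact: vregular_id.
  have n2 : nbhs (b : affine_space 'M[K]_(m + d))
      [set b | ulsubmx (invmx b0 *m b) \in unitmx].
    by apply: open_nbhs_nbhs; split=> //; exact: (@open_ul_unit b0).
  move: n2.
  by apply: filterS2 n1 => b' ub' uc' /=; rewrite chart_slopeE.
apply: vregular_morph.
by apply: (vregular_comp (mulmxl_regular _ _)); exact: slope_regular.
Qed.

Lemma chart_slopeK b0 U : b0 \in unitmx -> chart_domain b0 U ->
  rho (b0 *m lower (chart_slope b0 U)) = U.
Proof.
by move=> u0 [b [ub uc] <-]; rewrite chart_slopeE // rho_lower_slope.
Qed.

Lemma mul_lower_regular b0 (a : affine_space 'M[K]_(d, m)) :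
  vregular_at (fun a => b0 *m lower a) a.
Proof. exact: vregular_comp (lower_regular _) (mulmxl_regular _ _). Qed.

Lemma rho_good : good_map GL [set U : grassmannian V | \dim U = m] rho.
Proof.
split.
- exact: rho_morph.
- exact: dim_rho.
- by move=> U /rho_surj.
move=> b0 u0.
have ul0 : ulsubmx (invmx b0 *m b0) = 1%:M.
  by rewrite mulVmx // scalar_mx_block block_mxKul.
have D0 : chart_domain b0 (rho b0).
  by exists b0 => //; split=> //=; rewrite ul0 unitmx1.
exists (fun U => b0 *m lower (chart_slope b0 U)); split.
- exact: (morph_at_comp (chart_slope_morph D0)
    (vregular_morph (mul_lower_regular b0 _))).
- rewrite chart_slopeE //; last by rewrite ul0 unitmx1.
  rewrite /slope mulVmx // {1}scalar_mx_block block_mxKdl mul0mx /lower.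
  by rewrite -scalar_mx_block mulmx1.
- have := open_nbhs_nbhs (conj (@chart_domain_open b0) D0).
  apply: filterS => U DU _; split; last exact: chart_slopeK.
  by rewrite /= unitmx_mul u0 lower_unit.
Qed.

End GrassmannianQuotient.

(** * Stable range of endomorphism rings *)

Section StableRange.
Context {K : closedFieldType} {n' : nat}.
Local Notation n := n'.+1.
Implicit Types (y f b u e : 'M[K]_n).

(** Write the characteristic polynomial as [r] times a power of the indeterminate with exponent at
    most [n], where [r] does not vanish at 0. By Cayley-Hamilton, the constant term of [r] can be
    divided out. A polynomial in [y] is wanted because it stays in every centralizer containing
    [y]. *)
Lemma fitting y : exists q : {poly K}, y ^+ n = y ^+ n.+1 * horner_mx y q.
Proof.
have [k [r]] := multiplicity_XsubC (char_poly y) 0.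
rewrite monic_neq0 ?char_poly_monic //= subr0 => r0 pE.
have rn0 : r != 0 by apply: contraNneq r0 => ->; rewrite root0.
have kn : (k <= n)%N.
  rewrite -ltnS -(size_char_poly y) pE size_mulXn // -addn1 leq_add2l.
  by rewrite size_poly_gt0.
have CH : y ^+ k * horner_mx y r = 0.
  have := Cayley_Hamilton y; rewrite pE mulrC rmorphM rmorphXn /=.
  by rewrite horner_mx_X.
have [r' rE] : exists r', r = r' * 'X + r.[0]%:P.
  have /factor_theorem[r' r'E] : root (r - r.[0]%:P) 0.
    by rewrite /root !hornerE subrr.
  by exists r'; rewrite -[X in _ * X](subr0 'X) -r'E subrK.
have yk : y ^+ k = y ^+ k.+1 * horner_mx y (- r.[0]^-1 *: r').
  move: CH; rewrite {1}rE rmorphD rmorphM /= horner_mx_X horner_mx_C.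
  rewrite mulrDr -[_%:M]mulr1 -scalemx1 -scalerAl -scalerAr mul1r mulr1.
  move/eqP; rewrite addr_eq0 => /eqP h.
  rewrite linearZ /= -scalerAr exprSr -mulrA.
  have -> : y * horner_mx y r' = horner_mx y r' * y.
    by apply: comm_mx_horner.
  by rewrite h scaleNr scalerN opprK scalerA mulVf ?scale1r.
exists (- r.[0]^-1 *: r').
suff h N : (k <= N)%N -> y ^+ N = y ^+ N.+1 * horner_mx y (- r.[0]^-1 *: r').
  exact: h.
by move=> kN; rewrite -(subnK kN) -addnS !exprD {1}yk mulrA.
Qed.

(** An element [c] is the value at [s = 0] of [s y + c], whose powers vanish for
    [s <> 0] as soon as those of all [y + s^-1 c] do. *)
Lemma nilpotent_limit y (c : 'M[K]_n) k :
  (forall s : K, (y + s *: c) ^+ k = 0) -> c ^+ k = 0.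
Proof.
move=> h; pose Y := 'X *: map_mx polyC y + map_mx polyC c : 'M[{poly K}]_n.
have YE s : map_mx (horner_eval s) (Y ^+ k) = (s *: y + c) ^+ k.
  rewrite rmorphXn /=; congr (_ ^+ k); apply/matrixP => i j.
  by rewrite !mxE /horner_eval !hornerE.
rewrite -[c]add0r -{1}(scale0r y) -YE; apply/matrixP => i j; rewrite !mxE.
suff -> : (Y ^+ k) i j = 0 by rewrite /horner_eval horner0.
have : 'X * (Y ^+ k) i j = 0.
  apply/eqP; apply: contraT => /closed_nonrootP[s]; apply: contraNT => _.
  rewrite /root hornerM hornerX mulf_eq0; have [//|s0 /=] := eqVneq s 0.
  have -> : ((Y ^+ k) i j).[s] = (map_mx (horner_eval s) (Y ^+ k)) i j.
    by rewrite mxE.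
  rewrite YE; have -> : s *: y + c = s *: (y + s^-1 *: c).
    by rewrite scalerDr scalerA divff // scale1r.
  by rewrite exprZn h scaler0 mxE eqxx.
by move/eqP; rewrite mulf_eq0 polyX_eq0 => /eqP.
Qed.

(** The centralizer [E] of [S] has stable range one.  If all [y + f b u f] were
    nilpotent, so would be all [j = f b u f]; then [f - j = y a f] is invertible in
    the corner [f E f], contradicting the nilpotency of [y].  Otherwise, split off
    the Fitting component [e] of some [y + f b u f] and go on in the corner of
    [f - e]. *)
Lemma corner_left_unit (S : set 'M[K]_n) k f y b :
  let E := [set x : 'M[K]_n | forall s, S s -> GRing.comm s x] in
  (\rank f <= k)%N -> E f -> E y -> E b -> f * f = f -> f * y = y -> y * f = y ->
  (exists a u, [/\ E a, E u & f = y * a * f + f * b * u * f]) ->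
  exists u z, [/\ E u, z * f = z & z * (y + f * b * u * f) = f].
Proof.
move=> E.
have ED x x' : E x -> E x' -> E (x + x').
  by move=> h h' s Ss; apply: commrD; [exact: h | exact: h'].
have EN x : E x -> E (- x) by move=> h s Ss; apply: commrN; exact: h.
have EM x x' : E x -> E x' -> E (x * x').
  by move=> h h' s Ss; apply: commrM; [exact: h | exact: h'].
have EZ c x : E x -> E (c *: x).
  by move=> h s Ss; rewrite /GRing.comm -scalerAr h // scalerAl.
have EX x i : E x -> E (x ^+ i) by move=> h s Ss; apply: commrX; exact: h.
have E0 : E 0 by move=> s Ss; exact: commr0.
elim: k f y b => [|k IHk] f y b fk Ef Ey Eb ff fy yf [a [u [Ea Eu fE]]].
  have f0 : f = 0 by apply/eqP; rewrite -mxrank_eq0 -leqn0.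
  by exists 0, 0; split=> //; rewrite mul0r ?f0.
have [f0|f0] := eqVneq f 0.
  by exists 0, 0; split=> //; rewrite mul0r ?f0.
have [v Ev vn] : exists2 v, E v & (y + f * b * v * f) ^+ n <> 0.
  apply: contrapT => nil.
  have nilv v : E v -> (y + f * b * v * f) ^+ n = 0.
    by move=> Ev; apply: contrapT => h; apply: nil; exists v.
  pose j := f * b * u * f.
  have jn : j ^+ n = 0.
    apply: (@nilpotent_limit y) => s.
    have -> : s *: j = f * b * (s *: u) * f.
      by rewrite /j -!(scalerAl, scalerAr).
    exact/nilv/EZ.
  have yn : y ^+ n = 0.
    have := nilv 0 E0; by rewrite mulr0 mul0r addr0.
  have fj : f * j = j by rewrite /j !mulrA ff.
  have jf : j * f = j by rewrite /j -!mulrA ff.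
  have yaE : y * a * f = f - j by rewrite [X in _ = X - _]fE addrK.
  (* The geometric series inverts [1 - j] for the nilpotent [j]. As [y * a * f] equals
     [f * (1 - j)], this gives [y] a right inverse relative to [f], whose powers contradict
     [y ^+ n = 0]. *)
  pose t := \sum_(i < n) j ^+ i.
  have yr : y * (a * f * t) = f.
    have jt : (1 - j) * t = 1.
      by rewrite -opprB mulNr -subrX1 jn sub0r opprK.
    by rewrite !mulrA yaE -{1}[f]mulr1 -fj -mulrBr -mulrA jt mulr1.
  have yri i : y ^+ i.+1 * (a * f * t) ^+ i.+1 = f.
    elim: i => [|i IHi]; first by rewrite !expr1.
    have yif : y ^+ i.+1 * f = y ^+ i.+1 by rewrite exprSr -mulrA yf.
    rewrite (exprSr y i.+1) (exprS (a * f * t) i.+1) -mulrA [y * (_ * _)]mulrA yr.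
    by rewrite mulrA yif.
  by move/eqP: f0; rewrite -(yri n') yn mul0r.
pose y1 := y + f * b * v * f; have Ey1 : E y1.
  exact: (ED _ _ Ey (EM _ _ (EM _ _ (EM _ _ Ef Eb) Ev) Ef)).
have fy1 : f * y1 = y1 by rewrite /y1 mulrDr fy !mulrA ff.
have y1f : y1 * f = y1 by rewrite /y1 mulrDl yf -!mulrA ff.
have [q qE] := fitting y1; set x := horner_mx y1 q in qE.
have Ex : E x by move=> s Ss; apply: comm_mx_horner; exact: Ey1.
have xy : x * y1 = y1 * x by apply/esym/comm_mx_horner.
have xyX i l : y1 ^+ i * x ^+ l = x ^+ l * y1 ^+ i.
  by apply: commrX; apply/commr_sym/commrX/commr_sym; rewrite /GRing.comm xy.
have qX i : y1 ^+ n = y1 ^+ (n + i) * x ^+ i.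
  elim: i => [|i IHi]; first by rewrite addn0 mulr1.
  rewrite {1}IHi (addnC n i) (exprD y1 i n) qE (exprS x i).
  rewrite [y1 ^+ i * (_ * x)]mulrA -exprD -[_ * x * _]mulrA.
  by rewrite addnS addnC -addnS.
(* The idempotent [e] cuts out the part on which [y1] is invertible, and [w] inverts [y1] there: the
   exponent [n'] is one less than [n], so that [w * y1 = e * e]. *)
pose e := y1 ^+ n * x ^+ n; pose w := e * y1 ^+ n' * x ^+ n.
have Ee : E e by exact: (EM _ _ (EX _ _ Ey1) (EX _ _ Ex)).
have comE u' i l : GRing.comm u' y1 -> GRing.comm u' x ->
    GRing.comm u' (y1 ^+ i * x ^+ l).
  by move=> h1 h2; apply: commrM; exact: commrX.
have y1e : y1 * e = e * y1 by apply: comE => //; rewrite /GRing.comm xy.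
have xe : x * e = e * x by apply: comE.
have ee : e * e = e.
  by rewrite /e mulrA -[_ * _ * y1 ^+ n]mulrA -xyX mulrA -exprD -qX.
have wy : w * y1 = e.
  rewrite /w -mulrA -(xyX 1) mulrA -[e * _ * _]mulrA -exprD addn1.
  by rewrite -mulrA -/e.
have we : w * e = w.
  have c : GRing.comm e (y1 ^+ n' * x ^+ n) by apply: comE; exact: esym.
  have -> : w = e * (y1 ^+ n' * x ^+ n) by rewrite /w mulrA.
  by rewrite -[LHS]mulrA -c [LHS]mulrA ee.
have fe : f * e = e by rewrite /e (exprS y1 n') !mulrA fy1.
have ef : e * f = e by rewrite /e xyX (exprSr y1 n') -!mulrA y1f.
have e0 : e <> 0.
  move=> e0; apply: vn; rewrite -/y1 (qX n) exprD -mulrA.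
  by rewrite -/e e0 mulr0.
pose f' := f - e.
have Ef' : E f' by exact: (ED _ _ Ef (EN _ Ee)).
have f'e : f' * e = 0 by rewrite mulrBl fe ee subrr.
have ef' : e * f' = 0 by rewrite mulrBr ef ee subrr.
have ff' : f * f' = f' by rewrite mulrBr ff fe.
have f'f : f' * f = f' by rewrite mulrBl ff ef.
have f'f' : f' * f' = f' by rewrite {1}/f' mulrBl ff' ef' subr0.
have y1f' : y1 * f' = f' * y1 by rewrite mulrBr mulrBl y1f fy1 y1e.
have rk : (\rank f' <= k)%N.
  rewrite -ltnS; apply: leq_trans fk.
  have : (f' < f)%MS.
    rewrite ltmxE; apply/andP; split; first by rewrite -f'f; exact: submxMl.
    apply/negP => /submxP[D fD]; apply: e0.
    by rewrite -fe fD -[D *m _]/(D * f') -mulrA f'e mulr0.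
  by rewrite ltmxErank => /andP[].
have y1E : y1 = y + f * b * v * f by [].
have eE : e + f' = f by rewrite addrC subrK.
clearbody f' w e x y1.
have [||||u' [z' [Eu' z'f' z'E]]] := IHk f' (f' * y1) b rk Ef' _ Eb f'f'.
- exact: EM.
- by rewrite mulrA f'f'.
- by rewrite -mulrA y1f' mulrA f'f'.
(* Passing from [y] to [y1] added the term [f * b * v * f]; subtracting [v * f * a] from [u]
   compensates for it in the relation of the smaller corner. *)
- exists a, (u - v * f * a); split=> //.
    by apply: (ED _ _ Eu (EN _ _)); exact: (EM _ _ (EM _ _ Ev Ef) Ea).
  have fyE : f' * y1 * a * f' = f' * y * a * f' + f' * b * v * f * a * f'.
    by rewrite y1E mulrDr !mulrDl !mulrA f'f.
  have fE' : f' = f' * y * a * f' + f' * b * u * f'.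
    rewrite -{1}f'f' -{1}f'f {1}fE mulrDr mulrDl.
    by rewrite -!mulrA ff' !mulrA f'f.
  by rewrite fyE mulrBr mulrBl !mulrA addrACA subrr addr0 -fE'.
have wf : w * f = w by rewrite -we -mulrA ef.
(* The new element is block triangular for [f = e + f']. Its left inverse is the sum of those on the
   two corners minus the product that cancels the off-diagonal term. *)
exists (v + u' * f'), (w + z' - w * b * u' * f' * z'); split.
- exact: (ED _ _ Ev (EM _ _ Eu' Ef')).
- by rewrite mulrBl mulrDl wf -!mulrA -z'f' -!mulrA f'f.
have -> : y + f * b * (v + u' * f') * f = y1 + f * b * u' * f'.
  by rewrite mulrDr mulrDl addrA -y1E -!mulrA f'f.
have wX : w * (y1 + f * b * u' * f') = e + w * b * u' * f'.
  by rewrite mulrDr wy !mulrA wf.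
have z'X : z' * (y1 + f * b * u' * f') = f'.
  rewrite -[RHS]z'E -z'f' -!mulrA; congr (z' * _).
  by rewrite !mulrDr !mulrA f'f' f'f.
rewrite mulrBl mulrDl wX z'X -[_ * z' * _]mulrA z'X -[_ * f' * f']mulrA f'f'.
by rewrite addrAC addrK.
Qed.

(** The case of the full corner [f = 1], with [b = 1 - a * a'] and the witnesses [a'] and 1. A left
    inverse that need not centralize [S] suffices, as it already makes a square matrix
    invertible. *)
Lemma centralizer_unit (S : set 'M[K]_n) (a a' : 'M[K]_n) :
  (forall s, S s -> s *m a = a *m s) -> (forall s, S s -> s *m a' = a' *m s) ->
  exists2 u, (forall s, S s -> s *m u = u *m s) &
    a + (1%:M - a *m a') *m u \in unitmx.
Proof.
move=> Ea Ea'.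
have E1 : forall s, S s -> GRing.comm s (1 : 'M[K]_n) by move=> s _; exact: commr1.
have Eb : forall s, S s -> GRing.comm s (1 - a * a').
  move=> s Ss; apply: commrB; first exact: commr1.
  by apply: commrM; [exact: Ea | exact: Ea'].
have [|||u [z [Eu _ zE]]] :=
  @corner_left_unit S _ 1 a _ (leqnn _) E1 Ea Eb (mul1r _).
- by rewrite mul1r.
- by rewrite mulr1.
- exists a', 1; split=> //.
  by rewrite !(mul1r, mulr1) addrC subrK.
exists u => //; move: zE; rewrite !(mul1r, mulr1) => zE.
have zE' : z *m (a + (1%:M - a *m a') *m u) = 1%:M by [].
by case: (mulmx1_unit zE').
Qed.

End StableRange.

(** * Projective modules *)

Section Modules.
Context {K : closedFieldType} {Q : quiver} (I : set (pathalg K Q)).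

Lemma qpath_act_hom (V W : lmodType K) actV actW (f : {linear V -> W})
    (q : qpath Q) (v : V) :
  is_hom actV actW f -> f (qpath_act actV q v) = qpath_act actW q (f v).
Proof.
move=> hf; rewrite /qpath_act -hf; move: (actV _ v) => {}v.
by elim: (qarrows q) v => //= a s IHs v; rewrite IHs hf.
Qed.

(** Every module axiom is an equality preserved by homomorphisms, so it may be checked after mapping
    to genuine modules that separate points. *)
Lemma is_module_separated (M : lmodType K) (act : qstar Q -> {linear M -> M}) :
  (forall z z', (forall (V : lmodType K) actV (f : {linear M -> V}),
     is_module I actV -> is_hom act actV f -> f z = f z') -> z = z') ->
  is_module I act.
Proof.
move=> sep; split.
- move=> i j v; apply: sep => V actV f [m1 _ _ _ _] hf.
  by rewrite !hf m1; case: eqP => _; rewrite ?linear0 ?hf.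
- move=> v; apply: sep => V actV f [_ m2 _ _ _] hf.
  by rewrite linear_sum -[RHS]m2; apply: eq_bigr => i _; rewrite hf.
- by move=> a v; apply: sep => V actV f [_ _ m3 _ _] hf; rewrite !hf m3.
- by move=> a v; apply: sep => V actV f [_ _ _ m4 _] hf; rewrite !hf m4.
- move=> x Ix v; apply: sep => V actV f [_ _ _ _ m5] hf.
  rewrite linear_sum linear0 -[RHS](m5 x Ix (f v)); apply: eq_bigr => q _.
  by rewrite linearZ /= (qpath_act_hom _ _ hf).
Qed.

Lemma matrix_of_linear n k (h : {linear 'cV[K]_n -> 'cV[K]_k}) :
  exists A : 'M[K]_(k, n), forall v, h v = A *m v.
Proof.
exists (\matrix_(i, j) h (delta_mx j 0) i 0) => v.
have {1}-> : v = \sum_j v j 0 *: delta_mx j 0.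
  rewrite {1}(matrix_sum_delta v); apply: eq_bigr => j _.
  by rewrite big_ord1.
rewrite linear_sum; apply/colP => i; rewrite mxE summxE; apply: eq_bigr => j _.
by rewrite linearZ !mxE mulrC.
Qed.

Definition mx_hom n d (p : qpoint K Q n) (X : qpoint K Q d) (G : 'M[K]_(d, n)) :
  Prop := forall a, G *m p a = X a *m G.

Lemma mx_hom_lin n d (p : qpoint K Q n) (X : qpoint K Q d) (G : 'M[K]_(d, n)) :
  mx_hom p X G -> is_hom (qpoint_act p) (qpoint_act X) (mulmx G).
Proof. by move=> hG a v; rewrite /= !mulmxA hG. Qed.

Lemma mx_hom_of_lin n d (p : qpoint K Q n) (X : qpoint K Q d) (G : 'M[K]_(d, n)) :
  (forall a (v : 'cV_n), G *m (p a *m v) = X a *m (G *m v)) -> mx_hom p X G.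
Proof.
move=> hG a; apply/trmx_inj/row_matrixP => i; rewrite !rowE.
apply: trmx_inj; rewrite !trmx_mul !trmxK.
by rewrite -!mulmxA hG.
Qed.

Definition mx_surj n d (G : 'M[K]_(d, n)) : Prop :=
  forall w : 'cV_d, exists v : 'cV_n, G *m v = w.

Lemma projective_lift n d (p : qpoint K Q n) (X : qpoint K Q d)
    (G G' : 'M[K]_(d, n)) :
  projective I (qpoint_act p) -> Mod I d X -> mx_hom p X G -> mx_hom p X G' ->
  mx_surj G' ->
  exists2 f : 'M[K]_n, forall a, p a *m f = f *m p a & G' *m f = G.
Proof.
move=> [mp lift] mX hG hG' sG'.
have [h hh hE] := lift _ _ _ _ mp mX (mulmx G') (mulmx G) (mx_hom_lin hG') sG'
  (mx_hom_lin hG).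
have [f fE] := matrix_of_linear h; exists f.
  have : mx_hom p p f by apply: mx_hom_of_lin => a v; rewrite -!fE; exact: hh.
  by move=> hf a; rewrite hf.
apply/trmx_inj/row_matrixP => i; rewrite !rowE; apply: trmx_inj.
by rewrite !trmx_mul !trmxK -mulmxA -fE hE.
Qed.

(** Lifting both ways gives [G' *m f = G] and [G *m f' = G'], so [G'] kills [1%:M - f *m f'] and any
    multiple of it on the right may be added to [f]. Stable range one provides a multiple making the
    sum invertible. Size zero is separate, square matrices forming a ring only in positive size. *)
Lemma projective_unit_lift n d (p : qpoint K Q n) (X : qpoint K Q d)
    (G G' : 'M[K]_(d, n)) :
  projective I (qpoint_act p) -> Mod I d X -> mx_hom p X G -> mx_hom p X G' ->
  mx_surj G -> mx_surj G' ->
  exists f : 'M[K]_n, [/\ f \in unitmx, forall a, p a *m f = f *m p a &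
    G' *m f = G].
Proof.
move=> pP mX hG hG' sG sG'.
case: n => [|n] in p G G' pP hG hG' sG sG' *.
  exists 1%:M; split; [exact: unitmx1 | by move=> a; rewrite mulmx1 mul1mx |].
  by rewrite [RHS]thinmx0 [LHS]thinmx0.
have [f fp fE] := projective_lift pP mX hG hG' sG'.
have [f' f'p f'E] := projective_lift pP mX hG' hG sG.
have [||u up un] := @centralizer_unit K n (range p) f f'.
- by move=> _ [a _ <-].
- by move=> _ [a _ <-].
exists (f + (1%:M - f *m f') *m u); split=> //.
  move=> a; have pu : p a *m u = u *m p a by apply: up; exists a.
  have pb : p a *m (1%:M - f *m f') = (1%:M - f *m f') *m p a.
    by rewrite mulmxBr mulmxBl mulmx1 mul1mx mulmxA fp -!mulmxA f'p.
  by rewrite mulmxDr [RHS]mulmxDl fp mulmxA pb -!mulmxA pu.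
rewrite mulmxDr fE mulmxA mulmxBr mulmx1 mulmxA fE f'E subrr mul0mx.
exact: addr0.
Qed.

End Modules.

(** * Polynomial projectors onto spaces of homomorphisms *)

Section HomFamily.
Context {K : closedFieldType} {Q : quiver} (I : set (pathalg K Q)).
Context {n : nat} (p : qpoint K Q n) (d : nat).

(** Families [G |-> F(X, G)] of linear maps from [M_(d, n)] to [K^d] (given by their
    matrix acting on [mxvec G]), depending polynomially on the module [X] and natural
    in it, together with their value at [(P, 1)].  They form a module that evaluation
    at [(P, 1)] maps onto [P]; it replaces a free cover of [P]. *)
Definition fam_space : lmodType K :=
  ((qpoint K Q d -> 'M[K]_(d * n, d)) * 'cV[K]_n)%type.

Fact fam_spaceE1 c (z z' : fam_space) X :
  (c *: z + z').1 X = c *: z.1 X + z'.1 X.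
Proof. by []. Qed.

Fact fam_spaceE2 c (z z' : fam_space) : (c *: z + z').2 = c *: z.2 + z'.2.
Proof. by []. Qed.

(** Points that are not modules must contribute nothing, since the relations fail there. Naturality
    is expressed through the second component because P has size [n] and is not among the points [X]
    of size [d]. *)
Definition is_fam (z : fam_space) : Prop :=
  [/\ forall X, ~ Mod I d X -> z.1 X = 0,
      exists2 Z : qpoint K Q d -> 'M[K]_(d * n, d),
        forall i j, polyfun (fun X => Z X i j) & forall X, Mod I d X -> z.1 X = Z X &
      forall X G, Mod I d X -> mx_hom p X G ->
        mxvec G *m z.1 X = (G *m z.2)^T].

Definition fam_pred : {pred fam_space} := fun z => `[< is_fam z >].

Fact fam_closed : submod_closed fam_pred.
Proof.
split=> [|c z z' /asboolP[z1 [Z pZ zZ] z3] /asboolP[z1' [Z' pZ' zZ'] z3']];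
  apply/asboolP; split.
- by [].
- by exists (fun=> 0) => // i j; under eq_fun do rewrite mxE; exact: polyfun_cst.
- by move=> X G _ _; rewrite /= mulmx0 mulmx0 trmx0.
- by move=> X nX; rewrite fam_spaceE1 z1 // z1' // scaler0 addr0.
- exists (fun X => c *: Z X + Z' X) => [i j|X mX]; last first.
    by rewrite fam_spaceE1 zZ // zZ'.
  have -> : (fun X => (c *: Z X + Z' X) i j) = (fun X => c * Z X i j + Z' X i j).
    by apply/funext => X; rewrite !mxE.
  apply: polyfun_add; last exact: pZ'.
  by apply: polyfun_mul; [exact: polyfun_cst | exact: pZ].
- move=> X G mX hG; rewrite fam_spaceE1 fam_spaceE2.
  rewrite mulmxDr -scalemxAr z3 // z3' //.
  by rewrite mulmxDr -scalemxAr linearP.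
Qed.

HB.instance Definition _ :=
  GRing.isSubmodClosed.Build K fam_space fam_pred fam_closed.

Record fam := Fam { fam_val : fam_space; _ : fam_val \in fam_pred }.

HB.instance Definition _ := [isSub for fam_val].
HB.instance Definition _ := [Choice of fam by <:].
HB.instance Definition _ := [SubChoice_isSubLmodule of fam by <:].

Lemma famP (z : fam) : is_fam (val z).
Proof. exact/asboolP/(valP z). Qed.

Lemma fam_act_subproof (a : qstar Q) (z : fam) :
  ((fun X : qpoint K Q d => (val z).1 X *m (X a)^T, p a *m (val z).2) : fam_space)
    \in fam_pred.
Proof.
have [z1 [Z pZ zZ] z3] := famP z; apply/asboolP; split.
- by move=> X nX; rewrite /= z1 // mul0mx.
- exists (fun X => Z X *m (X a)^T) => [i j|X mX]; last by rewrite /= zZ.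
  have -> : (fun X : qpoint K Q d => (Z X *m (X a)^T) i j) =
      (fun X => \sum_l Z X i l * X a j l).
    by apply/funext => X; rewrite mxE; apply: eq_bigr => l _; rewrite mxE.
  apply: polyfun_sum => l _; apply: polyfun_mul; first exact: pZ.
  have fl : scalar (fun X : qpoint K Q d => X a j l).
    by move=> c A B; rewrite !ffunE !mxE.
  exact: (polyfun_lin (HB.pack (fun X : qpoint K Q d => X a j l)
    (GRing.isLinear.Build _ _ _ _ _ fl) : {scalar qpoint K Q d})).
- move=> X G mX hG; rewrite /= mulmxA z3 // -trmx_mul.
  by rewrite !mulmxA hG.
Qed.

Definition fam_fun (a : qstar Q) (z : fam) : fam := Fam (fam_act_subproof a z).

Fact fam_fun_linear a : linear (fam_fun a).
Proof.
move=> c z z'; apply: val_inj; congr (_, _).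
- by apply/funext => X; rewrite fam_spaceE1 mulmxDl -scalemxAl.
- by rewrite /= mulmxDr -scalemxAr.
Qed.

Definition fam_act (a : qstar Q) : {linear fam -> fam} :=
  linear_of (fam_fun_linear a).

Definition fam_eval (z : fam) : 'cV[K]_n := (val z).2.

Fact fam_eval_linear : linear fam_eval.
Proof. by []. Qed.

Definition fam_row (X : qpoint K Q d) (u : 'rV[K]_(d * n)) (z : fam) : 'cV[K]_d :=
  (u *m (val z).1 X)^T.

Fact fam_row_linear X u : linear (fam_row X u).
Proof.
by move=> c z z'; rewrite /fam_row fam_spaceE1 mulmxDr -scalemxAr linearP.
Qed.

Lemma fam_module : Mod I n p -> is_module I fam_act.
Proof.
move=> mp; apply: is_module_separated => z z' sep; apply: val_inj.
case: (famP z) (famP z') => z1 _ _ [z1' _ _].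
have E2 : (val z).2 = (val z').2.
  exact: (sep _ (qpoint_act p) (linear_of fam_eval_linear) mp).
have E1 : (val z).1 = (val z').1.
  apply/funext => X; have [mX|nX] := pselect (Mod I d X); last by rewrite z1 // z1'.
  apply/row_matrixP => i; rewrite !rowE; apply: trmx_inj.
  apply: (sep _ (qpoint_act X) (linear_of (fam_row_linear X (delta_mx 0 i))) mX).
  by move=> a w; rewrite /= /fam_row /= mulmxA trmx_mul trmxK.
by move: E1 E2; case: (val z) (val z') => [? ?] [? ?] /= -> ->.
Qed.

(** The family [G |-> G *m v], cut off outside modules; its value at P is [v], which makes
    evaluation surjective. *)
Fact fam_const_subproof (v : 'cV[K]_n) :
  ((fun X : qpoint K Q d => if pselect (Mod I d X)
      then lin1_mx (fun u : 'rV[K]_(d * n) => (vec_mx u *m v)^T) else 0, v)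
    : fam_space) \in fam_pred.
Proof.
apply/asboolP; split.
- by move=> X nX /=; case: pselect.
- exists (fun=> lin1_mx (fun u : 'rV[K]_(d * n) => (vec_mx u *m v)^T)).
    by move=> i j; exact: polyfun_cst.
  by move=> X mX /=; case: pselect.
- move=> X G mX _ /=; case: pselect => [h|//].
  have fl : linear (fun u : 'rV[K]_(d * n) => (vec_mx u *m v)^T).
    by move=> c u w; rewrite linearP mulmxDl -scalemxAl linearP.
  by rewrite (mul_rV_lin1 (linear_of fl)) /= mxvecK.
Qed.

(** Projectivity splits the evaluation by some [h]. For fixed [X] and [G], the values of the
    families [h v] depend linearly on [v] and define a new matrix: it is a homomorphism because [h]
    is one, and it equals [G] when [G] is already a homomorphism, by naturality. *)
Lemma hom_projector : projective I (qpoint_act p) ->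
  exists T : qpoint K Q d -> 'M[K]_(d * n),
    (forall k l, polyfun (fun X => T X k l)) /\
    forall X, Mod I d X ->
      (forall G, mx_hom p X (vec_mx (mxvec G *m T X))) /\
      (forall G, mx_hom p X G -> mxvec G *m T X = mxvec G).
Proof.
move=> [mp lift].
have [|||h hh hE] := lift fam 'cV[K]_n fam_act (qpoint_act p) (fam_module mp) mp
  (linear_of fam_eval_linear) idfun.
- by [].
- by move=> v; exists (Fam (fam_const_subproof v)).
- by [].
pose D j : fam := h (delta_mx j 0).
have /choice[Z ZP] : forall j, exists Z : qpoint K Q d -> 'M[K]_(d * n, d),
    (forall k i, polyfun (fun X => Z X k i)) /\
    forall X, Mod I d X -> (val (D j)).1 X = Z X.
  by move=> j; have [_ [Z pZ ZE] _] := famP (D j); exists Z.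
(* Column [j] is the value of the family attached to the [j]-th basis vector. The polynomial
   representatives [Z j] replace the families, which are cut off outside modules, so that [T] is
   polynomial on the whole space. *)
pose tau X (u : 'rV[K]_(d * n)) : 'rV[K]_(d * n) :=
  mxvec (\matrix_(i, j) (u *m Z j X) 0 i).
have taulin X : linear (tau X).
  move=> c u w; rewrite -linearP; congr mxvec; apply/matrixP => i j.
  rewrite !mxE mulr_sumr -big_split; apply: eq_bigr => l _.
  by rewrite /= !mxE mulrDl mulrA.
exists (fun X => lin1_mx (tau X)); split.
  move=> k l; case/mxvec_indexP: l => i j.
  have -> : (fun X => lin1_mx (tau X) k (mxvec_index i j)) = fun X => Z j X k i.
    by apply/funext => X; rewrite mxE mxvecE mxE -rowE mxE.
  exact: (ZP j).1.
move=> X mX.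
have tauE G v : vec_mx (tau X (mxvec G)) *m v = (mxvec G *m (val (h v)).1 X)^T.
  rewrite mxvecK; apply/colP => i.
  have hv : (val (h v)).1 X = \sum_j v j 0 *: Z j X.
    have {1}-> : v = \sum_j v j 0 *: delta_mx j 0.
      rewrite {1}(matrix_sum_delta v); apply: eq_bigr => j _.
      by rewrite big_ord1.
    rewrite linear_sum.
    have fl : linear (fun z : fam => (val z).1 X) by [].
    rewrite -[LHS]/(linear_of fl _) linear_sum; apply: eq_bigr => j _.
    by rewrite linearZ linearZ -(ZP j).2.
  rewrite hv mulmx_sumr !mxE summxE; apply: eq_bigr => j _.
  by rewrite -scalemxAr !mxE mulrC.
split=> G.
  rewrite (mul_rV_lin1 (linear_of (taulin X))) /=.
  apply: mx_hom_of_lin => a v; rewrite !tauE.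
  have -> : p a *m v = qpoint_act p a v by [].
  by rewrite hh /= mulmxA trmx_mul trmxK.
move=> hG; rewrite (mul_rV_lin1 (linear_of (taulin X))) /=.
rewrite -[LHS]vec_mxK; congr mxvec.
apply/trmx_inj/row_matrixP => i; rewrite !rowE; apply: trmx_inj.
rewrite !trmx_mul !trmxK tauE; have [_ _ ->] // := famP (h (delta_mx 0 i)^T).
rewrite trmxK; congr (_ *m _); exact: hE.
Qed.

End HomFamily.

(** * Submodules and factor modules *)

Section IrreducibleOrbits.
Context {K : closedFieldType}.

Lemma polyfun_line (V : vectType K) (q : V -> K) x v : polyfun q ->
  exists P : {poly K}, forall s, q (x + s *: v) = P.[s].
Proof.
elim=> [c|l|f g _ [P PE] _ [R RE]|f g _ [P PE] _ [R RE]].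
- by exists c%:P => s; rewrite hornerC.
- by exists ((l x)%:P + (l v) *: 'X) => s; rewrite linearD linearZ !hornerE mulrC.
- by exists (P + R) => s; rewrite PE RE hornerD.
- by exists (P * R) => s; rewrite PE RE hornerM.
Qed.

(** Take units mapped to the two open sets and restrict the two polynomial conditions to the line
    joining these units. Neither vanishes identically (look at the parameters 0 and 1), so some
    parameter satisfies both. *)
Lemma irreducible_units_image n (E : set 'M[K]_n) (T : topologicalType)
    (F : affine_space 'M[K]_n -> T) :
  (forall f f' s, E f -> E f' -> E (f + s *: (f' - f))) -> E 1%:M ->
  (forall (f : affine_space 'M[K]_n) B, f \in unitmx -> nbhs (F f) B -> nbhs f (F @^-1` B)) ->
  irreducible_set [set y | exists f, [/\ E f, f \in unitmx & y = F f]].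
Proof.
move=> El E1 cF; apply: irreducible_setP.
  by exists (F 1%:M), 1%:M; split=> //; exact: unitmx1.
move=> U U' oU oU' [_ [[f [Ef uf ->]] Uf]] [_ [[f' [Ef' uf' ->]] Uf']].
have nb g O : g \in unitmx -> open O -> O (F g) ->
    exists2 q : 'M[K]_n -> K, polyfun q & q g != 0 /\
      forall y, q y != 0 -> y \in unitmx /\ O (F y).
  move=> ug oO Og.
  have n1 := cF g O ug (open_nbhs_nbhs (conj oO Og)).
  have n2 : nbhs (g : affine_space 'M[K]_n) [set h | h \in unitmx].
    by apply: (near_unitmx (F := fun h => h)) => //; exact: vregular_id.
  have [q pq [qg qO]] := (nbhs_zariskiP _ _).1 (filterI n2 n1).
  by exists q => //; split=> // y /qO.
have [q pq [qf qU]] := nb _ _ uf oU Uf.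
have [q' pq' [qf' qU']] := nb _ _ uf' oU' Uf'.
have [P PE] := polyfun_line f (f' - f) pq.
have [P' PE'] := polyfun_line f (f' - f) pq'.
have P0 : P != 0.
  by apply: contraNneq qf => z; rewrite -[f]addr0 -(scale0r (f' - f)) PE z horner0.
have P'0 : P' != 0.
  by apply: contraNneq qf' => z; rewrite -[f'](subrKC f) -[f' - f]scale1r PE' z horner0.
have /closed_nonrootP[s] : P * P' != 0 by rewrite mulf_neq0.
rewrite /root hornerM -PE -PE' mulf_eq0 negb_or => /andP[/qU[us Us] /qU'[_ U's]].
exists (F (f + s *: (f' - f))); split=> //.
by exists (f + s *: (f' - f)); split=> //; exact: El.
Qed.

End IrreducibleOrbits.

Section SigmaAlgebra.
Context {K : closedFieldType} {Q : quiver} {I : set (pathalg K Q)}.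
Context {m d : nat} {p : qpoint K Q (m + d)}.
Implicit Types (b : 'M[K]_(m + d)) (X : qpoint K Q d).
Local Notation rho := (@rho K m d).
Local Notation sigma := (sigma p).
Local Notation G b := (dsubmx (invmx b) : 'M[K]_(d, m + d)).

Lemma rho_mul f b : rho (f *m b) = (linfun (mulmx f) @: rho b)%VS.
Proof.
apply/vspaceP => v; apply/idP/idP => [/mem_rho[c ->]|/memv_imgP[w /mem_rho[c ->] ->]].
  rewrite -mulmx_lsub -mulmxA; have -> : f *m (lsubmx b *m c) = linfun (mulmx f) (lsubmx b *m c).
    by rewrite lfunE.
  by apply: memv_img; apply/mem_rho; exists c.
by apply/mem_rho; exists c; rewrite lfunE /= -mulmx_lsub mulmxA.
Qed.

Lemma submodule_rhoP b : b \in unitmx ->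
  is_submodule p (rho b) <-> forall a, dlsubmx (invmx b *m p a *m b) = 0.
Proof.
move=> ub; split=> [h a|h a v /mem_rho[c ->]].
  rewrite -mulmxA; apply/rho_sub => //; apply/subvP => _ /mem_rho[c ->].
  by rewrite -mulmx_lsub -mulmxA; apply: h; apply/mem_rho; exists c.
have /(rho_sub _ ub)/subvP : dlsubmx (invmx b *m (p a *m b)) = 0 by rewrite mulmxA h.
by apply; apply/mem_rho; exists c; rewrite -mulmx_lsub mulmxA.
Qed.

Lemma dsub_mulV b : b \in unitmx -> G b *m b = row_mx 0 1%:M.
Proof.
move=> ub; rewrite mul_dsub_mx mulVmx // scalar_mx_block.
by rewrite block_mxEv col_mxKd.
Qed.

Lemma G_surj b : b \in unitmx -> mx_surj (G b).
Proof.
move=> ub w; exists (b *m col_mx 0 w).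
by rewrite mulmxA dsub_mulV // mul_row_col mul0mx mul1mx add0r.
Qed.

Lemma mx_surjK n k (A : 'M[K]_(n, k)) : mx_surj A -> exists B, A *m B = 1%:M.
Proof.
move=> sA; have /choice[c cE] : forall j, exists v : 'cV_k, A *m v = delta_mx j 0.
  by move=> j; exact: sA.
exists (\matrix_(i, j) c j i 0); apply/matrixP => i j; rewrite mxE.
have := congr1 (fun v : 'cV_n => v i 0) (cE j).
by rewrite !mxE andbT => <-; apply: eq_bigr => l _; rewrite mxE.
Qed.

(** As [G b *m b = row_mx 0 1%:M], multiplying the intertwining relation by [b] says that the lower
    rows of [invmx b *m p a *m b] are [row_mx 0 (X a)]. The zero block is the stability of [rho b],
    the other one is [sigma b = X]. *)
Lemma sigmaP b X : b \in unitmx ->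
  B_P p b /\ sigma b = X <-> mx_hom p X (G b).
Proof.
move=> ub; have NE a : dsubmx (invmx b *m p a *m b) = G b *m p a *m b.
  by rewrite !mul_dsub_mx.
split=> [[[_ /(submodule_rhoP ub) h] <-] a|h].
  rewrite -[LHS](mulmxK ub) -NE ffunE -[dsubmx _]hsubmxK.
  rewrite -/(dlsubmx _) -/(drsubmx _) h.
  by rewrite mul_mx_row_col row_mxKl row_mxKr mul0mx add0r.
have N' a : dsubmx (invmx b *m p a *m b) = row_mx 0 (X a).
  by rewrite NE h -mulmxA dsub_mulV // mul_mx_row mulmx0 mulmx1.
split.
  split=> //; apply/submodule_rhoP => // a.
  by rewrite /dlsubmx N' row_mxKl.
by apply/ffunP => a; rewrite ffunE /drsubmx N' row_mxKr.
Qed.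

Lemma quotient_module n (V : lmodType K) (actV : qstar Q -> {linear V -> V})
    (x : qpoint K Q n) (g : {linear V -> 'cV[K]_n}) :
  is_module I actV -> is_hom actV (qpoint_act x) g ->
  (forall w, exists v, g v = w) -> Mod I n x.
Proof.
move=> [m1 m2 m3 m4 m5] hg sg; split.
- move=> i j w; have [v <-] := sg w; rewrite -!hg m1.
  by case: eqP; rewrite ?linear0.
- move=> w; have [v <-] := sg w.
  transitivity (\sum_i g (actV (inl i) v)); first by apply: eq_bigr => i _; rewrite hg.
  by rewrite -linear_sum m2.
- by move=> a w; have [v <-] := sg w; rewrite -!hg m3.
- by move=> a w; have [v <-] := sg w; rewrite -!hg m4.
- move=> y Iy w; have [v <-] := sg w.
  rewrite -[RHS](linear0 g) -(m5 y Iy v) linear_sum.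
  by apply: eq_bigr => q _; rewrite linearZ /= (qpath_act_hom _ _ hg).
Qed.

Lemma Fac_mxP X : Fac_P I p X <->
  Mod I d X /\ exists2 A : 'M[K]_(d, m + d), mx_hom p X A & mx_surj A.
Proof.
split=> [[mX [g hg sg]]|[mX [A hA sA]]]; split=> //.
  have [A AE] := matrix_of_linear g; exists A.
    by apply: mx_hom_of_lin => a v; rewrite -!AE; exact: hg.
  by move=> w; have [v <-] := sg w; exists v; rewrite AE.
by exists (mulmx A); [exact: mx_hom_lin | exact: sA].
Qed.

(** A matrix [b] with [rho b] equal to the kernel of [A] is right up to the invertible matrix
    [A *m rsubmx b]; rescaling its last columns by the inverse finishes. *)
Lemma mx_surj_complete (A : 'M[K]_(d, m + d)) : mx_surj A ->
  exists2 b, b \in unitmx & G b = A.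
Proof.
move=> sA; pose L : 'Hom('cV[K]_(m + d), 'cV[K]_d) := linfun (mulmx A).
have LE v : L v = A *m v by rewrite lfunE.
pose U : {vspace 'cV[K]_(m + d)} := lker L.
have dU : \dim U = m.
  have := limg_ker_dim L fullv.
  rewrite capfv dimvf /dim /= muln1.
  have -> : limg L = fullv.
    apply/eqP; rewrite eqEsubv subvf /=; apply/subvP => w _.
    by have [v <-] := sA w; rewrite -LE memv_img ?memvf.
  by rewrite dimvf /dim /= muln1 => /eqP; rewrite eqn_add2r => /eqP.
have [b ub bU] := rho_surj dU.
have Ab0 : A *m lsubmx b = 0.
  apply/trmx_inj/row_matrixP => i; rewrite !rowE; apply: trmx_inj.
  rewrite !trmx_mul !trmxK mul0mx -mulmxA.
  have : lsubmx b *m (delta_mx 0 i)^T \in U.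
    by rewrite -bU; apply/mem_rho; exists (delta_mx 0 i)^T.
  by rewrite memv_ker LE => /eqP.
have [H AH] := mx_surjK sA.
have ug : A *m rsubmx b \in unitmx.
  have : (A *m rsubmx b) *m dsubmx (invmx b *m H) = 1%:M.
    rewrite -AH -{2}(mulKVmx ub H) [b *m _]mul_mx_row_col mulmxDr !mulmxA.
    by rewrite Ab0 mul0mx add0r.
  by case/mulmx1_unit.
pose h : 'M[K]_(m + d) := block_mx 1%:M 0 0 (invmx (A *m rsubmx b)).
have uh : h \in unitmx.
  by rewrite unitmxE det_ublock unitrM -!unitmxE unitmx1 unitmx_inv.
exists (b *m h); first by rewrite unitmx_mul ub.
have ubh : b *m h \in unitmx by rewrite unitmx_mul ub.
have Ah : A *m (b *m h) = row_mx 0 1%:M.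
  rewrite mulmxA -[A *m b]hsubmxK -mulmx_lsub -mulmx_rsub Ab0.
  by rewrite mul_row_block !mul0mx mulmx0 !add0r mulmxV.
by rewrite -[RHS](mulmxK ubh) Ah -(dsub_mulV ubh) mulmxK.
Qed.

Lemma sigma_Fac b : Mod I (m + d) p -> B_P p b -> Fac_P I p (sigma b).
Proof.
move=> mp Bb; have ub := Bb.1; have hG := (sigmaP (sigma b) ub).1 (conj Bb erefl).
apply/Fac_mxP; split; last by exists (G b); [exact: hG | exact: G_surj].
apply: (quotient_module (g := mulmx (G b)) mp); first exact: mx_hom_lin.
exact: G_surj.
Qed.

Lemma Fac_surj X : Fac_P I p X -> exists2 b, B_P p b & sigma b = X.
Proof.
move=> /Fac_mxP[mX [A hA sA]]; have [b ub bA] := mx_surj_complete sA.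
by exists b; [have [] := (sigmaP X ub).2 _ | have [] := (sigmaP X ub).2 _];
  rewrite ?bA.
Qed.

Lemma sigma_regular (b : affine_space 'M[K]_(m + d)) : b \in unitmx ->
  vregular_at sigma b.
Proof.
move=> ub; apply/vregular_ffun => a.
have -> : (fun b => sigma b a) = fun b => drsubmx (invmx b *m p a *m b).
  by apply/funext => c; rewrite ffunE.
apply: vregular_rsubmx; apply: vregular_dsubmx; apply: vregular_mulmx.
  apply: vregular_mulmx; last exact: vregular_cst.
  by apply: vregular_invmx => //; exact: vregular_id.
exact: vregular_id.
Qed.

Definition subfac (U : grassmannian 'cV[K]_(m + d)) (X : affine_space (qpoint K Q d)) :
  Prop := exists b, [/\ B_P p b, rho b = U & sigma b = X].

Lemma Aut_mul f b : Aut_P p f -> B_P p b -> B_P p (f *m b) /\ sigma (f *m b) = sigma b.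
Proof.
move=> [uf fp] Bb; have ub := Bb.1.
apply/sigmaP; first by rewrite unitmx_mul uf.
have hG := (sigmaP (sigma b) ub).1 (conj Bb erefl).
move=> a; rewrite invmx_mul // -!mul_dsub_mx.
have fp' : invmx f *m p a = p a *m invmx f.
  by rewrite -[LHS](mulmxK uf) -[invmx f *m _ *m f]mulmxA -fp mulKmx.
by rewrite -mulmxA fp' mulmxA hG mulmxA.
Qed.

(** Two surjections of P onto the same [X] differ by an automorphism of P, which carries one kernel
    onto the other. *)
Lemma subfac_Sub_orbit U U' X : projective I (qpoint_act p) -> Mod I d X ->
  subfac U X -> Sub_orbit p U U' <-> subfac U' X.
Proof.
move=> pP mX [b [Bb bU bX]]; have ub := Bb.1; split.
  move=> [f Af ->]; have [Bfb fbX] := Aut_mul Af Bb.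
  by exists (f *m b); rewrite rho_mul bU fbX.
move=> [b' [Bb' b'U b'X]]; have ub' := Bb'.1.
have hG := (sigmaP X ub).1 (conj Bb bX).
have hG' := (sigmaP X ub').1 (conj Bb' b'X).
have [f [uf fp fG]] := projective_unit_lift pP mX hG hG' (G_surj ub) (G_surj ub').
exists f; first by split=> // a; rewrite fp.
rewrite -b'U -bU -rho_mul; symmetry; apply/rho_eq => //.
  by rewrite unitmx_mul uf.
rewrite /dlsubmx -mul_dsub_mx mulmxA fG dsub_mulV //.
by rewrite row_mxKl.
Qed.

Lemma parabolic_mul b h3 : B_P p b -> h3 \in unitmx ->
  let b' := b *m block_mx 1%:M 0 0 h3 in
  [/\ B_P p b', rho b' = rho b &
      sigma b' = [ffun a => invmx h3 *m sigma b a *m h3]].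
Proof.
move=> Bb u3 b'; have ub := Bb.1.
have ph : parabolic (block_mx 1%:M 0 0 h3 : 'M[K]_(m + d)).
  by exists 1%:M, 0, h3; split=> //; exact: unitmx1.
have /parabolicP[uh _] := ph.
have ub' : b' \in unitmx by rewrite unitmx_mul ub.
have hE : invmx (block_mx 1%:M 0 0 h3 : 'M[K]_(m + d)) = block_mx 1%:M 0 0 (invmx h3).
  apply: (can_inj (mulKmx uh)); rewrite mulmxV // mulmx_block.
  by rewrite !mul0mx !mulmx0 !mul1mx !addr0 add0r mulmxV // -scalar_mx_block.
have GE : G b' = invmx h3 *m G b.
  rewrite invmx_mul // hE -mul_dsub_mx block_mxEv col_mxKd.
  by rewrite mul_mx_row_col row_mxKl row_mxKr mul0mx add0r.
have hG := (sigmaP (sigma b) ub).1 (conj Bb erefl).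
have [] := (sigmaP [ffun a => invmx h3 *m sigma b a *m h3] ub').2.
  by move=> a; rewrite GE ffunE -[LHS]mulmxA hG -[RHS]mulmxA mulKVmx // mulmxA.
move=> Bb' sE; split=> //; apply/rho_parabolic => //.
by exists (block_mx 1%:M 0 0 h3).
Qed.

(** Matrices over the same [U] differ by a parabolic [h], of which the lower rows of the inverse
    only see the block [h3]; the two modules are then conjugate under [invmx h3]. *)
Lemma subfac_Fac_orbit U X X' : subfac U X -> Fac_orbit X X' <-> subfac U X'.
Proof.
move=> [b [Bb bU bX]]; have ub := Bb.1; split.
  move=> [g ug ->]; have ug' : invmx g \in unitmx by rewrite unitmx_inv.
  have [B' r' s'] := parabolic_mul Bb ug'.
  exists (b *m block_mx 1%:M 0 0 (invmx g)); split=> //; first by rewrite r'.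
  by rewrite s' bX invmxK.
move=> [b' [Bb' b'U b'X]]; have ub' := Bb'.1.
have /(rho_parabolic ub ub')[h ph b'E] : rho b' = rho b by rewrite b'U.
have [h1 [h2 [h3 [u1 u3 hE]]]] := ph.
have /parabolicP[uh _] := ph.
have GE : G b' = invmx h3 *m G b.
  have uh' : invmx h = block_mx (invmx h1) (- invmx h1 *m h2 *m invmx h3) 0 (invmx h3).
    apply: (can_inj (mulKmx uh)); rewrite mulmxV // hE mulmx_block.
    rewrite !mulmx0 !mul0mx !addr0 !add0r !mulmxV // !mulmxA mulmxN mulmxV //.
    by rewrite mulNmx mul1mx mulNmx addNr -scalar_mx_block.
  rewrite b'E invmx_mul // -mul_dsub_mx uh' block_mxEv col_mxKd.
  by rewrite mul_mx_row_col row_mxKl row_mxKr mul0mx add0r.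
have hG := (sigmaP X ub).1 (conj Bb bX).
have hG' := (sigmaP X' ub').1 (conj Bb' b'X).
have [H GH] := mx_surjK (G_surj ub').
exists (invmx h3); first by rewrite unitmx_inv.
apply/ffunP => a; rewrite ffunE invmxK.
have Gh3 : G b *m H = h3.
  by rewrite -[G b](mulKVmx u3) -GE -mulmxA GH mulmx1.
rewrite -[LHS]mulmx1 -GH [LHS]mulmxA -hG' GE -[_ *m G b *m _]mulmxA hG.
by rewrite [_ *m (X a *m _)]mulmxA -[LHS]mulmxA Gh3.
Qed.

Lemma Sub_surj U : Sub_P p U -> exists2 b, B_P p b & rho b = U.
Proof.
by move=> [dU sU]; have [b ub bU] := rho_surj dU; exists b => //; split; rewrite ?bU.
Qed.

Lemma B_PE : B_P p = [set b : affine_space 'M[K]_(m + d) | b \in unitmx] `&`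
  rho @^-1` Sub_P p.
Proof.
apply/seteqP; split=> b [ub]; first by move=> sb; split=> //; split=> //; exact: dim_rho.
by case.
Qed.

Lemma rho_good_Sub : good_map (B_P p) (Sub_P p) rho.
Proof. by rewrite B_PE; apply: good_map_restrict rho_good => U []. Qed.

(** Keep the upper rows of [invmx b0] and project its lower rows to homomorphisms into [X]. At
    [sigma b0] nothing changes, so the result stays invertible nearby. The section covers all nearby
    modules, which also yields [Fac_open]. *)
Lemma sigma_section b0 : projective I (qpoint_act p) -> B_P p b0 ->
  exists s : affine_space (qpoint K Q d) -> affine_space 'M[K]_(m + d),
    [/\ morph_at s (sigma b0), s (sigma b0) = b0 &
      \forall X \near sigma b0, Mod I d X -> B_P p (s X) /\ sigma (s X) = X].
Proof.
move=> pP Bb; have ub := Bb.1.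
have [mX0 _] := sigma_Fac pP.1 Bb.
have hG := (sigmaP (sigma b0) ub).1 (conj Bb erefl).
have [T [pT hT]] := hom_projector d pP.
pose c X := col_mx (usubmx (invmx b0)) (vec_mx (mxvec (G b0) *m T X)).
have c0 : c (sigma b0) = invmx b0.
  by rewrite /c (hT _ mX0).2 // mxvecK vsubmxK.
have rc X : vregular_at c X.
  apply: vregular_col_mx; first exact: vregular_cst.
  apply: (vregular_lin_comp (F := fun X => mxvec (G b0) *m T X)).
  apply: vregular_mulmx; first exact: vregular_cst.
  by apply: vregular_mx => k l; exact: regular_polyfun.
have uc0 : c (sigma b0) \in unitmx by rewrite c0 unitmx_inv.
exists (fun X => invmx (c X)); split.
- by apply: vregular_morph; exact: vregular_invmx.
- by rewrite c0 invmxK.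
have := near_unitmx (rc (sigma b0)) uc0.
apply: filterS => X uc mX; apply/sigmaP; first by rewrite unitmx_inv.
by rewrite invmxK /c col_mxKd; exact: (hT _ mX).1.
Qed.

Lemma sigma_good : projective I (qpoint_act p) ->
  good_map (B_P p) (Fac_P I p) sigma.
Proof.
move=> pP; split.
- by move=> b [ub _]; exact/vregular_morph/sigma_regular.
- by move=> b; exact: sigma_Fac pP.1.
- exact: Fac_surj.
move=> b /(sigma_section pP)[s [ms sb ns]]; exists s; split=> //.
by apply: filterS ns => X h [/h].
Qed.

Lemma Fac_open : projective I (qpoint_act p) ->
  exists2 O : set (affine_space (qpoint K Q d)), open O & Fac_P I p = Mod I d `&` O.
Proof.
move=> pP; exists (interior [set X | Mod I d X -> Fac_P I p X]).
  exact: open_interior.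
apply/seteqP; split=> X; last by case=> mX /interior_subset; exact.
move=> FX; split; first exact: FX.1.
have [b Bb <-] := Fac_surj FX; have [s [_ _ ns]] := sigma_section pP Bb.
apply: filterS ns => Y h /h[Bs <-]; exact: sigma_Fac pP.1 Bs.
Qed.

Lemma subfac_stable_corr : projective I (qpoint_act p) ->
  stable_corr (Sub_P p) (Fac_P I p) (Sub_orbit p) (@Fac_orbit K Q d) subfac.
Proof.
move=> pP.
(* Preimages are controlled only at points of [B_P], so an ambient open set is produced as the
   interior of an implication. *)
have open_rho O : open O -> exists2 O', open O' & B_P p `&` O' = B_P p `&` rho @^-1` O.
  move=> oO; exists (interior [set b | B_P p b -> O (rho b)]); first exact: open_interior.
  apply/seteqP; split=> b [Bb]; first by move=> /interior_subset h; split=> //; exact: h.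
  move=> Ob; split=> //; have := morph_at_nbhs (gm_morph rho_good_Sub Bb)
    (open_nbhs_nbhs (conj oO Ob)).
  by apply: filterS => c Oc _.
have open_sigma O : open O ->
    exists2 O', open O' & B_P p `&` O' = B_P p `&` sigma @^-1` O.
  move=> oO; exists (interior [set b | B_P p b -> O (sigma b)]).
    exact: open_interior.
  apply/seteqP; split=> b [Bb]; first by move=> /interior_subset h; split=> //; exact: h.
  move=> Ob; split=> //; have := morph_at_nbhs (gm_morph (sigma_good pP) Bb)
    (open_nbhs_nbhs (conj oO Ob)).
  by apply: filterS => c Oc _.
split.
- by move=> U X [b [Bb <- _]]; exact: (gm_im rho_good_Sub).
- by move=> U X [b [Bb _ <-]]; exact: (gm_im (sigma_good pP)).
- by move=> U /Sub_surj[b Bb bU]; exists (sigma b), b.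
- by move=> X /Fac_surj[b Bb bX]; exists (rho b), b.
- move=> U X U' UX; apply: subfac_Sub_orbit => //.
  by case: UX => b [Bb _ <-]; case: (sigma_Fac pP.1 Bb).
- by move=> U X X'; exact: subfac_Fac_orbit.
- move=> O /open_rho[O1 oO1 O1E].
  have [O' oO' O'E] := good_map_open (sigma_good pP) oO1.
  exists O' => //; rewrite O'E O1E; apply/seteqP; split=> X.
    by move=> [b [Bb Ob] <-]; exists (rho b) => //; exists b.
  by move=> [U OU [b [Bb bU <-]]]; exists b => //; split=> //=; rewrite bU.
- move=> O /open_sigma[O1 oO1 O1E].
  have [O' oO' O'E] := good_map_open rho_good_Sub oO1.
  exists O' => //; rewrite O'E O1E; apply/seteqP; split=> U.
    by move=> [b [Bb Ob] <-]; exists (sigma b) => //; exists b.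
  by move=> [X OX [b [Bb <- bX]]]; exists b => //; split=> //=; rewrite bX.
- move=> U /Sub_surj[b [ub _] <-].
  (* The commutant of P is a linear space, so it contains the lines joining its elements, and the
     automorphisms are its units. *)
  pose E := [set f : 'M[K]_(m + d) | forall a, f *m p a = p a *m f].
  have -> : [set U' | Sub_orbit p (rho b) U'] =
      [set U' | exists f, [/\ E f, f \in unitmx & U' = rho (f *m b)]].
    apply/seteqP; split=> U'.
      by move=> [f [uf fp] ->]; exists f; split=> //; rewrite rho_mul.
    by move=> [f [fp uf ->]]; exists f => //; rewrite rho_mul.
  apply: (@irreducible_units_image _ _ E _ (fun f => rho (f *m b))).
  + move=> f f' s Ef Ef' a; rewrite mulmxDl mulmxDr Ef; congr (_ + _).
    by rewrite -scalemxAl -scalemxAr mulmxBl mulmxBr Ef Ef'.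
  + by move=> a; rewrite mulmx1 mul1mx.
  + move=> f B uf; apply: morph_at_nbhs.
    apply: (morph_at_comp (f := fun f : affine_space 'M[K]_(m + d) =>
      (f *m b : affine_space 'M[K]_(m + d))) (g := rho)).
      exact/vregular_morph/mulmxr_regular.
    by apply: rho_morph; rewrite unitmx_mul uf.
- move=> X _.
  have -> : [set X' | Fac_orbit X X'] = [set X' | exists g : 'M[K]_d, [/\ setT g, g \in unitmx &
      X' = [ffun a => g *m X a *m invmx g]]].
    by apply/seteqP; split=> X' [g]; [move=> ug -> | move=> [_ ug ->]]; exists g.
  apply: (@irreducible_units_image K d setT (affine_space (qpoint K Q d))
    (fun g : affine_space 'M[K]_d => [ffun a => g *m X a *m invmx g])).
  + by [].
  + by [].
  + move=> g B ug; apply: morph_at_nbhs; apply: vregular_morph.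
    apply/vregular_ffun => a; under eq_fun do rewrite ffunE.
    apply: vregular_mulmx; last by apply: vregular_invmx => //; exact: vregular_id.
    exact: mulmxr_regular.
Qed.

End SigmaAlgebra.

(** * Closed conditions, and smoothness of the two projections *)

Lemma closed_forall (T : topologicalType) (J : Type) (P : J -> set T) :
  (forall j, closed (P j)) -> closed [set x | forall j, P j x].
Proof.
move=> cP; have -> : [set x | forall j, P j x] = \bigcap_j P j.
  by apply/seteqP; split=> x h j; [move=> _; exact: h | exact: h].
by apply: closed_bigI => j _; exact: cP.
Qed.

Lemma closed_mx_eq (K : fieldType) (V : vectType K) k l (F H : V -> 'M[K]_(k, l)) :
  (forall x, vregular_at F x) -> (forall x, vregular_at H x) ->
  closed ([set x | F x = H x] : set (affine_space V)).
Proof.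
move=> rF rH.
have -> : [set x | F x = H x] = [set x | forall ij, F x ij.1 ij.2 - H x ij.1 ij.2 = 0].
  apply/seteqP; split=> x /= h; first by move=> ij; rewrite h subrr.
  by apply/matrixP => i j; apply/eqP; rewrite -subr_eq0 (h (i, j)).
apply: closed_forall => ij; apply: closed_regular => x.
by apply: regular_sub; exact: regular_entry.
Qed.

Section Smoothness.
Context {K : closedFieldType} {Q : quiver} {I : set (pathalg K Q)}.
Context {m d : nat} {p : qpoint K Q (m + d)}.
Local Notation rho := (@rho K m d).
Local Notation sigma := (sigma p).
Local Notation G b := (dsubmx (invmx b) : 'M[K]_(d, m + d)).

Lemma Mod_closed : closed (Mod I d).
Proof.
have rX a (x : affine_space (qpoint K Q d)) : vregular_at (fun X : qpoint K Q d => X a) x.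
  by apply: (vregular_ffun _ _).1; exact: vregular_id.
have rpath (q : qpath Q) (v : 'cV[K]_d) (x : affine_space (qpoint K Q d)) :
    vregular_at (fun X => qpath_act (qpoint_act X) q v) x.
  have aux (s : seq (arrow Q)) (w : qpoint K Q d -> 'cV[K]_d) : vregular_at w x ->
      vregular_at (fun X => foldl (fun u a => qpoint_act X (inr a) u) (w X) s) x.
    elim: s w => //= a s IHs w rw; apply: (IHs (fun X => X (inr a) *m w X)).
    exact: vregular_mulmx.
  apply: (aux _ (fun X : qpoint K Q d => X (inl (qstart q)) *m v)).
  by apply: vregular_mulmx => //; exact: vregular_cst.
have -> : Mod I d =
    [set X : qpoint K Q d | forall i j (v : 'cV[K]_d), X (inl i) *m (X (inl j) *m v) =
       if i == j then X (inl i) *m v else 0] `&`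
    ([set X : qpoint K Q d | forall v : 'cV[K]_d, \sum_i X (inl i) *m v = v] `&`
    ([set X : qpoint K Q d | forall a (v : 'cV[K]_d),
       X (inl (tgt a)) *m (X (inr a) *m v) = X (inr a) *m v] `&`
    ([set X : qpoint K Q d | forall a (v : 'cV[K]_d),
       X (inr a) *m (X (inl (src a)) *m v) = X (inr a) *m v] `&`
    [set X : qpoint K Q d | forall x, forall Ix : I x, forall v : 'cV[K]_d,
       \sum_(q <- finmap.enum_fset (monalg.msupp x))
       monalg.mcoeff q x *: qpath_act (qpoint_act X) q v = 0]))).
  by apply/seteqP; split=> X; [case | move=> [? [? [? [? ?]]]]; split].
have rv (F : qpoint K Q d -> 'M[K]_d) (v : 'cV[K]_d) x : vregular_at F x ->
    vregular_at (fun X => F X *m v) x.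
  by move=> rF; apply: vregular_mulmx => //; exact: vregular_cst.
apply: closedI; [|apply: closedI; [|apply: closedI; [|apply: closedI]]].
- apply: closed_forall => i; apply: closed_forall => j; apply: closed_forall => v.
  apply: closed_mx_eq => x; first by apply: vregular_mulmx => //; exact: rv.
  by case: eqP => _; [exact: rv | exact: vregular_cst].
- apply: closed_forall => v; apply: closed_mx_eq => x; last exact: vregular_cst.
  by apply: vregular_sum => i; exact: rv.
- apply: closed_forall => a; apply: closed_forall => v.
  by apply: closed_mx_eq => x; [apply: vregular_mulmx => // |]; exact: rv.
- apply: closed_forall => a; apply: closed_forall => v.
  by apply: closed_mx_eq => x; [apply: vregular_mulmx => // |]; exact: rv.
- apply: closed_forall => y; apply: closed_forall => Iy; apply: closed_forall => v.
  apply: closed_mx_eq => x; last exact: vregular_cst.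
  move=> l.
  have -> : l \o (fun X : qpoint K Q d => \sum_(q <- finmap.enum_fset (monalg.msupp y))
      monalg.mcoeff q y *: qpath_act (qpoint_act X) q v) =
    (fun X => \sum_(q <- finmap.enum_fset (monalg.msupp y))
      monalg.mcoeff q y * l (qpath_act (qpoint_act X) q v)).
    apply/funext => X; rewrite /= linear_sum; apply: eq_bigr => q _.
    by rewrite linearZ.
  apply: regular_sum => q _; apply: regular_mul; first exact: regular_cst.
  exact: rpath.
Qed.

Lemma unitmx_open n : open ([set b | b \in unitmx] : set (affine_space 'M[K]_n)).
Proof.
rewrite openE => b ub; rewrite /interior.
by apply: (near_unitmx (F := fun b => b)) => //; exact: vregular_id.
Qed.

(** The open set [D] is there because smoothness is later applied to an affine piece of the preimage
    of [M]. In the slope chart, being a submodule is a set of regular equations, which joins the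
    pullback of [F'] in [FA]. *)
Lemma rho_smooth (M : set (grassmannian 'cV[K]_(m + d)))
    (R D : set (affine_space 'M[K]_(m + d)))
    (phi : sub_space R -> sub_space M) (x : sub_space R) :
  locally_closed_in (Sub_P p) M -> open D ->
  (forall b, R b <-> [/\ B_P p b, M (rho b) & D b]) ->
  (forall z, val (phi z) = rho (val z)) -> smooth_at phi x.
Proof.
move=> [O' [F' [oO' cF' ME]]] oD RE phiE.
set b0 : 'M[K]_(m + d) := val x.
have Rb0 : R b0 := set_mem (valP x).
have [[u0 _] Mb0 Db0] := (RE b0).1 Rb0.
pose W := ('M[K]_m * 'M[K]_(m + d, d))%type.
pose gamma (a : affine_space 'M[K]_(d, m)) : grassmannian 'cV[K]_(m + d) :=
  rho (b0 *m lower a).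
have uL a : b0 *m lower a \in unitmx by rewrite unitmx_mul u0 lower_unit.
have mgamma a : morph_at gamma a.
  apply: (morph_at_comp (f := fun a : affine_space 'M[K]_(d, m) =>
    (b0 *m lower a : affine_space 'M[K]_(m + d))) (g := rho)).
    exact/vregular_morph/mul_lower_regular.
  exact: rho_morph.
have cgamma : continuous gamma by move=> a; case: (mgamma a).
pose sub (a : 'M[K]_(d, m)) i := dlsubmx (invmx (b0 *m lower a) *m p i *m (b0 *m lower a)).
pose FA : set (affine_space 'M[K]_(d, m)) :=
  gamma @^-1` F' `&` [set a | forall i, sub a i = 0].
(* For fixed slope [a], the first [m] columns of [invmx b0 *m b] are determined by their upper
   block, and the last [d] columns are free. These are the fibre coordinates [W]. *)
pose eps (t : W) a : 'M[K]_(m + d) := b0 *m row_mx (col_mx t.1 (a *m t.1)) t.2.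
pose c (b : 'M[K]_(m + d)) := invmx b0 *m b.
have ceps t a : c (eps t a) = row_mx (col_mx t.1 (a *m t.1)) t.2 by exact: mulKmx.
have blk t a : c (eps t a) = block_mx t.1 (usubmx t.2) (a *m t.1) (dsubmx t.2).
  by rewrite ceps block_mxEh vsubmxK.
have ulE t a : ulsubmx (c (eps t a)) = t.1 by rewrite blk block_mxKul.
have slE t a : t.1 \in unitmx -> slope (c (eps t a)) = a.
  by move=> ut; rewrite /slope ulE blk block_mxKdl mulmxK.
have rhoE t a : t.1 \in unitmx -> eps t a \in unitmx -> rho (eps t a) = gamma a.
  move=> ut ue; rewrite -(@rho_lower_slope _ _ _ b0 (eps t a)) //; last first.
    by rewrite -/(c _) ulE.
  by rewrite -/(c _) slE.
pose eps' (t : affine_space ('M[K]_(d, m) * W)%type) : affine_space 'M[K]_(m + d) :=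
  eps t.2 t.1.
have reps t : vregular_at eps' t.
  apply: vregular_mulmx; first exact: vregular_cst.
  have r2 : vregular_at (fun t : ('M[K]_(d, m) * W)%type => t.2) t.
    by apply: vregular_snd; exact: vregular_id.
  have r21 := vregular_fst r2.
  apply: vregular_row_mx; last exact: vregular_snd.
  apply: vregular_col_mx => //; apply: vregular_mulmx => //.
  by apply: vregular_fst; exact: vregular_id.
pose O : set (affine_space ('M[K]_(d, m) * W)%type) :=
  [set t | [/\ t.2.1 \in unitmx, eps' t \in unitmx & D (eps' t)]].
have oO : open O.
  rewrite openE => t [u1 u2 Dt]; rewrite /interior.
  have n1 := near_unitmx (vregular_fst (vregular_snd (vregular_id t))) u1.
  have n2 := near_unitmx (reps t) u2.
  have n3 := morph_at_nbhs (vregular_morph (reps t)) (open_nbhs_nbhs (conj oD Dt)).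
  by apply: filterS3 n1 n2 n3.
pose V0 : set (affine_space 'M[K]_(m + d)) :=
  D `&` ([set b | b \in unitmx] `&` [set b | ulsubmx (c b) \in unitmx]).
have ul0 : ulsubmx (c b0) = 1%:M by rewrite /c mulVmx // scalar_mx_block block_mxKul.
apply: (@smooth_at_chart K _ _ R M phi rho x 'M[K]_(d, m) W V0 (chart_domain b0)
  (gamma @^-1` O') FA O (chart_slope b0) gamma
  (fun b => (ulsubmx (c b), rsubmx (c b)) : W) eps').
- exact: phiE.
- apply: openI => //; apply: openI; first exact: unitmx_open.
  exact: (@open_ul_unit _ _ _ b0).
- by split=> //; split=> //=; rewrite ul0 unitmx1.
- exact: (@chart_domain_open _ _ _ b0).
- by move/continuousP: cgamma; exact.
- apply: closedI; first by move/continuous_closedP: cgamma; exact.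
  apply: closed_forall => i; apply: closed_mx_eq => a; last exact: vregular_cst.
  have rl := mul_lower_regular b0 a.
  apply: vregular_lsubmx; apply: vregular_dsubmx; apply: vregular_mulmx => //.
  by apply: vregular_mulmx; [exact: vregular_invmx | exact: vregular_cst].
- exact: oO.
- by move=> z _ [_ [uz uc]]; exists z.
- move=> U MU DU; have UE := chart_slopeK u0 DU.
  have [[[dU sU] O'U] F'U] : (Sub_P p `&` O' `&` F') U by rewrite -ME.
  split; first exact: chart_slope_morph.
  + by rewrite /= /gamma UE.
  + split; first by rewrite /= /gamma UE.
    by apply/submodule_rhoP => //; rewrite UE.
  + exact: UE.
- move=> a O'a [F'a sa]; split=> //.
  + rewrite ME; split=> //; split=> //; split; first exact: dim_rho.
    exact/submodule_rhoP.
  + exists (b0 *m lower a) => //; split=> //=.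
    by rewrite mulKmx // block_mxKul unitmx1.
  + rewrite chart_slopeE //; first by rewrite mulKmx // slope_lower.
    by rewrite mulKmx // block_mxKul unitmx1.
- move=> z Rz [Dz [uz uc]].
  have zE : eps' (chart_slope b0 (rho z), (ulsubmx (c z), rsubmx (c z))) = z.
    rewrite /eps' /eps /= chart_slopeE // -/(c z) /slope mulmxKV //.
    rewrite -[col_mx _ _]/(col_mx (ulsubmx (c z)) (dlsubmx (c z))).
    have -> : col_mx (ulsubmx (c z)) (dlsubmx (c z)) = lsubmx (c z).
      rewrite -[in RHS](submxK (c z)) block_mxEh row_mxKl //.
    by rewrite hsubmxK mulKVmx.
  split=> //; last by split=> //=; rewrite zE.
  apply: vregular_morph; apply: vregular_pair.
    have Dz' : chart_domain b0 (rho z) by exists z.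
    exact: morph_regular (morph_at_comp (rho_morph uz) (chart_slope_morph Dz')).
  have rc := mulmxl_regular (invmx b0) z.
  apply: vregular_pair; last exact: vregular_rsubmx.
  by apply: vregular_lsubmx; exact: vregular_usubmx.
- move=> [a t] /= O'a [F'a sa] [u1 u2 Dt] /=.
  have rE := rhoE t a u1 u2.
  have Mg : M (gamma a).
    rewrite ME; split=> //; split=> //; split; first exact: dim_rho.
    exact/submodule_rhoP.
  split=> //.
  + exact/vregular_morph/reps.
  + apply/RE; split=> //; last by rewrite rE.
    split=> //; rewrite rE; exact/submodule_rhoP.
  + by split=> //; split=> //=; rewrite ulE.
  + by rewrite /eps' /= ulE ceps row_mxKr; case: t {u1 u2 Dt rE}.
Qed.

(** A matrix [b] is recovered from [X = sigma b], the upper rows of its inverse, which are free, and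
    the lower rows, which lie in Hom(P, X). Identifying that space with a fixed one makes the fibres
    open pieces of [W]. *)
Lemma sigma_smooth (N : set (affine_space (qpoint K Q d)))
    (R D : set (affine_space 'M[K]_(m + d)))
    (phi : sub_space R -> sub_space N) (x : sub_space R) :
  projective I (qpoint_act p) -> locally_closed_in (Fac_P I p) N -> open D ->
  (forall b, R b <-> [/\ B_P p b, N (sigma b) & D b]) ->
  (forall z, val (phi z) = sigma (val z)) -> smooth_at phi x.
Proof.
move=> pP [O' [F' [oO' cF' NE]]] oD RE phiE.
set b0 : 'M[K]_(m + d) := val x.
have [Bb0 Nb0 Db0] := (RE b0).1 (set_mem (valP x)).
have u0 := Bb0.1.
have [OF oOF FacE] := @Fac_open K Q I m d p pP.
have [T [pT hT]] := hom_projector d pP.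
have [mX0 _] := sigma_Fac pP.1 Bb0.
pose T0 := T (sigma b0).
have TT X : Mod I d X -> T X *m T X = T X.
  move=> mX; apply/row_matrixP => i; rewrite !rowE mulmxA.
  rewrite -[delta_mx 0 i](vec_mxK) -[mxvec _ *m T X]vec_mxK.
  by rewrite (hT X mX).2 //; exact: (hT X mX).1.
have T0T0 : T0 *m T0 = T0 := TT _ mX0.
(* conjugates the projector [T0] to [T X] whenever it is invertible *)
pose S X := T0 *m T X + (1%:M - T0) *m (1%:M - T X).
have S0 : S (sigma b0) = 1%:M.
  rewrite /S -/T0 T0T0 mulmxBl mul1mx mulmxBr mulmx1 T0T0 subrr subr0.
  by rewrite addrC subrK.
have T0S X : T0 *m S X = T0 *m T X.
  have T0c : T0 *m (1%:M - T0) = 0 by rewrite mulmxBr mulmx1 T0T0 subrr.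
  by rewrite /S mulmxDr !mulmxA T0T0 T0c mul0mx addr0.
have ST X : Mod I d X -> S X *m T X = T0 *m T X.
  move=> mX; have cT : (1%:M - T X) *m T X = 0.
    by rewrite mulmxBl mul1mx TT // subrr.
  by rewrite /S mulmxDl -!mulmxA TT // cT mulmx0 addr0.
(* The rows of [Rb] are a basis of the flattened homomorphisms from P to [sigma b0]. For a module
   [X], right multiplication by [S X] sends them into the image of [T X], and to a basis of it where
   [S X] is invertible. *)
pose Rb := row_base T0.
have RbT : Rb *m T0 = Rb.
  have /submxP[C CE] : (Rb <= T0)%MS by rewrite eq_row_base.
  by rewrite CE -mulmxA T0T0.
have rT x' : vregular_at T x'.
  by apply: vregular_mx => k l; exact: regular_polyfun.
have rS x' : vregular_at S x'.
  apply: vregular_add; first exact: vregular_comp (rT _) (mulmxl_regular _ _).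
  apply: vregular_comp (mulmxl_regular _ _).
  by apply: vregular_add; [exact: vregular_cst | exact: vregular_opp].
pose k := \rank T0.
pose W := ('M[K]_(m, m + d) * 'rV[K]_k)%type.
pose hom X (w : 'rV[K]_k) : 'M[K]_(d, m + d) := vec_mx (w *m Rb *m S X).
have homP X w : Mod I d X -> mx_hom p X (hom X w).
  move=> mX; have -> : hom X w = vec_mx (mxvec (hom X w) *m T X).
    by rewrite /hom vec_mxK -[_ *m T X]mulmxA ST // -T0S -{1}RbT !mulmxA.
  exact: (hT X mX).1.
have homK X (A : 'M[K]_(d, m + d)) : Mod I d X -> S X \in unitmx -> mx_hom p X A ->
    hom X (mxvec A *m invmx (S X) *m pinvmx Rb) = A.
  move=> mX uS hA; rewrite /hom mulmxKpV; first by rewrite mulmxKV // mxvecK.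
  rewrite (eq_row_base T0).
  have STV : invmx (S X) *m T0 = T X *m invmx (S X).
    apply: (can_inj (mulKmx uS)); rewrite mulKVmx // mulmxA ST // -T0S.
    by rewrite mulmxK.
  have <- : mxvec A *m invmx (S X) *m T0 = mxvec A *m invmx (S X).
    by rewrite -mulmxA STV mulmxA (hT X mX).2.
  exact: submxMl.
pose eps' (t : affine_space (qpoint K Q d * W)%type) : affine_space 'M[K]_(m + d) :=
  invmx (col_mx t.2.1 (hom t.1 t.2.2)).
pose ceps (t : affine_space (qpoint K Q d * W)%type) : 'M[K]_(m + d) :=
  col_mx t.2.1 (hom t.1 t.2.2).
have rceps t : vregular_at ceps t.
  have r1 := vregular_fst (vregular_id (t : affine_space (qpoint K Q d * W)%type)).
  have r2 := vregular_snd (vregular_id (t : affine_space (qpoint K Q d * W)%type)).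
  apply: vregular_col_mx; first exact: vregular_fst.
  apply: (vregular_lin_comp (F := fun t : (qpoint K Q d * W)%type => t.2.2 *m Rb *m S t.1)).
  apply: vregular_mulmx; last exact: vregular_comp r1 (rS _).
  by apply: vregular_mulmx; [exact: vregular_snd | exact: vregular_cst].
have reps t : ceps t \in unitmx -> vregular_at eps' t.
  by move=> ut; exact: vregular_invmx.
pose U0 : set (affine_space (qpoint K Q d)) := [set X | S X \in unitmx].
have oU0 : open U0.
  by rewrite openE => X uX; rewrite /interior; exact: near_unitmx.
pose O : set (affine_space (qpoint K Q d * W)%type) :=
  [set t | ceps t \in unitmx /\ D (eps' t)].
have oO : open O.
  rewrite openE => t [u1 Dt]; rewrite /interior.
  have n1 := near_unitmx (rceps t) u1.
  have n2 := morph_at_nbhs (vregular_morph (reps t u1)) (open_nbhs_nbhs (conj oD Dt)).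
  by apply: filterS2 n1 n2.
pose V0 : set (affine_space 'M[K]_(m + d)) :=
  D `&` [set b | b \in unitmx /\ U0 (sigma b)].
have oV0 : open V0.
  apply: openI => //; rewrite openE => b [ub Ub]; rewrite /interior.
  have n1 := open_nbhs_nbhs (conj (@unitmx_open (m + d)) ub).
  have n2 := morph_at_nbhs (vregular_morph (sigma_regular (p := p) ub))
    (open_nbhs_nbhs (conj oU0 Ub)).
  by apply: filterS2 n1 n2.
pose beta b : W := (usubmx (invmx b),
  mxvec (G b) *m invmx (S (sigma b)) *m pinvmx Rb).
apply: (@smooth_at_chart K _ _ R N phi sigma x (qpoint K Q d) W V0 U0
  (U0 `&` (O' `&` OF)) (Mod I d `&` F') O id id beta eps').
- exact: phiE.
- exact: oV0.
- by split=> //; split=> //; rewrite /U0 /= S0 unitmx1.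
- exact: oU0.
- by apply: openI => //; exact: openI.
- by apply: closedI => //; exact: Mod_closed.
- exact: oO.
- by move=> z _ [_ []].
- move=> X NX UX; move: NX; rewrite NE FacE => -[[[mX OX] O'X] F'X].
  by split=> //; exact: morph_at_id.
- move=> X [UX [O'X OX]] [mX F'X]; split=> //; first exact: morph_at_id.
  by rewrite NE FacE.
- move=> z /RE[Bz Nz Dz] [_ [uz Uz]].
  have [mX _] := sigma_Fac pP.1 Bz.
  have hG := (sigmaP (sigma z) uz).1 (conj Bz erefl).
  have cE : ceps (sigma z, beta z) = invmx z by rewrite /ceps /= homK // vsubmxK.
  have zE : eps' (sigma z, beta z) = z by rewrite /eps' -/(ceps _) cE invmxK.
  split=> //; last by split=> //=; rewrite ?zE // cE unitmx_inv.
  have rs := sigma_regular (p := p) uz.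
  have ri := vregular_invmx (vregular_id z) uz.
  apply: vregular_morph; apply: vregular_pair => //; apply: vregular_pair.
    exact: vregular_usubmx.
  apply: vregular_mulmx; last exact: vregular_cst.
  apply: vregular_mulmx.
    apply: (vregular_lin_comp (F := fun b : 'M[K]_(m + d) => G b)).
    exact: vregular_dsubmx.
  by apply: vregular_invmx => //; exact: vregular_comp rs (rS _).
- move=> [X [c1 w]] /= [UX [O'X OX]] [mX F'X] [ut Dt].
  have ue : eps' (X, (c1, w)) \in unitmx by rewrite unitmx_inv.
  have GE : G (eps' (X, (c1, w))) = hom X w by rewrite invmxK col_mxKd.
  have [Be sE] := (sigmaP X ue).2 (eq_ind_r (mx_hom p X) (homP X w mX) GE).
  split=> //.
  + exact/vregular_morph/reps.
  + by apply/RE; split=> //; rewrite sE NE FacE.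
  + by split=> //; split=> //; rewrite sE.
  + rewrite /beta sE GE; congr (_, _); first by rewrite invmxK col_mxKu.
    rewrite /hom vec_mxK mulmxK //.
    by rewrite mulmxKp // row_base_free.
Qed.

End Smoothness.

(** * Orbits, quotients and singularities over a common preimage *)

Section Correspondence.
Context {K : closedFieldType} {Q : quiver} {I : set (pathalg K Q)}.
Context {m d : nat} {p : qpoint K Q (m + d)}.
Context (pP : projective I (qpoint_act p)).
Local Notation rho := (@rho K m d).
Local Notation sigma := (sigma p).
Local Notation st := (stable_subset (Sub_orbit p) (Sub_P p)).

Lemma corrE M : corr p M = rel_image (subfac (p := p)) M.
Proof.
apply/seteqP; split=> X.
  by move=> [b [Bb Mb] <-]; exists (rho b) => //; exists b.
by move=> [U MU [b [Bb bU <-]]]; exists b => //; split=> //=; rewrite bU.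
Qed.

(** Both [M] and its partner have the same preimage in [B_P], so the two quotient problems can be
    compared on one space. *)
Lemma rho_inv_sigma M : st M -> rho_inv p M = B_P p `&` sigma @^-1` corr p M.
Proof.
move=> sM; rewrite corrE; apply/seteqP; split=> b [Bb Mb]; split=> //.
  by exists (rho b) => //; exists b.
by apply/(rel_imageE (subfac_stable_corr pP) (y := sigma b) sM) => //; exists b.
Qed.

Lemma B_orbit_rho b b' : B_P p b -> B_P p b' ->
  B_orbit p b b' <-> Sub_orbit p (rho b) (rho b').
Proof.
move=> Bb Bb'; have ub := Bb.1; have ub' := Bb'.1; split.
  move=> [f [h [[uf fp] ph b'E]]]; exists (invmx f).
    split=> [|a]; first by rewrite unitmx_inv.
    by apply: (can_inj (mulKmx uf)); rewrite mulKVmx // [RHS]mulmxA fp mulmxK.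
  rewrite -rho_mul; apply/rho_parabolic => //; last by exists h.
  by rewrite unitmx_mul unitmx_inv uf.
move=> [f [uf fp]]; rewrite -rho_mul => bb'.
have ufb : f *m b \in unitmx by rewrite unitmx_mul uf.
have /(rho_parabolic ufb ub')[h ph b'E] := bb'.
exists (invmx f), h; rewrite invmxK; split=> //; split=> [|a].
  by rewrite unitmx_inv.
by apply: (can_inj (mulKmx uf)); rewrite mulKVmx // [RHS]mulmxA fp mulmxK.
Qed.

Lemma B_orbit_sigma b b' : B_P p b -> B_P p b' ->
  B_orbit p b b' <-> Fac_orbit (sigma b) (sigma b').
Proof.
move=> Bb Bb'; have sc := subfac_stable_corr pP.
have E : subfac (p := p) (rho b) (sigma b) by exists b.
have E' : subfac (p := p) (rho b') (sigma b') by exists b'.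
split.
  move=> /(B_orbit_rho Bb Bb')/(sc_orb1 sc _ E) h.
  have h' : Sub_orbit p (rho b') (rho b) by exact/(sc_orb1 sc _ h).
  by apply/(sc_orb2 sc _ E)/(sc_orb1 sc _ E').
move=> /(sc_orb2 sc _ E) h; apply/(B_orbit_rho Bb Bb').
have h' : Sub_orbit p (rho b') (rho b) by exact/(sc_orb1 sc _ E').
by apply/(sc_orb1 sc _ h); exact: E'.
Qed.

Lemma rho_good_restrict M : st M -> good_map (rho_inv p M) M rho.
Proof. by move=> sM; exact: good_map_restrict sM.1 rho_good_Sub. Qed.

Lemma corr_stable M : stable_subset (@Fac_orbit K Q d) (Fac_P I p) (corr p M).
Proof. by rewrite corrE; exact: (rel_image_stable (subfac_stable_corr pP) M). Qed.

Lemma sigma_good_restrict M : st M -> good_map (rho_inv p M) (corr p M) sigma.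
Proof.
move=> sM; rewrite rho_inv_sigma //.
exact: good_map_restrict (corr_stable M).1 (sigma_good pP).
Qed.

Lemma sub_quotient_pull (X Y Z : kspace K) (A : set X) (B : set Y) (f : X -> Y)
    (orb : X -> X -> Prop) (orb' : Y -> Y -> Prop) (phi : sub_space B -> Z) :
  good_map A B f ->
  (forall x x', A x -> A x' -> orb x x' <-> orb' (f x) (f x')) ->
  sub_quotient orb' phi ->
  exists phi' : sub_space A -> Z, sub_quotient orb phi'.
Proof.
move=> gf oo q; have [mf sf lf] := good_map_sub gf.
exists (phi \o sub_fun (gm_im gf)); apply: quotient_pull mf sf lf _ q => x y.
by apply: oo; [exact: (set_mem (valP x)) | exact: (set_mem (valP y))].
Qed.

Lemma sub_quotient_push (X Y Z : kspace K) (A : set X) (B : set Y) (f : X -> Y)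
    (orb : X -> X -> Prop) (orb' : Y -> Y -> Prop) (phi : sub_space A -> Z) :
  good_map A B f ->
  (forall x x', A x -> A x' -> orb x x' <-> orb' (f x) (f x')) ->
  sub_quotient orb phi ->
  exists phi' : sub_space B -> Z, sub_quotient orb' phi'.
Proof.
move=> gf oo q; have [mf sf lf] := good_map_sub gf.
apply: quotient_push mf sf lf _ q => x y.
by apply: oo; [exact: (set_mem (valP x)) | exact: (set_mem (valP y))].
Qed.

Lemma sub_quotient_unique (X Y1 Y2 : kspace K) (A : set X) (orb : X -> X -> Prop)
    (phi1 : sub_space A -> Y1) (phi2 : sub_space A -> Y2) :
  sub_quotient orb phi1 -> sub_quotient orb phi2 -> isomorphic Y1 Y2.
Proof.
move=> q1 q2; have [[[pY1 _] _] _ _ _ _] := q1; have [[[pY2 _] _] _ _ _ _] := q2.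
apply: quotient_unique q1 q2 => y; exact: nice_prevariety.
Qed.

Lemma rho_inv_locally_closed M : locally_closed_in (Sub_P p) M ->
  exists O F : set (affine_space 'M[K]_(m + d)),
    [/\ open O, closed F & rho_inv p M = O `&` F].
Proof.
move=> [O' [F' [oO' cF' ME]]].
(* Nothing is known about [rho] at singular matrices, so the violations of the closed conditions are
   collected among invertible ones only. This set is open, and its complement is the required closed
   set. *)
pose N : set (affine_space 'M[K]_(m + d)) :=
  [set b | b \in unitmx /\ (~ F' (rho b) \/ ~ is_submodule p (rho b))].
exists [set b | b \in unitmx /\ O' (rho b)], (~` N); split.
- rewrite openE => b [ub Ob]; rewrite /interior.
  have n1 := open_nbhs_nbhs (conj (@unitmx_open K (m + d)) ub).
  have n2 := morph_at_nbhs (rho_morph ub) (open_nbhs_nbhs (conj oO' Ob)).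
  by apply: filterS2 n1 n2.
- apply: open_closedC; rewrite openE => b [ub nb]; rewrite /interior.
  have n1 := open_nbhs_nbhs (conj (@unitmx_open K (m + d)) ub).
  case: nb => nb.
    have n2 := morph_at_nbhs (rho_morph ub)
      (open_nbhs_nbhs (conj (closed_openC cF') nb)).
    by apply: filterS2 n1 n2 => c uc nc; split=> //; left.
  have [a [i [j aij]]] : exists a i j, dlsubmx (invmx b *m p a *m b) i j != 0.
    apply: contrapT => h; apply: nb; apply/submodule_rhoP => // a.
    apply/matrixP => i j; rewrite [RHS]mxE; apply/eqP/negPn/negP => aij.
    by apply: h; exists a, i, j.
  have r : vregular_at (fun b => dlsubmx (invmx b *m p a *m b)) b.
    apply: vregular_lsubmx; apply: vregular_dsubmx.
    apply: vregular_mulmx; last exact: vregular_id.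
    apply: vregular_mulmx; last exact: vregular_cst.
    by apply: vregular_invmx => //; exact: vregular_id.
  have n2 := regular_neq0 (regular_entry i j r) aij.
  apply: filterS2 n1 n2 => c uc nc; split=> //; right=> /(submodule_rhoP uc) /(_ a) h.
  by move: nc; rewrite h mxE eqxx.
- apply/seteqP; split=> b.
    move=> [[ub sb]]; rewrite /= ME => -[[Sb Ob] Fb]; split=> //.
    by move=> [_ []].
  move=> [[ub Ob] nb].
  have sb : is_submodule p (rho b).
    by apply: contrapT => h; apply: nb; split=> //; right.
  split=> //; rewrite /= ME; split; last first.
    by apply: contrapT => h; apply: nb; split=> //; left.
  by split=> //; split=> //; exact: dim_rho.
Qed.

Lemma corr_locally_closed M : st M ->
  locally_closed_in (Sub_P p) M <-> locally_closed_in (Fac_P I p) (corr p M).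
Proof.
have sc := subfac_stable_corr pP; move=> sM; rewrite corrE; split.
  exact: (rel_image_locally_closed sc sM).
move/(rel_image_locally_closed (stable_corr_sym sc) (rel_image_stable sc M)).
by rewrite (rel_imageK sc sM).
Qed.

(** The linking variety is a principal open piece around [b] of the preimage of [M]: being affine,
    it is a variety, and both projections restricted to it are smooth. *)
Lemma corr_same_singularity M (b : 'M[K]_(m + d)) (x : sub_space M)
    (y : sub_space (corr p M)) :
  st M -> locally_closed_in (Sub_P p) M ->
  B_P p b -> rho b = val x -> sigma b = val y -> same_singularity x y.
Proof.
move=> sM lM Bb bx by_.
have lN := (corr_locally_closed sM).1 lM.
have [O [F [oO cF rE]]] := rho_inv_locally_closed lM.
have Mb : rho_inv p M b by split=> //=; rewrite bx; exact: (set_mem (valP x)).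
have Ob : O b by move: Mb; rewrite rE => -[].
have [q pq [qb qO]] := (oO : zariski_open O) b Ob.
pose D : set (affine_space 'M[K]_(m + d)) := [set c | q c != 0].
have oD : open D by exact: open_nonzero.
pose R : set (affine_space 'M[K]_(m + d)) := F `&` D.
have RE c : R c <-> rho_inv p M c /\ D c.
  by rewrite rE; split=> [[Fc Dc]|[[]]] //; split=> //; split=> //; exact: qO.
have R1 c : R c <-> [/\ B_P p c, M (rho c) & D c].
  by split=> [/RE[[Bc Mc] Dc]|[Bc Mc Dc]] //; apply/RE.
have R2 c : R c <-> [/\ B_P p c, corr p M (sigma c) & D c].
  split=> [/RE[]|[Bc Nc Dc]].
    by rewrite rho_inv_sigma // => -[Bc Nc] Dc.
  by apply/RE; rewrite rho_inv_sigma.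
have f1 c : R c -> M (rho c) by case/R1.
have f2 c : R c -> corr p M (sigma c) by case/R2.
have Rb : R b by apply/RE.
exists (sub_space R), (to_sub Rb), (sub_fun f1), (sub_fun f2); split.
- exact/affine_variety_sub/principal_affine_variety.
- split=> [|z]; last exact: (@rho_smooth K Q m d p M R D (sub_fun f1) z lM oD R1).
  apply/kmorphismP => z; apply: sub_fun_morph; apply: rho_morph.
  by have [[uz _] _ _] := (R1 _).1 (set_mem (valP z)).
- split=> [|z]; last first.
    exact: (@sigma_smooth K Q I m d p _ R D (sub_fun f2) z pP lN oD R2).
  apply/kmorphismP => z; apply: sub_fun_morph; apply: vregular_morph.
  by apply: sigma_regular; have [[uz _] _ _] := (R1 _).1 (set_mem (valP z)).
- exact: val_inj.
- exact: val_inj.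
Qed.

End Correspondence.

Theorem propositionC (K : closedFieldType) (Q : quiver)
    (I : set (pathalg K Q)) (I_admissible : admissible I)
    (m d : nat) (p : qpoint K Q (m + d)) (p_Mod : Mod I (m + d) p)
    (P_projective : projective I (qpoint_act p)) :
  let SubP := Sub_P p in
  let FacP := Fac_P I p in
  let stSub := stable_subset (Sub_orbit p) SubP in
  let stFac := stable_subset (@Fac_orbit K Q d) FacP in
  let Phi := corr p in
  (* the inclusion-preserving one-to-one correspondence *)
  [/\ set_bij stSub stFac Phi &
      forall M M', stSub M -> stSub M' -> (M `<=` M' <-> Phi M `<=` Phi M')]
  /\
  (* openness and closures *)
  (forall M, stSub M ->
    (open_in SubP M <-> open_in FacP (Phi M)) /\
    [/\ stSub (closure_in SubP M),
        stFac (closure_in FacP (Phi M)) &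
        Phi (closure_in SubP M) =
          closure_in FacP (Phi M)])
  /\
  (* connected and irreducible components of stable subsets *)
  (forall M, stSub M ->
    [/\ forall C, is_connected_component M C -> stSub C,
        forall D, is_connected_component (Phi M) D -> stFac D &
        forall C, stSub C ->
          (is_connected_component M C <->
           is_connected_component (Phi M) (Phi C))] /\
    [/\ forall C, is_irreducible_component M C -> stSub C,
        forall D, is_irreducible_component (Phi M) D -> stFac D &
        forall C, stSub C ->
          (is_irreducible_component M C <->
           is_irreducible_component (Phi M) (Phi C))])
  /\
  (* subvarieties and types of singularities *)
  (forall M, stSub M ->
    (locally_closed_in SubP M <-> locally_closed_in FacP (Phi M)) /\
    (locally_closed_in SubP M ->
     forall (b : 'M[K]_(m + d)) (x : sub_space M) (y : sub_space (Phi M)),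
       B_P p b -> rho b = val x -> sigma p b = val y ->
       same_singularity x y))
  /\
  (* geometric quotients *)
  (forall M, stSub M -> locally_closed_in SubP M ->
    ((exists (Y : kspace K) (phi : sub_space M -> Y),
        sub_quotient (Sub_orbit p) phi) <->
     (exists (Y : kspace K) (phi : sub_space (Phi M) -> Y),
        sub_quotient (@Fac_orbit K Q d) phi)) /\
    ((exists (Y : kspace K) (phi : sub_space M -> Y),
        sub_quotient (Sub_orbit p) phi) ->
     (exists (Y : kspace K) (phi : sub_space (rho_inv p M) -> Y),
        sub_quotient (B_orbit p) phi) /\
     forall (Y1 Y2 Y3 : kspace K) (phi1 : sub_space M -> Y1)
       (phi2 : sub_space (Phi M) -> Y2) (phi3 : sub_space (rho_inv p M) -> Y3),
       sub_quotient (Sub_orbit p) phi1 ->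
       sub_quotient (@Fac_orbit K Q d) phi2 ->
       sub_quotient (B_orbit p) phi3 ->
       isomorphic Y1 Y3 /\ isomorphic Y2 Y3)).
Proof.
move=> SubP FacP stSub stFac Phi.
have sc := subfac_stable_corr P_projective; have cs := stable_corr_sym sc.
have PhiE : Phi = rel_image (subfac (p := p)) by apply/funext => M; exact: corrE.
(* Turns one-way transports, along the correspondence and along its inverse, into an equivalence;
   serves both kinds of components. *)
have iff_of
    (P : set (grassmannian 'cV[K]_(m + d)) -> set (grassmannian 'cV[K]_(m + d)) ->
      Prop)
    (P' : set (affine_space (qpoint K Q d)) -> set (affine_space (qpoint K Q d)) -> Prop) :
  (forall M C, stSub M -> stSub C -> P M C -> P' (Phi M) (Phi C)) ->
  (forall N D, stFac N -> stFac D -> P' N D ->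
     P (rel_image (fun y x => subfac (p := p) x y) N)
       (rel_image (fun y x => subfac (p := p) x y) D)) ->
  forall M C, stSub M -> stSub C -> P M C <-> P' (Phi M) (Phi C).
- move=> h1 h2 M C sM sC; split; first exact: h1.
  rewrite PhiE => h; have := h2 _ _ (rel_image_stable sc M) (rel_image_stable sc C) h.
  by rewrite !(rel_imageK sc).
split.
  rewrite PhiE; split; first exact: (rel_image_bij sc).
  by move=> M M' sM sM'; exact: (rel_image_sub sc sM sM').
split.
  move=> M sM; split; first by rewrite PhiE; exact: (rel_image_openE sc sM).
  have sN : stFac (Phi M) by rewrite PhiE; exact: (rel_image_stable sc M).
  split; first exact: (closure_in_stable sc sM).
    exact: (closure_in_stable cs sN).
  by rewrite PhiE; exact: (rel_image_closure_in sc sM).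
split.
  move=> M sM; have sN : stFac (Phi M) by rewrite PhiE; exact: (rel_image_stable sc M).
  split; split.
  - by move=> C; exact: (connected_component_stable sc sM).
  - by move=> C; exact: (connected_component_stable cs sN).
  - move=> C sC.
    apply: (iff_of (@is_connected_component _) (@is_connected_component _)) sM sC =>
      [M' C' sM' sC'|].
      by rewrite PhiE; exact: (rel_image_connected_component sc sM' sC').
    by move=> N D sN' sD; exact: (rel_image_connected_component cs sN' sD).
  - by move=> C; exact: (irreducible_component_stable sc sM).
  - by move=> C; exact: (irreducible_component_stable cs sN).
  - move=> C sC.
    apply: (iff_of (@is_irreducible_component _) (@is_irreducible_component _)) sM sC =>
      [M' C' sM' sC'|].
      by rewrite PhiE; exact: (rel_image_irreducible_component sc sM' sC').
    by move=> N D sN' sD; exact: (rel_image_irreducible_component cs sN' sD).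
split.
  move=> M sM; split; first exact: (corr_locally_closed P_projective sM).
  by move=> lM b x y; exact: (corr_same_singularity P_projective sM lM).
move=> M sM _.
have g1 := rho_good_restrict sM; have g2 := sigma_good_restrict P_projective sM.
have o1 b b' : rho_inv p M b -> rho_inv p M b' ->
    B_orbit p b b' <-> Sub_orbit p (rho b) (rho b').
  by move=> [Bb _] [Bb' _]; exact: B_orbit_rho.
have o2 b b' : rho_inv p M b -> rho_inv p M b' ->
    B_orbit p b b' <-> Fac_orbit (sigma p b) (sigma p b').
  by move=> [Bb _] [Bb' _]; exact: (B_orbit_sigma P_projective).
split.
  (* A quotient is pulled back to [rho_inv p M] along one map and pushed down along the other, with
     the same target [Y]. *)
  split=> -[Y [phi q]]; exists Y.
    have [phi' q'] := sub_quotient_pull g1 o1 q.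
    exact: (sub_quotient_push g2 o2 q').
  have [phi' q'] := sub_quotient_pull g2 o2 q.
  exact: (sub_quotient_push g1 o1 q').
move=> [Y [phi q]]; split; first by exists Y; exact: (sub_quotient_pull g1 o1 q).
move=> Y1 Y2 Y3 phi1 phi2 phi3 q1 q2 q3.
(* All three targets become quotients of [rho_inv p M] for the same relation, so uniqueness
   applies. *)
have [phi1' q1'] := sub_quotient_pull g1 o1 q1.
have [phi2' q2'] := sub_quotient_pull g2 o2 q2.
by split; [exact: (sub_quotient_unique q1' q3) | exact: (sub_quotient_unique q2' q3)].
Qed.
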